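(* Let $\Omega\subset\mathbb R^{n+1}$ be a bounded domain of class $C^2$ with boundary $S=\partial\Omega$ and $\beta\in C^1(S,(0,\pi))$. Let $V\in\mathbf V^m_\beta(\Omega)$ with boundary varifold $\Gamma$, such that $\mathbf H\in L^p(\mu_V)$ for some $p\in(m,\infty)$. Let $x_0\in\mathscr P_{\rm cb}(\Gamma)$ be a capillary boundary point with corresponding factors $\epsilon_0,\rho_0,c_0$ and $\tau^V_{x_0}$. Then there exists $\Lambda=\Lambda(m,p,S,\|\mathbf H\|_{L^p(\mu_V)},\epsilon_0,c_0,\cos\beta(x_0))>0$ such that the function $$\rho\mapsto e^{\Lambda\rho}\left(\left(\frac{\mu_V(B_\rho(x_0))}{\rho^m}\right)^{\frac1p}+\Lambda\rho^{\frac{p-m}p}\right)$$ is monotone increasing on $(0,\min\{\rho_0,\frac{\rho_S}2\})$. Moreover, there exists an increasing function $g_{x_0}:\mathbb R^+\to\mathbb R^+$ such that for any $0<r<\rho<\min\{\rho_0,\frac{\rho_S}2\}$ $$\frac{\mu_V(B_r(x_0))}{r^m}\le\frac{\mu_V(B_\rho(x_0))}{\rho^m}+g_{x_0}(\rho),$$ where $\lim_{\rho\searrow0}g_{x_0}(\rho)=0$.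
   Context: Notation: $n\ge2$, $m\in\mathbb N$, $1\le m\le n$. $B_r(x)$ is the closed ball in $\mathbb R^{n+1}$. $G(m,n+1)$ is the Grassmannian of unoriented $m$-dimensional linear subspaces of $\mathbb R^{n+1}$; for a plane $P$ and a vector $v$, $P(v)$ is the orthogonal projection of $v$ onto $P$ (likewise $T_xS(v)$). $G_m(U)=U\times G(m,n+1)$. $\nu^S$ is the inward pointing unit normal along $S$. $\rho_S>0$ is a constant such that the normal exponential map $(x,\rho)\mapsto x+\rho\nu^S(x)$ is a diffeomorphism from $S\times[0,\rho_S)$ onto a one-sided tubular neighbourhood of $S$. An $m$-varifold on $\overline\Omega$ is a positive Radon measure $V$ on $G_m(\overline\Omega)$; $\mu_V$ is its push-forward to $\overline\Omega$; $\delta V(\varphi)=\int_{G_m(\overline\Omega)}\mathrm{div}_P\varphi(x)\,dV(x,P)$. $\mathfrak X_t(\Omega)=\{\varphi\in C^1(\overline\Omega,\mathbb R^{n+1}):\varphi(x)\in T_xS\ \forall x\in S\}$. Capillary bundle: for $x\in S$, $G_{m,\beta}(x)$ is the set of $P\in G(m,n+1)$ with (i) $|P(\nu^S(x))|=\sin\beta(x)$ and (ii) $(P\cap T_xS)\perp P(\nu^S(x))$. $G_{m,\beta}(S)=\{(x,P):x\in S,P\in G_{m,\beta}(x)\}$ with the subspace topology of $S\times G(m,n+1)$. For $(x,P)\in G_{m,\beta}(S)$, $\mathbf n(x,P)=P(\nu^S(x))/|P(\nu^S(x))|$. Capillary varifolds: $V\in\mathbf V^m_\beta(\Omega)$ with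 boundary varifold $\Gamma$ means: $V$ is an $m$-varifold on $\overline\Omega$, $\Gamma$ is a Radon measure on $G_{m,\beta}(S)$, and there is a generalized mean curvature vector $\mathbf H\in L^1_{\rm loc}(\mu_V)$ with values in $\mathbb R^{n+1}$, $\mathbf H(x)\in T_xS$ for $\mu_V$-a.e. $x\in S$, such that for all compactly supported $\varphi\in\mathfrak X_t(\Omega)$: $\delta V(\varphi)=-\int_{\overline\Omega}\langle\mathbf H,\varphi\rangle d\mu_V-\int_{G_{m,\beta}(S)}\langle\mathbf n(x,P),\varphi(x)\rangle d\Gamma(x,P)$. Disintegrate $\Gamma=\sigma_\Gamma\otimes\Gamma^x$ with $\sigma_\Gamma$ the push-forward of $\Gamma$ to $S$ and $\Gamma^x$ probability measures on $G_{m,\beta}(x)$; $\mathbf n_V(x)=\int\mathbf n(x,P)\,d\Gamma^x(P)$ and $\cos\beta(x)\mathbf n_W(x)=T_xS(\mathbf n_V(x))$. Capillary boundary points: $x_0\in\mathrm{spt}\,\sigma_\Gamma$ with $\cos\beta(x_0)\ne0$ belongs to $\mathscr P_{\rm cb}(\Gamma)$ with factors $\epsilon_0,\rho_0\in(0,1]$, $c_0>0$ and unit vector $\tau^V_{x_0}\in T_{x_0}S$ if for $\sigma_\Gamma$-a.e. $x\in B_{\rho_0}(x_0)$: (C1) $\langle\cos\beta(x)\mathbf n_W(x),\tau^V_{x_0}\rangle\ge\epsilon_0$; (C2) $|\langle x-x_0,\cos\beta(x)\mathbf n_W(x)\rangle|\le c_0|\cos\beta(x_0)||x-x_0|^2$.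 *)

(* Defs.v *)
From HB Require Import structures.
From mathcomp Require Import all_boot all_order all_algebra.
From mathcomp Require Import all_classical all_reals all_analysis.

Set Implicit Arguments.
Unset Strict Implicit.
Unset Printing Implicit Defensive.

Import Order.TTheory GRing.Theory Num.Theory.
Import numFieldNormedType.Exports.

Local Open Scope classical_set_scope.
Local Open Scope ring_scope.

(* Points of R^(n+1) are row vectors 'rV[R]_n.+1.  The library norm on matrices
   is the sup norm: it provides the topology and the differential calculus, but
   lengths and balls are Euclidean and are defined through [dot]. *)

Section Euclidean.
Context {R : realType} {n : nat}.
Implicit Types u v x : 'rV[R]_n.+1.

Definition dot u v : R := \sum_i u 0 i * v 0 i.
Definition enorm u : R := Num.sqrt (dot u u).
Definition cball x (r : R) : set 'rV[R]_n.+1 := [set y | enorm (y - x) <= r].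

End Euclidean.

(* An m-plane is encoded by the matrix of the orthogonal projection onto it;
   the topology of G(m,n+1) is the one induced from matrices.  As projections
   are symmetric, P(v) is [v *m P], and v lies in the plane iff v *m P = v. *)
Definition grassmannian (R : realType) (n m : nat) : set 'M[R]_n.+1 :=
  [set P | [/\ P^T = P, P *m P = P & \rank P = m]].
Arguments grassmannian : clear implicits.

(* [jacobian phi x] acts on row vectors, so that its (i, j) entry is
   the i-th partial derivative of phi_j, and div_P phi = tr (P o Dphi). *)
Definition plane_div (R : realType) (n : nat) (P A : 'M[R]_n.+1) : R :=
  \tr (P *m A).

Section Smoothness.
Context {R : realType}.

(* The spaces below are finite-dimensional, where continuity of all
   directional derivatives is continuity of the differential. *)
Definition C1_open (V W : normedModType R) (U : set V) (f : V -> W) :=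
  forall x, U x ->
    differentiable f x /\ forall v, {for x, continuous ('D_v f)}.

Definition C2_open (V W : normedModType R) (U : set V) (f : V -> W) :=
  C1_open U f /\ forall v, C1_open U ('D_v f).

(* C^1 on an arbitrary set: locally the restriction of a C^1 map *)
Definition C1_set (V W : normedModType R) (A : set V) (f : V -> W) :=
  forall x, A x -> exists (U : set V) (g : V -> W),
    [/\ open U, U x, C1_open U g & {in A `&` U, f =1 g}].

Definition diffeo_onto (V W : normedModType R) (A : set V) (B : set W)
    (f : V -> W) :=
  [/\ f @` A = B, C1_set A f &
      exists g : W -> V, C1_set B g /\ {in A, cancel f g}].

End Smoothness.

Section Domain.
Context {R : realType} {n : nat}.
Local Notation E := 'rV[R]_n.+1.
Implicit Types (Omega U : set E) (x v : E).

Definition boundary Omega : set E := closure Omega `&` closure (~` Omega).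

Definition gradient (f : E -> R) x : E :=
  \row_i 'D_(delta_mx 0 i : E) f x.

(* f is a C^2 defining function of Omega near x, positive inside *)
Definition local_defining Omega x U (f : E -> R) :=
  [/\ open U, U x, C2_open U f, gradient f x != 0 &
      forall y, U y -> (Omega y <-> 0 < f y)].

Definition bounded_C2_domain Omega :=
  [/\ open Omega, Omega !=set0, connected Omega, bounded_set Omega &
      forall x, boundary Omega x -> exists U f, local_defining Omega x U f].

(* inward unit normal nu^S; it does not depend on the defining function *)
Definition inner_normal Omega x : E :=
  xget 0 [set v | exists U f, local_defining Omega x U f /\
                    v = (enorm (gradient f x))^-1 *: gradient f x].

(* v \in T_xS *)
Definition tangent Omega x v : Prop := dot v (inner_normal Omega x) = 0.

(* the orthogonal projection T_xS(v) *)
Definition tangent_proj Omega x v : E :=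
  v - dot v (inner_normal Omega x) *: inner_normal Omega x.

Definition normal_exp Omega (z : E * R) : E :=
  z.1 + z.2 *: inner_normal Omega z.1.

(* rho is an admissible rho_S: N is the one-sided tubular neighbourhood *)
Definition tubular_radius Omega (rho : R) :=
  0 < rho /\
  exists N : set E,
    [/\ boundary Omega `<=` N,
        exists U, open U /\ N = U `&` closure Omega &
        diffeo_onto (boundary Omega `*` `[0, rho[) N (normal_exp Omega)].

(* beta \in C^1(S, (0, pi)) *)
Definition contact_angle Omega (beta : E -> R) :=
  C1_set (boundary Omega) beta /\
  forall x, boundary Omega x -> 0 < beta x < pi.

(* phi \in X_t(Omega) with compact support.  C^1 regularity is up to the
   boundary: Dphi, defined in Omega, has the continuous extension J to the
   closure of Omega.  Values of phi and J elsewhere are irrelevant. *)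
Definition tangential_test Omega (phi : E -> E) (J : E -> 'M[R]_n.+1) :=
  [/\ {within closure Omega, continuous phi},
      {within closure Omega, continuous J},
      forall x, Omega x -> differentiable phi x /\ jacobian phi x = J x,
      forall x, boundary Omega x -> tangent Omega x (phi x) &
      compact (closure [set x | closure Omega x /\ phi x != 0])].

End Domain.

Notation borel T := (@g_sigma_algebraType T open).

(* R^(n+1) x 'M_n.+1, which contains G_m(U) for every U *)
Notation bundle R n := ('rV[R]_n.+1 * 'M[R]_n.+1)%type.

(* A Radon measure on A is a Borel measure of the ambient space that is
   concentrated on A and finite on the compact subsets of A; regularity is
   automatic in these spaces.  Only used for closed A. *)
Definition radon_on (R : realType) (n : nat) (A : set (bundle R n))
    (mu : {measure set (borel (bundle R n)) -> \bar R}) :=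
  mu (~` A) = 0%E /\
  forall K : set (bundle R n), compact K -> K `<=` A -> (mu K < +oo)%E.

Definition spt (R : realType) (n : nat)
    (mu : {measure set (borel 'rV[R]_n.+1) -> \bar R}) : set 'rV[R]_n.+1 :=
  [set x | forall U : set 'rV[R]_n.+1, open U -> U x -> (0 < mu U)%E].

Section Base.
Context {R : realType} {n : nat}.
Local Notation E := 'rV[R]_n.+1.

Lemma measurable_base :
  measurable_fun setT (fst : borel (bundle R n) -> borel E).
Proof.
apply: (@measurability _ _ (borel (bundle R n)) (borel E) _ _ open erefl).
move=> _ [U oU <-]; rewrite setTI; apply: sub_sigma_algebra.
by apply: open_comp => // z _; exact: cvg_fst.
Qed.

(* push-forward to R^(n+1): mu_V, and sigma_Gamma *)
Definition base_measure (V : {measure set (borel (bundle R n)) -> \bar R}) :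
    {measure set (borel E) -> \bar R} :=
  @measure_function_pushforward__canonical__measure_function_Measure
    _ _ _ _ _ V _ measurable_base.

End Base.

Section Capillary.
Context {R : realType} {n : nat} (m : nat).
Local Notation E := 'rV[R]_n.+1.
Local Notation M := 'M[R]_n.+1.
Implicit Types (Omega : set E) (beta : E -> R) (x v : E) (P : M).
Implicit Types (V Gamma : {measure set (borel (bundle R n)) -> \bar R}).

Definition grassmann_bundle (A : set E) : set (bundle R n) :=
  A `*` grassmannian R n m.

(* P(nu^S(x)) *)
Definition plane_normal Omega x P : E := inner_normal Omega x *m P.

(* G_{m,beta}(x) *)
Definition capillary_planes Omega beta x : set M :=
  [set P | [/\ grassmannian R n m P,
     enorm (plane_normal Omega x P) = sin (beta x) &
     forall v, v *m P = v -> tangent Omega x v ->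
       dot v (plane_normal Omega x P) = 0]].

(* G_{m,beta}(S) *)
Definition capillary_bundle Omega beta : set (bundle R n) :=
  [set z | boundary Omega z.1 /\ capillary_planes Omega beta z.1 z.2].

(* n(x,P) *)
Definition conormal Omega x P : E :=
  (enorm (plane_normal Omega x P))^-1 *: plane_normal Omega x P.

(* delta V(phi), where J is Dphi extended to the closure of Omega *)
Definition first_variation Omega V (J : E -> M) : R :=
  \int[V]_(z in grassmann_bundle (closure Omega)) plane_div z.2 (J z.1).

(* V \in V^m_beta(Omega) with boundary varifold Gamma and generalized mean
   curvature H.  H is extended to R^(n+1) as a Borel map; mu_V does not charge
   the complement of the closure of Omega. *)
Definition capillary_varifold Omega beta V Gamma (H : E -> E) :=
  [/\ radon_on (grassmann_bundle (closure Omega)) V,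
      radon_on (capillary_bundle Omega beta) Gamma,
      forall (K : set E) i, compact K ->
        (base_measure V).-integrable K (fun x => (H x 0 i)%:E),
      {ae base_measure V, forall x, boundary Omega x -> tangent Omega x (H x)} &
      forall (phi : E -> E) (J : E -> M), tangential_test Omega phi J ->
        first_variation Omega V J =
        - (\int[base_measure V]_(x in closure Omega) dot (H x) (phi x))
        - (\int[Gamma]_(z in capillary_bundle Omega beta)
             dot (conormal Omega z.1 z.2) (phi z.1))].

(* Gamma = sigma_Gamma (x) Gamma^x; the fibre measures Gamma^x are given by a
   probability kernel k and are determined for sigma_Gamma-a.e. x *)
Definition disintegration Omega beta Gamma (k : R.-pker (borel E) ~> (borel M)) :=
  (forall (A : set (borel E)) (B : set (borel M)),
     measurable A -> measurable B ->
     Gamma (A `*` B) = (\int[base_measure Gamma]_(x in A) k x B)%E) /\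
  {ae base_measure Gamma, forall x, k x (~` capillary_planes Omega beta x) = 0%E}.

(* n_V(x) *)
Definition mean_conormal Omega beta (k : R.-pker (borel E) ~> (borel M)) x : E :=
  \row_i \int[k x]_(P in capillary_planes Omega beta x) conormal Omega x P 0 i.

(* cos beta(x) n_W(x); n_W itself never occurs without this factor *)
Definition cos_nW Omega beta (k : R.-pker (borel E) ~> (borel M)) x : E :=
  tangent_proj Omega x (mean_conormal Omega beta k x).

(* x0 \in P_cb(Gamma) with factors eps0, rho0, c0 and unit vector tau *)
Definition capillary_boundary_point Omega beta Gamma
    (k : R.-pker (borel E) ~> (borel M)) (x0 : E) (eps0 rho0 c0 : R) (tau : E) :=
  [/\ [/\ boundary Omega x0, spt (base_measure Gamma) x0 & cos (beta x0) != 0],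
      [/\ 0 < eps0 <= 1, 0 < rho0 <= 1 & 0 < c0],
      enorm tau = 1 /\ tangent Omega x0 tau,
      {ae base_measure Gamma, forall x, cball x0 rho0 x ->
         eps0 <= dot (cos_nW Omega beta k x) tau} &
      {ae base_measure Gamma, forall x, cball x0 rho0 x ->
         `|dot (x - x0) (cos_nW Omega beta k x)|
           <= c0 * `|cos (beta x0)| * enorm (x - x0) ^+ 2}].

(* mu_V(B_r(x)); finite, since V is a Radon measure on a compact set *)
Definition ball_mass V x (r : R) : R := fine (base_measure V (cball x r)).

(* a finite value amounts to H \in L^p(mu_V) *)
Definition vLnorm V (p : R) (H : E -> E) : \bar R :=
  'N[base_measure V]_(p%:E)[EFin \o (@enorm R n \o H)]%E.

End Capillary.

(* Main.v *)
(* The first variation identity is tested against phi = h(|x - x0|^2 / t^2) Z,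
   where Z is tangential along S, agrees with x - x0 up to O(|x - x0|^2), has
   DZ = 1 + O(|x - x0|), and pairs nonnegatively with n_V along S.  The field Z
   is the position vector made tangential by a defining function of S, plus
   K |x - x0|^2 times the tangential part of tau: by (C1) the last term makes up
   for the defect allowed by (C2) when K = c0 |cos beta(x0)| / eps0.  Hence the
   boundary term can be dropped, and Hoelder's inequality for H turns the
   identity into a differential inequality for I(t) = int h(|x - x0|^2 / t^2)
   which says that exp(L t) ((I / t^m)^(1/p) + L t^((p-m)/p)) has a nonnegative
   derivative.  Letting h decrease to the indicator of [0, 1] gives the
   monotonicity at radii below the size r of the charts of S.  At larger radii
   mu(B_t) is nondecreasing and exp(p L t) / t^m increases as soon as
   m <= p L t, so a large L suffices.  The additive estimate follows from
   x^p - y^p <= p x^(p-1) (x - y). *)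

Require Import Defs.
From HB Require Import structures.
From mathcomp Require Import all_boot all_order all_algebra.
From mathcomp Require Import all_classical all_reals all_analysis.
From mathcomp Require Import measurable_realfun.
From mathcomp Require Import ring lra.

Set Implicit Arguments.
Unset Strict Implicit.
Unset Printing Implicit Defensive.

Import Order.TTheory GRing.Theory Num.Theory.
Import numFieldNormedType.Exports.

Local Open Scope classical_set_scope.
Local Open Scope ring_scope.

(** * Euclidean vectors and projections *)

(** [Lambda] has to be fixed before the domain and [x0], from S and numerical data alone. Hence
    compactness of S is used to get one chart radius r for all points, 1/r also bounds all
    derivatives, and a chart knows the tangent planes for every domain bounded by S, since defining
    functions with the same zero set have parallel gradients. In the first variation the cutoff
    contributes h' times the squared length of the projection of x - x0 to the plane, up to errors.
    As h' <= 0, only the bound of this length by |x - x0| is needed, and the resulting integral of u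
    h'(u), u = |x - x0|^2 / t^2, is -t/2 times the derivative of I. The power 1/p is not
    differentiable at zero mass, so a positive constant is added to the density and removed in the
    limit. The boundary integrand has a sign only after averaging over the planes at a point; a
    shift by a constant lets the disintegration of Gamma be applied to nonnegative functions. *)

Section EuclideanFacts.
Context {R : realType} {n : nat}.
Local Notation E := 'rV[R]_n.+1.
Implicit Types (u v w x y : E) (P : 'M[R]_n.+1).

Lemma dotC u v : dot u v = dot v u.
Proof. by apply: eq_bigr => i _; rewrite mulrC. Qed.

Lemma dotDl u v w : dot (u + v) w = dot u w + dot v w.
Proof. by rewrite -big_split; apply: eq_bigr => i _; rewrite mxE mulrDl. Qed.

Lemma dotZl (a : R) u v : dot (a *: u) v = a * dot u v.
Proof. by rewrite mulr_sumr; apply: eq_bigr => i _; rewrite mxE mulrA. Qed.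

Lemma dotNl u v : dot (- u) v = - dot u v.
Proof. by rewrite -scaleN1r dotZl mulN1r. Qed.

Lemma dotBl u v w : dot (u - v) w = dot u w - dot v w.
Proof. by rewrite dotDl dotNl. Qed.

Lemma dotDr u v w : dot w (u + v) = dot w u + dot w v.
Proof. by rewrite dotC dotDl !(dotC w). Qed.

Lemma dotZr (a : R) u v : dot u (a *: v) = a * dot u v.
Proof. by rewrite dotC dotZl dotC. Qed.

Lemma dotNr u v : dot u (- v) = - dot u v.
Proof. by rewrite dotC dotNl dotC. Qed.

Lemma dotBr u v w : dot w (u - v) = dot w u - dot w v.
Proof. by rewrite dotDr dotNr. Qed.

Lemma dot0l u : dot 0 u = 0.
Proof. by rewrite -(scale0r 0) dotZl mul0r. Qed.

Lemma dot0r u : dot u 0 = 0.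
Proof. by rewrite dotC dot0l. Qed.

Lemma dot_ge0 u : 0 <= dot u u.
Proof. by apply: sumr_ge0 => i _; rewrite -expr2 sqr_ge0. Qed.

Lemma dot_eq0 u : (dot u u == 0) = (u == 0).
Proof.
apply/idP/eqP => [|->]; last by rewrite dot0l.
rewrite psumr_eq0 => [/allP h|i _]; last by rewrite -expr2 sqr_ge0.
apply/rowP => i; rewrite mxE.
have := h i (mem_index_enum _); rewrite -expr2 sqrf_eq0 => /eqP ->.
by rewrite // .
Qed.

Lemma dot_gt0 u : u != 0 -> 0 < dot u u.
Proof. by move=> u0; rewrite lt_neqAle dot_ge0 eq_sym dot_eq0 u0. Qed.

Lemma enorm_ge0 u : 0 <= enorm u. Proof. exact: sqrtr_ge0. Qed.

Lemma enorm_sqr u : enorm u ^+ 2 = dot u u.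
Proof. by rewrite sqr_sqrtr // dot_ge0. Qed.

Lemma enorm_gt0 u : u != 0 -> 0 < enorm u.
Proof. by move=> u0; rewrite sqrtr_gt0 dot_gt0. Qed.

Lemma enormZ (a : R) u : enorm (a *: u) = `|a| * enorm u.
Proof.
by rewrite /enorm dotZl dotZr mulrA -expr2 sqrtrM ?sqr_ge0 // sqrtr_sqr.
Qed.

Lemma enormN u : enorm (- u) = enorm u.
Proof. by rewrite -scaleN1r enormZ normrN1 mul1r. Qed.

(** Cauchy-Schwarz: the squared length of |v|^2 u - <u, v> v is |v|^2 (|u|^2 |v|^2 - <u, v>^2). *)
Lemma dot_le_enorm u v : `|dot u v| <= enorm u * enorm v.
Proof.
rewrite -(@ler_pXn2r _ 2) ?nnegrE ?mulr_ge0 ?enorm_ge0 //.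
rewrite real_normK ?num_real // exprMn !enorm_sqr.
have [->|v0] := eqVneq v 0; first by rewrite !dot0r mulr0 expr0n.
have vv := dot_gt0 v0.
have := dot_ge0 (dot v v *: u - dot u v *: v).
rewrite dotBl !dotBr !dotZl !dotZr (dotC v u) => h.
have : 0 <= dot v v * (dot u u * dot v v - dot u v ^+ 2) by lra.
by rewrite pmulr_rge0 // subr_ge0.
Qed.

Lemma enormD u v : enorm (u + v) <= enorm u + enorm v.
Proof.
rewrite -(@ler_pXn2r _ 2) ?nnegrE ?addr_ge0 ?enorm_ge0 //.
rewrite sqrrD !enorm_sqr dotDl !dotDr (dotC v u).
have := le_trans (ler_norm _) (dot_le_enorm u v).
lra.
Qed.

Lemma coord_le_enorm u i : `|u 0 i| <= enorm u.
Proof.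
rewrite -(@ler_pXn2r _ 2) ?nnegrE ?enorm_ge0 //.
rewrite real_normK ?num_real // enorm_sqr /dot (bigD1 i) //= -expr2 lerDl.
by apply: sumr_ge0 => j _; rewrite -expr2 sqr_ge0.
Qed.

Lemma enorm_le_coord u (c : R) :
  (forall i, `|u 0 i| <= c) -> enorm u <= n.+1%:R * c.
Proof.
move=> h; have c0 : 0 <= c := le_trans (normr_ge0 _) (h 0).
rewrite -(@ler_pXn2r _ 2) ?nnegrE ?mulr_ge0 ?enorm_ge0 //.
rewrite enorm_sqr exprMn.
apply: (@le_trans _ _ (\sum_(i < n.+1) c ^+ 2)).
  apply: ler_sum => i _; rewrite -expr2 -(real_normK (num_real _)).
  by rewrite ler_pXn2r ?nnegrE.
rewrite sumr_const card_ord -[leLHS]mulr_natl; apply: ler_wpM2r; first exact: sqr_ge0.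
by rewrite expr2 ler_peMr // ler1n.
Qed.

(** Together with the reverse estimate below, this moves neighbourhoods and boundedness between the
    sup norm and Euclidean balls. *)
Lemma norm_le_enorm u : `|u| <= enorm u.
Proof.
rewrite /Num.Def.normr /= mx_normrE; apply: bigmax_le; first exact: enorm_ge0.
by move=> [i j] _ /=; rewrite (ord1 i) coord_le_enorm.
Qed.

Lemma enorm_le_norm u : enorm u <= n.+1%:R * `|u|.
Proof.
apply: enorm_le_coord => i; rewrite [leRHS]/Num.Def.normr /= mx_normrE.
exact: (le_bigmax _ (fun ij : 'I_1 * 'I_n.+1 => `|u ij.1 ij.2|) (0, i)).
Qed.

Lemma enorm_triangle x y w : enorm (x - w) <= enorm (x - y) + enorm (y - w).
Proof. by rewrite -[x - w](subrKA y) enormD. Qed.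

End EuclideanFacts.

Section MatrixLimits.
Context {R : realType}.

Lemma cvg_mx_coord {T : Type} (F : set_system T) {FF : Filter F} (m n : nat)
    (f : T -> 'M[R]_(m.+1, n.+1)) (l : 'M[R]_(m.+1, n.+1)) :
  (forall i j, f x i j @[x --> F] --> l i j) -> f @ F --> l.
Proof.
move=> h; apply/cvgrPdist_le => /= e e0; near=> x.
rewrite /Num.Def.normr /= mx_normrE (bigmax_le _ (ltW e0)) //= => i _.
rewrite !mxE; move: i; near: x; apply: filter_forall => /= i.
exact: ((cvgrPdist_le _ _).1 (h i.1 i.2)).
Unshelve. all: by end_near. Qed.

Lemma cvg_sum {T I : Type} (F : set_system T) {FF : Filter F} (r : seq I)
    (f : I -> T -> R) (l : I -> R) :
  (forall i, f i x @[x --> F] --> l i) ->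
  (\sum_(i <- r) f i x) @[x --> F] --> \sum_(i <- r) l i.
Proof.
move=> h; elim: r => [|i r IH].
  by under eq_fun do rewrite big_nil; rewrite big_nil; exact: cvg_cst.
by under eq_fun do rewrite big_cons; rewrite big_cons; exact: cvgD.
Qed.

End MatrixLimits.

Section EuclideanTopology.
Context {R : realType} {n : nat}.
Local Notation E := 'rV[R]_n.+1.
Implicit Types (u v w x y : E) (P : 'M[R]_n.+1).

Lemma cvg_row {T : Type} (F : set_system T) {FF : Filter F} (f : T -> E) (l : E) :
  (forall i, f x 0 i @[x --> F] --> l 0 i) -> f @ F --> l.
Proof. by move=> h; apply: cvg_mx_coord => i j; rewrite (ord1 i). Qed.

Lemma cvg_coord {T : Type} (F : set_system T) {FF : Filter F} (f : T -> E) (l : E) i :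
  f @ F --> l -> f x 0 i @[x --> F] --> l 0 i.
Proof. by move=> h; exact: (@cvg_comp _ _ _ f (fun y : E => y 0 i) _ _ _ h (@coord_continuous _ _ _ _ _ l)). Qed.

Lemma cvg_dot {T : Type} (F : set_system T) {FF : Filter F} (f g : T -> E) (a b : E) :
  f @ F --> a -> g @ F --> b -> dot (f x) (g x) @[x --> F] --> dot a b.
Proof.
by move=> fa gb; apply: cvg_sum => i; apply: cvgM; exact: cvg_coord.
Qed.

Lemma cvg_enorm {T : Type} (F : set_system T) {FF : Filter F} (f : T -> E) (a : E) :
  f @ F --> a -> enorm (f x) @[x --> F] --> enorm a.
Proof.
move=> fa; rewrite /enorm; have h := @sqrt_continuous R (dot a a).
exact: cvg_comp (cvg_dot fa fa) h.
Qed.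

Lemma enorm_dist_continuous x0 : continuous (fun x => enorm (x - x0)).
Proof.
move=> x; apply: (@cvg_enorm _ (nbhs x) _ (fun y => y - x0)).
by apply: (@cvgB _ _ _ (nbhs x)); [exact: cvg_id|exact: cvg_cst].
Qed.

Lemma cball_closed x (r : R) : closed (cball x r).
Proof.
exact: (closed_comp (fun y _ => @enorm_dist_continuous x y) (@closed_le R r)).
Qed.

Lemma cball_compact x (r : R) : compact (cball x r).
Proof.
apply: bounded_closed_compact; last exact: cball_closed.
exists (r + enorm x); split; first exact: num_real.
move=> M rM y /= yr; apply: le_trans (norm_le_enorm _) _; apply: ltW.
apply: le_lt_trans rM.
by rewrite -[y in leLHS](subrK x); apply: le_trans (enormD _ _) _; rewrite lerD2r.
Qed.

Lemma nbhs_eball x (r : R) : 0 < r -> nbhs x [set y | enorm (y - x) < r].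
Proof.
move=> r0; apply: (open_nbhs_nbhs); split; last first.
  by rewrite /= subrr -(scale0r 0) enormZ normr0 mul0r.
exact: (open_comp (fun y _ => @enorm_dist_continuous x y) (@open_lt R r)).
Qed.

Lemma nbhs_eballP x (A : set E) :
  nbhs x A <-> exists2 r : R, 0 < r & forall y, enorm (y - x) < r -> A y.
Proof.
split=> [|[r r0 h]]; last by apply: filterS (nbhs_eball x r0).
move=> /nbhs_ballP[e /= e0 h]; exists e => // y yx; apply: h.
rewrite mx_norm_ball /ball_ /= -normrN opprB.
exact: le_lt_trans (norm_le_enorm _) yx.
Qed.

Lemma dot_mulmx_sym P u v : P^T = P -> dot (u *m P) v = dot u (v *m P).
Proof.
move=> Ps; rewrite /dot.
under eq_bigr => i _ do rewrite mxE mulr_suml.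
rewrite exchange_big; apply: eq_bigr => i _; rewrite mxE mulr_sumr.
by apply: eq_bigr => j _; rewrite -[in P j i]Ps mxE; ring.
Qed.

Lemma dot_proj P u : P^T = P -> P *m P = P ->
  dot (u *m P) u = dot (u *m P) (u *m P).
Proof. by move=> Ps Pi; rewrite [RHS]dot_mulmx_sym // -mulmxA Pi dotC. Qed.

(** For an orthogonal projection |uP|^2 = <uP, u>; Cauchy-Schwarz then allows one factor |uP| to be
    cancelled. *)
Lemma enorm_proj_le P u : P^T = P -> P *m P = P -> enorm (u *m P) <= enorm u.
Proof.
move=> Ps Pi; have [h|h] := eqVneq (enorm (u *m P)) 0; first by rewrite h enorm_ge0.
have h0 : 0 < enorm (u *m P) by rewrite lt_neqAle eq_sym h enorm_ge0.
rewrite -(ler_pM2l h0) -expr2 enorm_sqr -dot_proj //.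
exact: le_trans (ler_norm _) (dot_le_enorm _ _).
Qed.

Lemma proj_entry_le1 P i j : P^T = P -> P *m P = P -> `|P i j| <= 1.
Proof.
move=> Ps Pi; have -> : P i j = (delta_mx 0 i *m P : E) 0 j.
  by rewrite -rowE mxE.
apply: le_trans (coord_le_enorm _ _) _; apply: le_trans (enorm_proj_le _ Ps Pi) _.
rewrite /enorm /dot (bigD1 i) //= big1 => [|k ki].
  by rewrite !mxE !eqxx mulr1 addr0 sqrtr1.
by rewrite !mxE (negPf ki) andbF mul0r.
Qed.

Lemma dot_proj_bounds P u : P^T = P -> P *m P = P ->
  0 <= dot (u *m P) u <= enorm u ^+ 2.
Proof.
move=> Ps Pi; rewrite dot_proj // dot_ge0 /= -enorm_sqr.
by rewrite ler_pXn2r ?nnegrE ?enorm_ge0 // enorm_proj_le.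
Qed.

(* An idempotent of rank m factors as C *m B with B *m C = 1%:M. *)
Lemma mxtrace_idem P : P *m P = P -> \tr P = (\rank P)%:R.
Proof.
move=> PP; rewrite -[in LHS](mulmx_base P) mxtrace_mulC.
suff -> : row_base P *m col_base P = 1%:M by rewrite mxtrace1.
have Bf := row_base_free P; have Cf : row_full (col_base P) := col_base_full P.
have h : col_base P *m (row_base P *m col_base P) = col_base P.
  apply: (row_free_inj Bf) => /=.
  by rewrite mulmxA mulmx_base -mulmxA mulmx_base PP.
have /row_fullP[D DC] := Cf.
by have := congr1 (mulmx D) h; rewrite mulmxA DC mul1mx.
Qed.

(** The trace expands into (n+1)^2 products, and the entries of an orthogonal projection are at most
    1 in absolute value. This count is the origin of the factor (n+1)^2 in the later constants. *)
Lemma mxtrace_mul_le P (A : 'M[R]_n.+1) (c : R) : P^T = P -> P *m P = P ->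
  (forall i j, `|A i j| <= c) -> `|\tr (P *m A)| <= (n.+1 * n.+1)%:R * c.
Proof.
move=> Ps Pi h; rewrite /mxtrace; apply: le_trans (ler_norm_sum _ _ _) _.
rewrite natrM -mulrA -[X in X%:R * _]card_ord mulr_natl -sumr_const.
apply: ler_sum => i _; rewrite mxE; apply: le_trans (ler_norm_sum _ _ _) _.
rewrite -[X in X%:R * _]card_ord mulr_natl -sumr_const.
apply: ler_sum => j _; rewrite normrM -[leRHS]mul1r.
by rewrite ler_pM // proj_entry_le1.
Qed.

End EuclideanTopology.

(** * Gradients *)

Section Gradients.
Context {R : realType} {n : nat}.
Local Notation E := 'rV[R]_n.+1.
Local Notation e i := (delta_mx 0 i : E).
Implicit Types (u v w x y : E) (f g : E -> R) (F G : E -> E) (U : set E).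

(** A pointwise certificate of C^1 regularity. F is a whole field, although it is compared with the
    gradient at x only, so that its continuity passes through the sum, product and chain rules and
    test fields come with explicit continuous derivatives. *)
Definition has_gradient f F x :=
  [/\ differentiable f x, gradient f x = F x & {for x, continuous F}].

Lemma derive_gradient f x v : differentiable f x ->
  'D_v f x = dot v (gradient f x).
Proof.
move=> df; rewrite deriveE // {1}(row_sum_delta v) linear_sum /=.
by apply: eq_bigr => i _; rewrite linearZ /= mxE deriveE.
Qed.

Lemma has_gradientP f F x : differentiable f x ->
  (forall i, is_derive x (e i) f (F x 0 i)) -> {for x, continuous F} ->
  has_gradient f F x.
Proof.
move=> df h cF; split=> //; apply/rowP => i; rewrite mxE.
by have [_ ->] := h i.
Qed.

Lemma has_gradient_is_derive f F x i : has_gradient f F x ->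
  is_derive x (e i) f (F x 0 i).
Proof.
move=> [df <- _]; rewrite mxE; apply: derivableP; exact: diff_derivable.
Qed.

Lemma has_gradient_cst (c : R) x : has_gradient (fun=> c) (fun=> 0) x.
Proof.
apply: has_gradientP; first exact: differentiable_cst.
  by move=> i; rewrite mxE; exact: is_derive_cst.
exact: cst_continuous.
Qed.

Lemma has_gradient_coord (i : 'I_n.+1) x :
  has_gradient (fun y => y 0 i) (fun=> e i) x.
Proof.
have h := @differentiable_coord R 1 n.+1 x 0 i.
apply: has_gradientP; first exact: h.
  move=> j; apply: DeriveDef; first exact: diff_derivable.
  have /matrixP/(_ 0 i) := derive_mx (@derivable_id R E x (e j)).
  by rewrite derive_id !mxE eq_sym => <-.
exact: cst_continuous.
Qed.

Lemma has_gradientD f F g G x : has_gradient f F x -> has_gradient g G x ->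
  has_gradient (fun y => f y + g y) (fun y => F y + G y) x.
Proof.
move=> hf hg; have [df _ cF] := hf; have [dg _ cG] := hg.
apply: has_gradientP; first exact: differentiableD.
  move=> i; rewrite mxE.
  have h1 := has_gradient_is_derive i hf; have h2 := has_gradient_is_derive i hg.
  exact: is_deriveD.
exact: (cvgD cF cG).
Qed.

Lemma has_gradientN f F x : has_gradient f F x ->
  has_gradient (fun y => - f y) (fun y => - F y) x.
Proof.
move=> hf; have [df _ cF] := hf.
apply: has_gradientP; first exact: differentiableN.
  move=> i; rewrite mxE; have h1 := has_gradient_is_derive i hf.
  exact: is_deriveN.
exact: (cvgN cF).
Qed.

Lemma has_gradientB f F g G x : has_gradient f F x -> has_gradient g G x ->
  has_gradient (fun y => f y - g y) (fun y => F y - G y) x.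
Proof. by move=> hf /has_gradientN; exact: has_gradientD. Qed.

Lemma has_gradient_continuous f F x : has_gradient f F x -> {for x, continuous f}.
Proof. by move=> [/differentiable_continuous]. Qed.

Lemma has_gradientM f F g G x : has_gradient f F x -> has_gradient g G x ->
  has_gradient (fun y => f y * g y) (fun y => f y *: G y + g y *: F y) x.
Proof.
move=> hf hg; have [df _ cF] := hf; have [dg _ cG] := hg.
apply: has_gradientP; first exact: differentiableM.
  move=> i; rewrite !mxE.
  have h1 := has_gradient_is_derive i hf; have h2 := has_gradient_is_derive i hg.
  exact: is_deriveM.
have cf := has_gradient_continuous hf; have cg := has_gradient_continuous hg.
exact: (cvgD (cvgZ cf cG) (cvgZ cg cF)).
Qed.

Lemma has_gradient_comp (h dh : R -> R) f F x : has_gradient f F x ->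
  (forall t : R, is_derive t 1 h (dh t)) -> {for f x, continuous dh} ->
  has_gradient (fun y => h (f y)) (fun y => dh (f y) *: F y) x.
Proof.
move=> hf hh cdh; have [df gf cF] := hf.
have dh' : differentiable h (f x) by apply/derivable1_diffP; have [] := hh (f x).
have dc : differentiable (h \o f) x by exact: differentiable_comp.
apply: has_gradientP; first exact: dc.
  move=> i; apply: DeriveDef; first exact: diff_derivable.
  have [dh1 dh2] := hh (f x); have [_ df2] := has_gradient_is_derive i hf.
  rewrite (deriveE _ dc) diff_comp //= -(deriveE _ df) df2 deriv1E // derive1E dh2.
  by rewrite mxE mulrC.
have cdhf : {for x, continuous (dh \o f)}.
  by apply: continuous_comp => //; exact: has_gradient_continuous hf.
exact: (cvgZ cdhf cF).
Qed.

Lemma has_gradientV f F x : f x != 0 -> has_gradient f F x ->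
  has_gradient (fun y => (f y)^-1) (fun y => - (f y) ^- 2 *: F y) x.
Proof.
move=> fx0 hf; have [df gf cF] := hf.
apply: has_gradientP; first exact: differentiableV.
  move=> i; have h1 := has_gradient_is_derive i hf.
  have [d1 d2] := h1.
  apply: DeriveDef; first exact: derivableV.
  by rewrite (deriveV fx0 d1) d2 mxE.
have cf := has_gradient_continuous hf.
have cf2 : (fun y => f y ^+ 2) @ x --> f x ^+ 2.
  by rewrite expr2; under eq_fun do rewrite expr2; exact: (cvgM cf cf).
have fx2 : f x ^+ 2 != 0 by rewrite expf_neq0.
exact: (cvgZ (cvgN (cvgV fx2 cf2)) cF).
Qed.

Lemma has_gradient_sum (I : Type) (r : seq I) (f : I -> E -> R) (F : I -> E -> E) x :
  (forall i, has_gradient (f i) (F i) x) ->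
  has_gradient (fun y => \sum_(i <- r) f i y) (fun y => \sum_(i <- r) F i y) x.
Proof.
move=> h; elim: r => [|i r IH].
  under eq_fun do rewrite big_nil; under [X in has_gradient _ X]eq_fun do rewrite big_nil.
  exact: has_gradient_cst.
under eq_fun do rewrite big_cons; under [X in has_gradient _ X]eq_fun do rewrite big_cons.
exact: has_gradientD.
Qed.

(** Serves to glue the cut-off field to zero: where the cutoff vanishes, the field can be replaced
    by 0 without any control of its other factor. *)
Lemma near_eq_has_gradient f f' F F' x :
  (\forall y \near x, f y = f' y) -> (\forall y \near x, F y = F' y) ->
  has_gradient f F x -> has_gradient f' F' x.
Proof.
move=> ff hFF [df gf cF].
have ff' : {near x, f =1 f'} by [].
have fx := nbhs_singleton ff; have Fx := nbhs_singleton hFF.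
have df' : differentiable f' x.
  have [dfc dfo] := (diff_locallyP x f).1 df.
  have eo : f' \o shift x = cst (f' x) + 'd f x +o_ (0 : E) id.
    apply/eqaddoP => eps eps0; move/eqaddoP : dfo => /(_ _ eps0) h.
    have /nbhs_eballP[r r0 ffr] := ff.
    have hr : \forall z \near (0 : E), enorm (z - 0) < r by exact: nbhs_eball.
    apply: filterS2 h hr => z; rewrite subr0 /= fx => hz zr.
    have e : f (z + x) = f' (z + x) by apply: ffr; rewrite addrK.
    by move: hz; rewrite !fctE /= e.
  apply/diff_locallyP; have -> := diff_unique dfc eo; split => //.
split => //.
- rewrite -Fx -gf; apply/rowP => i; rewrite !mxE.
  by apply/esym; apply: near_eq_derive.
- change (F' y @[y --> x] --> F' x); rewrite -Fx; apply: cvg_trans cF.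
  by apply: (@near_eq_cvg _ _ (nbhs x)).
Qed.

Lemma gradient_segment f F x0 w (t : R) : has_gradient f F (x0 + t *: w) ->
  is_derive t 1 (fun s => f (x0 + s *: w)) (dot w (F (x0 + t *: w))).
Proof.
move=> [df gf cF].
rewrite -gf -derive_gradient //.
pose g (s : R) := f (x0 + s *: w); set a := x0 + t *: w in df *.
have e : (fun h : R => h^-1 *: (g (h *: 1 + t) - g t)) =
         (fun h : R => h^-1 *: (f (h *: w + a) - f a)).
  apply/funext => h; congr (_ *: (f _ - _)).
  have -> : h%:A = h :> R by rewrite /GRing.scale /= mulr1.
  by rewrite scalerDl addrCA.
apply: (@DeriveDef _ _ _ t 1 g).
  by rewrite /derivable e; exact: diff_derivable.
by rewrite /derive e.
Qed.

(** Mean value theorem on the segment from x0. It is meant for <x - x0, F> - f with F the gradient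
    of f, whose own gradient is linear in x - x0 with second derivatives of f as coefficients;
    boundaries of class C^2 are therefore smooth enough. *)
Lemma gradient_quadratic_bound f F x0 x (c : R) :
  (forall t, 0 <= t <= 1 -> has_gradient f F (x0 + t *: (x - x0))) ->
  (forall t, 0 <= t <= 1 ->
     enorm (F (x0 + t *: (x - x0))) <= c * (t * enorm (x - x0))) ->
  f x0 = 0 -> 0 <= c -> `|f x| <= c * enorm (x - x0) ^+ 2.
Proof.
move=> hf hF f0 c0; set w := x - x0 in hf hF *.
have hd (s : R) : 0 <= s <= 1 -> is_derive s 1 (fun s => f (x0 + s *: w))
    (dot w (F (x0 + s *: w))) by move=> hs; exact: gradient_segment (hf s hs).
have h1 (s : R) : s \in `]0 : R, 1[ -> is_derive s 1 (fun s => f (x0 + s *: w))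
    (dot w (F (x0 + s *: w))).
  by rewrite in_itv /= => /andP[s0 s1]; apply: hd; rewrite !ltW.
have h2 : {within `[0 : R, 1], continuous (fun s => f (x0 + s *: w))}.
  apply: derivable_within_continuous => s; rewrite in_itv /= => hs.
  by have [] := hd s hs.
have [t] := MVT ltr01 h1 h2; rewrite in_itv /= => /andP[t0 t1].
rewrite scale1r scale0r addr0 f0 subr0 [x0 + w]addrC subrK subr0 mulr1 => ->.
apply: le_trans (dot_le_enorm _ _) _.
have /hF h : 0 <= t <= 1 by rewrite !ltW.
rewrite mulrC expr2 mulrA; apply: ler_wpM2r; first exact: enorm_ge0.
apply: le_trans h _; apply: ler_wpM2l => //.
by apply: ler_piMl; [exact: enorm_ge0|exact: ltW].
Qed.

End Gradients.

(** * Normals and charts of the boundary *)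

Section Charts.
Context {R : realType} {n : nat}.
Local Notation E := 'rV[R]_n.+1.
Local Notation e i := (delta_mx 0 i : E).
Implicit Types (u v w x y z : E) (f g : E -> R) (F G b : E -> E) (U S Omega : set E).

Lemma differentiable_eps f z (eps : R) : differentiable f z -> 0 < eps ->
  exists2 r, 0 < r & forall v, enorm v < r ->
    `|f (z + v) - f z - dot v (gradient f z)| <= eps * enorm v.
Proof.
move=> df eps0; have [_ /eqaddoP h] := (diff_locallyP z f).1 df.
have /nbhs_eballP[r r0 hr] := h _ eps0; exists r => // v vr.
have := hr v; rewrite subr0 => /(_ vr); rewrite !fctE /= [v + z]addrC.
rewrite -deriveE // derive_gradient // opprD addrA => /le_trans; apply.
by apply: ler_wpM2l; [exact: ltW|exact: norm_le_enorm].
Qed.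

(** The linearisation error is made smaller than half of the leading term t <v, grad f>. *)
Lemma positive_direction f z v : differentiable f z -> f z = 0 ->
  0 < dot v (gradient f z) ->
  exists2 t0 : R, 0 < t0 & forall t, 0 < t < t0 -> 0 < f (z + t *: v).
Proof.
move=> df fz vg; have v0 : v != 0.
  by apply: contraTneq vg => ->; rewrite dot0l ltxx.
have nv := enorm_gt0 v0.
have [||r r0 h] := @differentiable_eps f z (dot v (gradient f z) / (2 * enorm v)) => //.
  by rewrite divr_gt0 // mulr_gt0.
exists (r / enorm v); first exact: divr_gt0.
move=> t /andP[t0 tr]; have tv : enorm (t *: v) < r.
  by rewrite enormZ gtr0_norm // -ltr_pdivlMr.
have := h _ tv; rewrite fz subr0 enormZ (gtr0_norm t0) dotZl ler_norml => /andP[+ _].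
rewrite (_ : _ / _ * _ = t * dot v (gradient f z) / 2); last first.
  by field; rewrite gt_eqF.
have := mulr_gt0 t0 vg; lra.
Qed.

(* If w, the part of grad g normal to grad f, did not vanish, f would change
   sign on a short segment around z + t w, on which g > 0. *)
Lemma zero_set_parallel_gradients f g z (r0 : R) :
  0 < r0 -> (forall y, enorm (y - z) < r0 -> {for y, continuous f}) ->
  differentiable f z -> differentiable g z -> gradient f z != 0 ->
  f z = 0 -> (forall y, enorm (y - z) < r0 -> f y = 0 -> g y = 0) ->
  exists c, gradient g z = c *: gradient f z.
Proof.
move=> r00 cf df dg F0 fz hfg; set F := gradient f z in F0 *; set G := gradient g z.
have gz : g z = 0 by apply: hfg fz; rewrite subrr /enorm dot0l sqrtr0.
have FF := dot_gt0 F0; set FF' := dot F F in FF.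
pose al := dot G F / FF'; pose w := G - al *: F.
exists al; apply/eqP; rewrite -subr_eq0 -/w; apply/negPn/negP => w0.
have W0 := dot_gt0 w0; set W := dot w w in W0.
have wF : dot w F = 0 by rewrite /w dotBl dotZl /al -mulrA mulVf ?gt_eqF // mulr1 subrr.
have wG : dot w G = W.
  by rewrite -[G](subrK (al *: F)) -/w dotDr dotZr wF mulr0 addr0.
have FG : dot F G = al * FF' by rewrite dotC /al mulfVK // gt_eqF.
(* This width keeps eta |al| |F|^2 <= W/2, so that <u(s), G> >= W/2 for |s| <= eta; the 1 in the
   denominator covers al = 0. *)
pose eta := W / (2 * (`|al| * FF' + 1)).
have d0 : 0 < `|al| * FF' + 1 by rewrite ltr_wpDl // mulr_ge0 // ltW.
have eta0 : 0 < eta by rewrite divr_gt0 // mulr_gt0.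
have etaW : eta * (`|al| * FF') <= W / 2.
  rewrite /eta -ler_pdivlMl; last by rewrite divr_gt0 // mulr_gt0.
  rewrite (_ : _^-1 * _ = `|al| * FF' + 1); last by field; rewrite !gt_eqF.
  by rewrite lerDl.
pose u (s : R) := w + s *: F; pose L := enorm w + eta * enorm F + 1.
have L0 : 0 < L.
  by rewrite /L; have := enorm_ge0 w; have := mulr_ge0 (ltW eta0) (enorm_ge0 F); lra.
have uL s : `|s| <= eta -> enorm (u s) < L.
  move=> hs; apply: le_lt_trans (enormD _ _) _; rewrite enormZ /L.
  rewrite -addrA ltrD2l; apply: (@le_lt_trans _ _ (eta * enorm F)); last by rewrite ltrDl.
  by apply: ler_wpM2r; first exact: enorm_ge0.
have uF s : dot (u s) F = s * FF' by rewrite dotDl wF add0r dotZl.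
have uG s : `|s| <= eta -> W / 2 <= dot (u s) G.
  move=> hs; rewrite dotDl wG dotZl FG.
  have : - (eta * (`|al| * FF')) <= s * (al * FF').
    apply: lerNnormlW; rewrite !normrM (gtr0_norm FF).
    by apply: ler_wpM2r => //; rewrite mulr_ge0 // ltW.
  by lra.
(* L bounds |u(s)|, so the error along t u(s) is at most half of both leading terms: t eta |F|^2 for
   f at the two ends of the segment, and t W/2 for g. *)
pose eps := Num.min (eta * FF') (W / 2) / (2 * L).
have m0 : 0 < Num.min (eta * FF') (W / 2).
  by rewrite lt_min !divr_gt0 // mulr_gt0.
have eps0 : 0 < eps by rewrite divr_gt0 // mulr_gt0.
have [rf rf0 hf] := differentiable_eps df eps0.
have [rg rg0 hg] := differentiable_eps dg eps0.
pose t := Num.min r0 (Num.min rf rg) / L.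
have m1 : 0 < Num.min r0 (Num.min rf rg) by rewrite !lt_min r00 rf0 rg0.
have t0 : 0 < t by rewrite divr_gt0.
have tu s : `|s| <= eta -> enorm (t *: u s) < Num.min r0 (Num.min rf rg).
  move=> hs; rewrite enormZ gtr0_norm // mulrC -ltr_pdivlMr //.
  apply: lt_le_trans (uL s hs) _.
  by rewrite /t invf_div mulrC divfK // gt_eqF.
have epsu s : `|s| <= eta ->
    eps * enorm (t *: u s) <= t * Num.min (eta * FF') (W / 2) / 2.
  move=> hs; rewrite enormZ gtr0_norm //.
  rewrite (_ : _ / 2 = eps * (t * L)); last first.
    by rewrite /eps; field; rewrite gt_eqF.
  by rewrite ler_pM2l // ler_pM2l // ltW // uL.
have fs s : `|s| <= eta -> `|f (z + t *: u s) - t * (s * FF')| <=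
    t * (eta * FF') / 2.
  move=> hs; have := tu s hs; rewrite !lt_min => /and3P[_ h _].
  have := hf _ h; rewrite fz subr0 dotZl uF => /le_trans; apply.
  apply: le_trans (epsu s hs) _.
  rewrite ler_pM2r ?invr_gt0 // ler_pM2l // ge_min lexx //.
have gs s : `|s| <= eta -> 0 < g (z + t *: u s).
  move=> hs; have := tu s hs; rewrite !lt_min => /and3P[_ _ h].
  have := hg _ h; rewrite gz subr0 dotZl ler_norml => /andP[+ _].
  have h1 := epsu s hs.
  have h2 : t * Num.min (eta * FF') (W / 2) <= t * (W / 2).
    by rewrite ler_pM2l // ge_min lexx orbT.
  have h3 : t * (W / 2) <= t * dot (u s) G by rewrite ler_pM2l // uG.
  have h4 : 0 < t * (W / 2) by rewrite mulr_gt0 // divr_gt0.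
  rewrite -/G; lra.
have tef : 0 < t * (eta * FF') by apply: mulr_gt0 => //; exact: mulr_gt0.
have h1 : {within `[- eta, eta], continuous (fun s => f (z + t *: u s))}.
  apply: continuous_in_subspaceT => s; rewrite inE /= in_itv /= => hs.
  have hs' : `|s| <= eta by rewrite ler_norml.
  have cz : {for s, continuous (fun s => z + t *: u s)}.
    apply: cvgD; first exact: cvg_cst.
    apply: cvgZr; apply: cvgD; first exact: cvg_cst.
    by apply: cvgZl; exact: cvg_id.
  apply: continuous_comp => //.
  apply: cf; rewrite addrAC subrr add0r.
  by have := tu s hs'; rewrite !lt_min => /andP[].
have h2 : Num.min (f (z + t *: u (- eta))) (f (z + t *: u eta)) <= 0
       <= Num.max (f (z + t *: u (- eta))) (f (z + t *: u eta)).
  have e1 := fs eta; have e2 := fs (- eta).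
  rewrite normrN gtr0_norm // lexx in e1 e2; have {}e1 := e1 isT; have {}e2 := e2 isT.
  move: e1 e2; rewrite !ler_norml => /andP[e1 _] /andP[_ e2].
  rewrite ge_min le_max; apply/andP; split; apply/orP; [left|right]; lra.
have ee : - eta <= eta by lra.
(* For the fixed small t, f changes sign between s = -eta and s = eta; at the zero found here g is
   positive, against [hfg]. *)
have [s hs fs0] := IVT ee h1 h2.
have hs' : `|s| <= eta by rewrite ler_norml; move: hs; rewrite in_itv.
have := gs s hs'; rewrite (hfg _ _ fs0) ?ltxx //.
rewrite addrAC subrr add0r.
by have := tu s hs'; rewrite !lt_min => /andP[].
Qed.

Lemma C1_open_has_gradient U f x : C1_open U f -> U x -> has_gradient f (gradient f) x.
Proof.
move=> h Ux; have [df cf] := h x Ux; split => //.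
change (gradient f y @[y --> x] --> gradient f x).
apply: (@cvg_row _ _ _ (nbhs x)) => i; rewrite mxE.
under eq_fun do rewrite mxE.
exact: cf.
Qed.

Lemma C2_open_has_gradient U f x i : C2_open U f -> U x ->
  has_gradient (fun y => gradient f y 0 i) (gradient (fun y => gradient f y 0 i)) x.
Proof.
move=> [_ h] Ux; apply: (@C1_open_has_gradient U) => //.
rewrite (_ : (fun y => _) = 'D_(e i) f) //.
by apply/funext => y; rewrite mxE.
Qed.

Lemma boundary_open_notin Omega x : open Omega -> boundary Omega x -> ~ Omega x.
Proof.
move=> oO [_ cl] Ox; have [y []] := cl _ (open_nbhs_nbhs (conj oO Ox)); exact.
Qed.

(** Since Omega is open, f > 0 would put the boundary point into Omega; f < 0 would give it a
    neighbourhood that misses Omega. *)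
Lemma local_defining_boundary0 Omega y U f z : open Omega ->
  local_defining Omega y U f -> boundary Omega z -> U z -> f z = 0.
Proof.
move=> oO [oU _ [Cf _] _ hU] bz Uz.
have fz : f z <= 0.
  by rewrite leNgt; apply/negP => /(hU _ Uz).2; exact: boundary_open_notin bz.
apply/eqP; rewrite eq_le fz leNgt; apply/negP => fz0.
have cf := has_gradient_continuous (C1_open_has_gradient Cf Uz).
have /cvgr_lt/(_ _ fz0) h1 := cf.
have [w [Ow [Uw fw]]] := bz.1 _ (filterI (open_nbhs_nbhs (conj oU Uz)) h1).
by have := (hU _ Uw).1 Ow; rewrite ltNge ltW.
Qed.

(** A short step along grad f reaches f > 0, hence Omega, while the point itself lies outside
    Omega. *)
Lemma local_defining_zero_boundary Omega y U f z :
  local_defining Omega y U f -> U z -> f z = 0 -> gradient f z != 0 ->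
  boundary Omega z.
Proof.
move=> [oU _ [Cf _] _ hU] Uz fz g0; split; last first.
  by apply: subset_closure => /(hU _ Uz).1; rewrite fz ltxx.
have [df _] := Cf z Uz.
have [t0 t00 ht] := positive_direction df fz (dot_gt0 g0).
move=> B /nbhs_eballP[r r0 hB].
have /nbhs_eballP[r' r'0 hU'] := open_nbhs_nbhs (conj oU Uz).
have ng := enorm_gt0 g0.
pose t := Num.min t0 (Num.min r r' / enorm (gradient f z)) / 2.
have m0 : 0 < Num.min t0 (Num.min r r' / enorm (gradient f z)).
  by rewrite lt_min t00 divr_gt0 // lt_min r0.
have t_gt0 : 0 < t by rewrite divr_gt0.
have tm : t < Num.min t0 (Num.min r r' / enorm (gradient f z)) by rewrite /t; lra.
move: tm; rewrite lt_min ltr_pdivlMr // lt_min => /and3P[tt0 tr tr'].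
exists (z + t *: gradient f z).
have hd : enorm (z + t *: gradient f z - z) = t * enorm (gradient f z).
  by rewrite addrAC subrr add0r enormZ gtr0_norm.
have Uw : U (z + t *: gradient f z) by apply: hU'; rewrite hd.
split; last by apply: hB; rewrite hd.
by apply/(hU _ Uw)/ht; rewrite t_gt0.
Qed.

Lemma inner_normal_spec Omega x : bounded_C2_domain Omega -> boundary Omega x ->
  exists U f, local_defining Omega x U f /\
    inner_normal Omega x = (enorm (gradient f x))^-1 *: gradient f x.
Proof.
move=> [_ _ _ _ h] bx; have [U [f hf]] := h x bx.
have : exists v : E, exists U f, local_defining Omega x U f /\
    v = (enorm (gradient f x))^-1 *: gradient f x.
  by exists ((enorm (gradient f x))^-1 *: gradient f x), U, f.
by move=> /(xgetPex 0).
Qed.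

Lemma inner_normal_unit Omega x : bounded_C2_domain Omega -> boundary Omega x ->
  enorm (inner_normal Omega x) = 1.
Proof.
move=> hO bx; have [U [f [[_ _ _ g0 _] ->]]] := inner_normal_spec hO bx.
by rewrite enormZ ger0_norm ?invr_ge0 ?enorm_ge0 // mulVf // gt_eqF // enorm_gt0.
Qed.

(* [Omega'] is allowed to differ from [Omega]: the tangent planes depend on S only. *)
Lemma gradient_parallel_inner_normal Omega Omega' y U f z :
  bounded_C2_domain Omega -> bounded_C2_domain Omega' ->
  boundary Omega' = boundary Omega ->
  local_defining Omega y U f -> U z -> boundary Omega z -> gradient f z != 0 ->
  exists2 c, c != 0 & inner_normal Omega' z = c *: gradient f z.
Proof.
move=> hO hO' bOO hf Uz bz g0.
have bz' : boundary Omega' z by rewrite bOO.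
have [V [g [hg ->]]] := inner_normal_spec hO' bz'.
have [oU _ [Cf C2f] _ _] := hf; have [oV Vz [Cg _] gz0 _] := hg.
have [oO _ _ _ _] := hO; have [oO' _ _ _ _] := hO'.
have cG : {for z, continuous (gradient f)}.
  by have [_ _] := C1_open_has_gradient Cf Uz.
have nG : \forall w \near z, 0 < enorm (gradient f w).
  exact: (@cvgr_gt R _ (nbhs z) _ _ _ (cvg_enorm cG) _ (enorm_gt0 g0)).
have /nbhs_eballP[r r0 hr] : nbhs z (U `&` V `&` [set w | 0 < enorm (gradient f w)]).
  by apply: filterI => //; apply: filterI; exact: open_nbhs_nbhs.
have [c hc] : exists c, gradient g z = c *: gradient f z.
  apply: (@zero_set_parallel_gradients f g z r) => //.
  - move=> w /hr[[Uw _] _]; exact: has_gradient_continuous (C1_open_has_gradient Cf Uw).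
  - by have [] := Cf z Uz.
  - by have [] := Cg z Vz.
  - exact: local_defining_boundary0 hf bz Uz.
  - move=> w /hr[[Uw Vw] gw] fw.
    apply: (local_defining_boundary0 oO' hg) => //; rewrite bOO.
    apply: (local_defining_zero_boundary hf) => //.
    by apply: contraTneq gw => ->; rewrite /enorm dot0l sqrtr0 ltxx.
exists ((enorm (gradient g z))^-1 * c); last by rewrite -scalerA hc.
apply: mulf_neq0; first by rewrite invr_neq0 // gt_eqF // enorm_gt0.
by apply: contraNneq gz0 => c0; rewrite hc c0 scale0r.
Qed.

(** Parallelism leaves only a sign open. If grad f and the gradient of the function g behind
    [inner_normal] were opposite, a short step along grad f would reach f > 0 and g < 0, though both
    functions describe the same Omega. *)
Lemma inner_normal_gradient Omega y U f z :
  bounded_C2_domain Omega -> local_defining Omega y U f -> U z ->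
  boundary Omega z -> gradient f z != 0 ->
  inner_normal Omega z = (enorm (gradient f z))^-1 *: gradient f z.
Proof.
move=> hO hf Uz bz g0.
have [c c0 hc] := gradient_parallel_inner_normal hO hO erefl hf Uz bz g0.
have hn := inner_normal_unit hO bz.
have ng := enorm_gt0 g0.
suff cp : 0 < c.
  rewrite hc; congr (_ *: _); move: hn; rewrite hc enormZ gtr0_norm // => h.
  by rewrite -[LHS](mulfK (lt0r_neq0 ng)) h mul1r.
have [V [g [hg eg]]] := inner_normal_spec hO bz.
have [oU _ [Cf _] _ hU] := hf; have [oV Vz [Cg _] gz0 hV] := hg.
have [oO _ _ _ _] := hO.
have fz := local_defining_boundary0 oO hf bz Uz.
have gz := local_defining_boundary0 oO hg bz Vz.
rewrite lt_neqAle eq_sym c0 leNgt; apply/negP => cn.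
have [df _] := Cf z Uz; have [dg _] := Cg z Vz.
have [t1 t10 h1] := positive_direction df fz (dot_gt0 g0).
have ngz : gradient g z = (enorm (gradient g z) * c) *: gradient f z.
  have ngg := enorm_gt0 gz0.
  by rewrite -scalerA -hc eg scalerA divff ?scale1r // gt_eqF.
have dng : 0 < dot (gradient f z) (gradient (fun y => - g y) z).
  have -> : gradient (fun y => - g y) z = - gradient g z.
    by have [_ -> _] := has_gradientN (C1_open_has_gradient Cg Vz).
  have ngg := enorm_gt0 gz0; have ff := dot_gt0 g0.
  by rewrite ngz dotNr dotZr oppr_gt0 pmulr_llt0 // pmulr_rlt0.
have dNg : differentiable (fun y => - g y) z by exact: differentiableN.
have gz' : - g z = 0 by rewrite gz oppr0.
have [t2 t20 h2] := positive_direction dNg gz' dng.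
have /nbhs_eballP[r r0 hr] : nbhs z (U `&` V).
  by apply: filterI; exact: open_nbhs_nbhs.
pose t := Num.min (Num.min t1 t2) (r / enorm (gradient f z)) / 2.
have m0 : 0 < Num.min (Num.min t1 t2) (r / enorm (gradient f z)).
  by rewrite !lt_min t10 t20 divr_gt0.
have t_gt0 : 0 < t by rewrite divr_gt0.
have tm : t < Num.min (Num.min t1 t2) (r / enorm (gradient f z)) by rewrite /t; lra.
move: tm; rewrite !lt_min ltr_pdivlMr // => /andP[/andP[tt1 tt2] tr].
have [Uw Vw] : (U `&` V) (z + t *: gradient f z).
  by apply: hr; rewrite addrAC subrr add0r enormZ gtr0_norm.
have fw : 0 < f (z + t *: gradient f z) by apply: h1; rewrite t_gt0.
have gw : 0 < - g (z + t *: gradient f z) by apply: h2; rewrite t_gt0.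
have := (hV _ Vw).1 ((hU _ Uw).2 fw); lra.
Qed.

(* F is the gradient of a defining function f, and b = F / |F|^2.  The inverse
   of the radius also bounds the derivatives, so that a single constant, which
   depends on S only, controls all the estimates. *)
Definition chart S x0 (r : R) f F b (DF Db : 'I_n.+1 -> E -> E) :=
  [/\ forall x, enorm (x - x0) < r ->
        [/\ has_gradient f F x,
            forall i, has_gradient (fun y => F y 0 i) (DF i) x &
            forall i, has_gradient (fun y => b y 0 i) (Db i) x],
      forall x, enorm (x - x0) < r ->
        [/\ enorm (F x) <= r^-1, enorm (b x) <= r^-1,
            forall i, enorm (DF i x) <= r^-1 & forall i, enorm (Db i x) <= r^-1],
      forall x, enorm (x - x0) < r -> S x -> f x = 0 /\ dot (F x) (b x) = 1 &
      forall Omega x v, bounded_C2_domain Omega -> boundary Omega = S ->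
        enorm (x - x0) < r -> S x ->
        (dot v (F x) = 0 -> tangent Omega x v) /\
        (tangent Omega x v -> dot v (b x) = 0)].

Lemma continuous_locally_bounded F x : {for x, continuous F} ->
  exists2 c : R, 0 < c & \forall y \near x, enorm (F y) <= c.
Proof.
move=> cF; exists (enorm (F x) + 1); first by rewrite ltr_wpDl // enorm_ge0.
have h : enorm (F x) < enorm (F x) + 1 by rewrite ltrDl.
exact: (@cvgr_le R _ (nbhs x) _ _ _ (cvg_enorm cF) _ h).
Qed.

(** The admissible radii are the same for all centres x0 close to y; this uniformity is what the
    compactness argument consumes. *)
Lemma exists_chart_near Omega y : bounded_C2_domain Omega -> boundary Omega y ->
  exists2 r0 : R, 0 < r0 & forall r x0, 0 < r < r0 -> enorm (x0 - y) < r0 ->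
    exists f F b DF Db, chart (boundary Omega) x0 r f F b DF Db.
Proof.
move=> hO by_; have [_ _ _ _ h] := hO; have [U [f hf]] := h y by_.
have [oU Uy C2f g0 _] := hf; have [Cf _] := C2f.
have [oO _ _ _ _] := hO.
pose F := gradient f; pose q x := dot (F x) (F x).
pose DF i := gradient (fun x => F x 0 i).
pose Dq x : E := \sum_i (F x 0 i *: DF i x + F x 0 i *: DF i x).
pose b x := (q x)^-1 *: F x.
pose Db i x : E := (q x)^-1 *: DF i x + F x 0 i *: (- (q x) ^- 2 *: Dq x).
have hF x : U x -> has_gradient f F x by exact: C1_open_has_gradient.
have hDF x i : U x -> has_gradient (fun y => F y 0 i) (DF i) x.
  exact: C2_open_has_gradient.
have hq x : U x -> has_gradient q Dq x.
  by move=> Ux; apply: has_gradient_sum => i; apply: has_gradientM; exact: hDF.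
have hDb x i : U x -> q x != 0 -> has_gradient (fun y => b y 0 i) (Db i) x.
  move=> Ux qx; have -> : (fun y => b y 0 i) = (fun y => (q y)^-1 * F y 0 i).
    by apply/funext => z; rewrite mxE.
  by apply: has_gradientM; [apply: has_gradientV => //; exact: hq|exact: hDF].
have qy : 0 < q y by exact: dot_gt0.
have qy0 : q y != 0 by rewrite gt_eqF.
have nq : \forall x \near y, 0 < q x.
  by have /cvgr_gt/(_ _ qy) := has_gradient_continuous (hq y Uy).
have [cF cF0 nF] : exists2 c : R, 0 < c & \forall x \near y, enorm (F x) <= c.
  by apply: continuous_locally_bounded; have [] := hF y Uy.
have [cb cb0 nb] : exists2 c : R, 0 < c & \forall x \near y, enorm (b x) <= c.
  apply: continuous_locally_bounded.
  apply: (@cvg_row _ _ _ (nbhs y)) => i.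
  exact: has_gradient_continuous (hDb y i Uy qy0).
have all_near (G : 'I_n.+1 -> E -> E) : (forall i, {for y, continuous (G i)}) ->
    exists2 c : R, 0 < c & \forall x \near y, forall i, enorm (G i x) <= c.
  move=> cG; have hc i := cid2 (continuous_locally_bounded (cG i)).
  exists (\sum_i s2val (hc i)).
    rewrite (bigD1 ord0) //= ltr_pwDl ?(s2valP (hc ord0)) //.
    by apply: sumr_ge0 => i _; rewrite ltW // (s2valP (hc i)).
  apply: (@filter_forall _ _ (fun i => [set x | enorm (G i x) <= _]) (nbhs y)) => i.
  apply: filterS (s2valP' (hc i)) => x /= hx.
  apply: le_trans hx _; rewrite [leRHS](bigD1 i) //= lerDl.
  by apply: sumr_ge0 => j _; rewrite ltW // (s2valP (hc j)).
have [cDF cDF0 nDF] : exists2 c : R, 0 < c &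
    \forall x \near y, forall i, enorm (DF i x) <= c.
  by apply: all_near => i; have [] := hDF y i Uy.
have [cDb cDb0 nDb] : exists2 c : R, 0 < c &
    \forall x \near y, forall i, enorm (Db i x) <= c.
  by apply: all_near => i; have [] := hDb y i Uy qy0.
have nU := open_nbhs_nbhs (conj oU Uy).
have /nbhs_eballP[d d0 hd] : nbhs y (U `&` ([set x | 0 < q x] `&`
    (([set x | enorm (F x) <= cF] `&` [set x | enorm (b x) <= cb]) `&`
     ([set x | forall i, enorm (DF i x) <= cDF] `&`
      [set x | forall i, enorm (Db i x) <= cDb])))).
  by do 2 apply: filterI => //; apply: filterI; apply: filterI.
pose c := cF + cb + cDF + cDb.
have c0 : 0 < c by rewrite !addr_gt0.
(* The half keeps the r-ball about x0 within distance d of y, and r < 1/c makes 1/r dominate all the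
   local bounds at once. *)
exists (Num.min (d / 2) c^-1); first by rewrite lt_min divr_gt0 // invr_gt0.
move=> r x0 /andP[r0]; rewrite !lt_min => /andP[rd rc] /andP[xd _].
have hc : c <= r^-1 by rewrite -[c]invrK lef_pV2 ?posrE ?invr_gt0 // ltW.
exists f, F, b, DF, Db.
have hball x : enorm (x - x0) < r -> enorm (x - y) < d.
  by move=> xr; have := enorm_triangle x x0 y; lra.
split.
- move=> x /hball/hd [Ux [qx _]]; split => //; first exact: hF.
    by move=> i; exact: hDF.
  by move=> i; apply: hDb; rewrite ?gt_eqF.
- move=> x /hball/hd [Ux [qx [[h1 h2] [h3 h4]]]].
  split=> [||i|i]; apply: le_trans hc; rewrite /c.
  + by move: h1; rewrite /=; lra.
  + by move: h2; rewrite /=; lra.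
  + by have := h3 i; rewrite /=; lra.
  + by have := h4 i; rewrite /=; lra.
- move=> x /hball/hd [Ux [qx _]] bx; split.
    exact: local_defining_boundary0 hf bx Ux.
  by rewrite /b dotZr mulVf // gt_eqF.
- move=> Omega' x v hO' bO /hball/hd [Ux [qx _]] bx.
  have Fx0 : gradient f x != 0 by rewrite -dot_eq0 gt_eqF.
  have [k k0 hk] := gradient_parallel_inner_normal hO hO' bO hf Ux bx Fx0.
  rewrite /tangent hk dotZr /b dotZr; split=> [->|/eqP]; first by rewrite mulr0.
  by rewrite mulf_eq0 (negPf k0) /= => /eqP ->; rewrite mulr0.
Qed.

Lemma boundary_closed Omega : closed (boundary Omega).
Proof. by apply: closedI; exact: closed_closure. Qed.

(** Compactness in near-covering form: what holds near each point of S for all small r holds on all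
    of S once r is small. One radius for the whole of S is what frees [Lambda] from x0. *)
Lemma exists_chart Omega : bounded_C2_domain Omega -> compact (boundary Omega) ->
  exists2 r : R, 0 < r <= 1 & forall x0, boundary Omega x0 ->
    exists f F b DF Db, chart (boundary Omega) x0 r f F b DF Db.
Proof.
move=> hO /compact_near_coveringP cS.
have h : \forall r \near (0 : R)^'+, boundary Omega `<=`
    [set x0 | exists f F b DF Db, chart (boundary Omega) x0 r f F b DF Db].
  apply: (cS R ((0 : R)^'+) (fun r x0 => exists f F b DF Db,
    chart (boundary Omega) x0 r f F b DF Db)).
  move=> y bo; have [r0 r00 hr] := exists_chart_near hO bo.
  exists ([set x | enorm (x - y) < r0], [set r : R | 0 < r < r0]) => /=.
    split; first exact: nbhs_eball.
    near=> r; apply/andP; split; near: r; [exact: nbhs_right_gt|exact: nbhs_right_lt].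
  by move=> [x r] [/= hx hr0]; exact: hr.
near (0 : R)^'+ => r; exists r; last by near: r.
apply/andP; split; near: r; first exact: nbhs_right_gt.
by apply: nbhs_right_le; exact: ltr01.
Unshelve. all: by end_near. Qed.

End Charts.

(** * Tangential test fields *)

Section TestFields.
Context {R : realType} {n : nat}.
Local Notation E := 'rV[R]_n.+1.
Local Notation M := 'M[R]_n.+1.
Local Notation e i := (delta_mx 0 i : E).
Local Notation N := (n.+1%:R : R).
Implicit Types (u v w x y z : E) (f g : E -> R) (F G b : E -> E) (U S Omega : set E).

Lemma enorm_sum (I : Type) (r : seq I) (G : I -> E) :
  enorm (\sum_(i <- r) G i) <= \sum_(i <- r) enorm (G i).
Proof.
elim: r => [|i r IH]; first by rewrite !big_nil /enorm dot0l sqrtr0.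
by rewrite !big_cons; apply: le_trans (enormD _ _) _; rewrite lerD2l.
Qed.

Lemma enorm_sum_le (v : E) (G : 'I_n.+1 -> E) (c : R) :
  (forall i, enorm (G i) <= c) -> enorm (\sum_i v 0 i *: G i) <= N * (enorm v * c).
Proof.
move=> hG; apply: le_trans (enorm_sum _ _) _.
rewrite -[X in X%:R * _]card_ord mulr_natl -sumr_const; apply: ler_sum => i _.
by rewrite enormZ ler_pM ?normr_ge0 ?enorm_ge0 // coord_le_enorm.
Qed.

Lemma has_gradient_dist2 x0 x :
  has_gradient (fun y => dot (y - x0) (y - x0)) (fun y => 2 *: (y - x0)) x.
Proof.
have h i : has_gradient (fun y => (y - x0) 0 i) (fun=> e i) x.
  have := has_gradientB (has_gradient_coord i x) (has_gradient_cst (x0 0 i) x).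
  congr (has_gradient _ _ _); apply/funext => y; first by rewrite !mxE.
  by rewrite subr0.
have := has_gradient_sum (index_enum 'I_n.+1) (fun i => has_gradientM (h i) (h i)).
congr (has_gradient _ _ _); apply/funext => y.
rewrite big_split /= scaler_nat mulr2n.
by rewrite -(row_sum_delta (y - x0)).
Qed.

(** With c = 1/r bounding F, b and their derivatives, the first summand dominates the quadratic
    error of Z and the second the linear error of its derivative; one constant serves both. *)
Definition field_const (r K : R) : R :=
  N * (N * (r^-1 * r^-1) + K * (1 + r^-1 * r^-1)) +
  (N * (r^-1 * r^-1) *+ 2 + K * ((1 + N) * (r^-1 * r^-1) + 2 * (1 + r^-1 * r^-1))).

(* Z = w - a b + K |w|^2 Y with w = x - x0, a = <w, F> - f and
   Y = tau - <tau, F> b; both w - a b and Y are tangential where f = 0. *)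
Lemma exists_test_field S x0 tau (r K : R) f F b DF Db :
  0 < r <= 1 -> 0 <= K -> enorm tau = 1 -> S x0 -> chart S x0 r f F b DF Db ->
  exists (Z : E -> E) (DZ : 'I_n.+1 -> E -> E),
    [/\ forall x j, enorm (x - x0) < r -> has_gradient (fun y => Z y 0 j) (DZ j) x,
        forall x, enorm (x - x0) < r ->
          enorm (Z x - (x - x0)) <= field_const r K * enorm (x - x0) ^+ 2,
        forall x j, enorm (x - x0) < r ->
          enorm (DZ j x - e j) <= field_const r K * enorm (x - x0),
        forall Omega x, bounded_C2_domain Omega -> boundary Omega = S ->
          enorm (x - x0) < r -> S x -> tangent Omega x (Z x) &
        forall Omega x v, bounded_C2_domain Omega -> boundary Omega = S ->
          enorm (x - x0) < r -> S x -> tangent Omega x v ->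
          dot v (Z x) = dot v (x - x0) + K * enorm (x - x0) ^+ 2 * dot v tau].
Proof.
move=> /andP[r0 r1] K0 tau1 Sx0 [hg hb hS hT].
set c := r^-1 in hb *.
have c1 : 1 <= c by rewrite invf_ge1.
have c0 : 0 <= c by rewrite (le_trans _ c1).
pose a x := dot (x - x0) (F x) - f x.
pose Da x : E := \sum_i (x - x0) 0 i *: DF i x.
pose s2 x := dot (x - x0) (x - x0).
pose T x := dot tau (F x).
pose DT x : E := \sum_i tau 0 i *: DF i x.
pose Y x : E := tau - T x *: b x.
pose DY j x : E := - (T x *: Db j x + b x 0 j *: DT x).
pose Z x : E := x - x0 - a x *: b x + (K * s2 x) *: Y x.
pose DZ j x : E := e j - (a x *: Db j x + b x 0 j *: Da x) +
  ((K * s2 x) *: DY j x + Y x 0 j *: (K *: (2 *: (x - x0)))).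
have hw i x : has_gradient (fun y => (y - x0) 0 i) (fun=> e i) x.
  have := has_gradientB (has_gradient_coord i x) (has_gradient_cst (x0 0 i) x).
  congr (has_gradient _ _ _); apply/funext => y; first by rewrite !mxE.
  by rewrite subr0.
have ha x : enorm (x - x0) < r -> has_gradient a Da x.
  move=> /hg[hf hF _].
  have := has_gradientB (has_gradient_sum (index_enum 'I_n.+1)
    (fun i => has_gradientM (hw i x) (hF i))) hf.
  congr (has_gradient _ _ _); apply/funext => y.
  (* The F that arises from differentiating x - x0 cancels the gradient of f; only second
     derivatives with a factor x - x0 are left. *)
  by rewrite big_split /= -(row_sum_delta (F y)) addrK.
have hTg x : enorm (x - x0) < r -> has_gradient T DT x.
  move=> /hg[_ hF _].
  have := has_gradient_sum (index_enum 'I_n.+1)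
    (fun i => has_gradientM (has_gradient_cst (tau 0 i) x) (hF i)).
  congr (has_gradient _ _ _); apply/funext => y.
  by apply: eq_bigr => i _; rewrite scaler0 addr0.
have hY x j : enorm (x - x0) < r -> has_gradient (fun y => Y y 0 j) (DY j) x.
  move=> xr; have [_ _ hbj] := hg x xr.
  have := has_gradientB (has_gradient_cst (tau 0 j) x)
    (has_gradientM (hTg x xr) (hbj j)).
  congr (has_gradient _ _ _); apply/funext => y; first by rewrite !mxE.
  by rewrite sub0r.
have hKs x : has_gradient (fun y => K * s2 y) (fun y => K *: (2 *: (y - x0))) x.
  have := has_gradientM (has_gradient_cst K x) (has_gradient_dist2 x0 x).
  congr (has_gradient _ _ _); apply/funext => y.
  by rewrite scaler0 addr0.
have hZ x j : enorm (x - x0) < r -> has_gradient (fun y => Z y 0 j) (DZ j) x.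
  move=> xr; have [_ _ hbj] := hg x xr.
  have := has_gradientD (has_gradientB (hw j x)
    (has_gradientM (ha x xr) (hbj j))) (has_gradientM (hKs x) (hY x j xr)).
  by congr (has_gradient _ _ _); apply/funext => y; rewrite !mxE.
have Da_le x : enorm (x - x0) < r -> enorm (Da x) <= N * c * enorm (x - x0).
  move=> /hb[_ _ h _]; apply: le_trans (enorm_sum_le _ h) _.
  by rewrite -mulrA [_ * c]mulrC.
have x0r : enorm (x0 - x0) < r by rewrite subrr /enorm dot0l sqrtr0.
have Nc0 : 0 <= N * c by rewrite mulr_ge0.
have a_le x : enorm (x - x0) < r -> `|a x| <= N * c * enorm (x - x0) ^+ 2.
  move=> xr.
  have seg t : 0 <= t <= 1 -> enorm (x0 + t *: (x - x0) - x0) = t * enorm (x - x0).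
    by move=> /andP[t0 _]; rewrite addrAC subrr add0r enormZ ger0_norm.
  have segr t : 0 <= t <= 1 -> enorm (x0 + t *: (x - x0) - x0) < r.
    move=> t01; rewrite seg //; apply: le_lt_trans xr.
    by apply: ler_piMl; [exact: enorm_ge0|case/andP: t01].
  apply: (@gradient_quadratic_bound _ _ a Da) => //.
  - by move=> t /segr/ha.
  - by move=> t t01; rewrite -(seg t t01); exact/Da_le/segr.
  - by rewrite /a subrr dot0l sub0r (hS _ x0r Sx0).1 oppr0.
have T_le x : enorm (x - x0) < r -> `|T x| <= c.
  move=> /hb[h _ _ _]; apply: le_trans (dot_le_enorm _ _) _.
  by rewrite tau1 mul1r.
have DT_le x : enorm (x - x0) < r -> enorm (DT x) <= N * c.
  by move=> /hb[_ _ h _]; have := enorm_sum_le tau h; rewrite tau1 mul1r.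
have Y_le x : enorm (x - x0) < r -> enorm (Y x) <= 1 + c * c.
  move=> xr; have [_ h _ _] := hb x xr.
  apply: le_trans (enormD _ _) _; rewrite tau1 lerD2l enormN enormZ.
  by rewrite ler_pM ?normr_ge0 ?enorm_ge0 // T_le.
have bj_le x j : enorm (x - x0) < r -> `|b x 0 j| <= c.
  by move=> /hb[_ h _ _]; exact: le_trans (coord_le_enorm _ _) h.
have DY_le x j : enorm (x - x0) < r -> enorm (DY j x) <= (1 + N) * (c * c).
  move=> xr; have [_ h _ h'] := hb x xr.
  rewrite enormN mulrDl mul1r; apply: le_trans (enormD _ _) _.
  rewrite !enormZ lerD //.
    by rewrite ler_pM ?normr_ge0 ?enorm_ge0 // T_le.
  by rewrite [leRHS]mulrCA ler_pM ?normr_ge0 ?enorm_ge0 ?bj_le ?DT_le.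
have s2E x : s2 x = enorm (x - x0) ^+ 2 by rewrite enorm_sqr.
have s2_ge0 x : 0 <= s2 x by exact: dot_ge0.
have CA : 0 <= N * (N * (c * c) + K * (1 + c * c)).
  by rewrite !(mulr_ge0, addr_ge0).
have CB : 0 <= N * (c * c) *+ 2 + K * ((1 + N) * (c * c) + 2 * (1 + c * c)).
  by rewrite !(mulr_ge0, addr_ge0, mulrn_wge0).
exists Z, DZ; split.
- by move=> x j /hZ.
- move=> x xr; have [_ h _ _] := hb x xr.
  have -> : Z x - (x - x0) = (K * s2 x) *: Y x - a x *: b x.
    by rewrite /Z addrAC addrC [x - x0 - _]addrC addrK.
  apply: (@le_trans _ _ ((N * (c * c) + K * (1 + c * c)) * enorm (x - x0) ^+ 2)).
    apply: le_trans (enormD _ _) _; rewrite enormN !enormZ addrC mulrDl.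
    apply: lerD.
      have -> : N * (c * c) * enorm (x - x0) ^+ 2 = N * c * enorm (x - x0) ^+ 2 * c.
        by ring.
      by apply: ler_pM; rewrite ?normr_ge0 ?enorm_ge0 // a_le.
    rewrite ger0_norm ?mulr_ge0 // s2E.
    have -> : K * (1 + c * c) * enorm (x - x0) ^+ 2 =
      K * enorm (x - x0) ^+ 2 * (1 + c * c) by ring.
    by apply: ler_wpM2l; [rewrite mulr_ge0 ?sqr_ge0|exact: Y_le].
  apply: ler_wpM2r; first exact: sqr_ge0.
  rewrite /field_const -/c; apply: ler_wpDr => //.
  by rewrite ler_peMl ?ler1n // !(mulr_ge0, addr_ge0).
- move=> x j xr; have [_ h _ h'] := hb x xr.
  set s := enorm (x - x0).
  have s0 : 0 <= s by exact: enorm_ge0.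
  (* As s < r <= 1, quadratic errors can be absorbed into linear ones. *)
  have ss : s ^+ 2 <= s.
    by rewrite expr2 ler_piMl // (le_trans (ltW xr)).
  have -> : DZ j x - e j = - (a x *: Db j x + b x 0 j *: Da x) +
      ((K * s2 x) *: DY j x + Y x 0 j *: (K *: (2 *: (x - x0)))).
    by rewrite /DZ addrAC [e j - _]addrC addrK.
  apply: (@le_trans _ _ ((N * (c * c) *+ 2 +
      K * ((1 + N) * (c * c) + 2 * (1 + c * c))) * s)); last first.
    by apply: ler_wpM2r => //; rewrite /field_const -/c ler_wpDl.
  apply: le_trans (enormD _ _) _; rewrite mulrDl; apply: lerD.
    rewrite enormN; apply: le_trans (enormD _ _) _.
    rewrite mulr2n mulrDl !enormZ; apply: lerD.
      have -> : N * (c * c) * s = N * c * s * c by ring.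
      apply: ler_pM; rewrite ?normr_ge0 ?enorm_ge0 //.
      apply: le_trans (a_le x xr) _.
      by apply: ler_wpM2l.
    have -> : N * (c * c) * s = c * (N * c * s) by ring.
    by apply: ler_pM; rewrite ?normr_ge0 ?enorm_ge0 ?bj_le ?Da_le.
  apply: le_trans (enormD _ _) _; rewrite !enormZ !normrM !(ger0_norm K0).
  rewrite (ger0_norm (s2_ge0 x)) s2E -/s (ger0_norm (ler0n R 2)).
  have -> : K * ((1 + N) * (c * c) + 2 * (1 + c * c)) * s =
    K * s * ((1 + N) * (c * c)) + (1 + c * c) * (K * (2 * s)) by ring.
  apply: lerD; apply: ler_pM; rewrite ?mulr_ge0 ?sqr_ge0 ?enorm_ge0 ?normr_ge0 //.
  - exact: ler_wpM2l.
  - exact: DY_le.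
  - exact: le_trans (coord_le_enorm _ _) (Y_le _ xr).
- move=> Omega x hO bO xr Sx; have [h _] := hT Omega x (Z x) hO bO xr Sx.
  apply: h; have [fx Fb] := hS x xr Sx.
  have Fb' : dot (b x) (F x) = 1 by rewrite dotC.
  (* With f = 0 and <b, F> = 1, subtracting a b removes <x - x0, F>, and subtracting T b removes
     <tau, F>. *)
  rewrite /Z /Y !(dotDl, dotNl, dotZl) Fb' /a fx -/(T x) !(dotDl, dotNl).
  ring.
- move=> Omega x v hO bO xr Sx tv; have [_ h] := hT Omega x v hO bO xr Sx.
  have {}h := h tv.
  by rewrite /Z /Y !(dotDr, dotNr, dotZr) h s2E; ring.
Qed.

Lemma differentiable_row (phi : E -> E) x :
  (forall j, differentiable (fun y => phi y 0 j) x) -> differentiable phi x.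
Proof.
move=> h; have -> : phi = \sum_j (fun y => phi y 0 j *: e j).
  by apply/funext => y; rewrite {1}(row_sum_delta (phi y)) fct_sumE.
by apply: differentiable_sum => j; exact: differentiableZl.
Qed.

Lemma gradients_tangential_test Omega (phi : E -> E) (G : 'I_n.+1 -> E -> E) x0 (r : R) :
  (forall x j, has_gradient (fun y => phi y 0 j) (G j) x) ->
  (forall x, boundary Omega x -> tangent Omega x (phi x)) ->
  (forall x, phi x != 0 -> enorm (x - x0) <= r) ->
  tangential_test Omega phi (fun x => \matrix_(i, j) G j x 0 i).
Proof.
move=> hG ht hr; have dphi x : differentiable phi x.
  by apply: differentiable_row => j; have [] := hG x j.
split => //.
- by apply: continuous_subspaceT => x; exact: differentiable_continuous.
- apply: continuous_subspaceT => x.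
  apply: (@cvg_mx_coord _ _ (nbhs x)) => i j; rewrite mxE.
  under eq_fun do rewrite mxE.
  by have [_ _ cG] := hG x j; exact: cvg_coord cG.
- move=> x _; split => //; apply/matrixP => i j.
  rewrite [RHS]mxE /jacobian mxE -deriveE //.
  rewrite derive_mx; last exact: diff_derivable.
  by rewrite mxE; have [_ ->] := has_gradient_is_derive i (hG x j).
- apply: (subclosed_compact (@closed_closure _ _) (@cball_compact R n x0 r)).
  have -> : cball x0 r = closure (cball x0 r).
    by apply/(closure_id _).1/cball_closed.
  by apply: closure_subset => x [_ /hr].
Qed.

(** The divergence of h Z splits into h tr(P (1 + Err)) and 2 dh t^-2 <zP, w>. The trace of P is m.
    Since dh <= 0, the second part needs only the upper bound <wP, w> <= |w|^2, which makes the
    estimate independent of the plane. The errors become multiples of t through |w| <= 2 t. *)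
Lemma plane_div_lower (m : nat) (P : M) (w z : E) (D : 'I_n.+1 -> E) (h dh t C : R) :
  grassmannian R n m P -> 0 <= h -> dh <= 0 -> 0 < t -> 0 <= C ->
  enorm w <= 2 * t ->
  enorm (z - w) <= C * enorm w ^+ 2 -> (forall j, enorm (D j - e j) <= C * enorm w) ->
  h * (m%:R - 2 * (n.+1 * n.+1)%:R * C * t) +
    2 * dh * (t ^- 2 * enorm w ^+ 2) * (1 + 2 * (n.+1 * n.+1)%:R * C * t)
  <= plane_div P
       (\matrix_(i, j) (h *: D j + z 0 j *: (dh *: (t ^- 2 *: (2 *: w)))) 0 i).
Proof.
move=> [Ps Pi Pm] h0 dh0 t0 C0 wt hz hD.
set N2 := (n.+1 * n.+1)%:R.
pose Err : M := \matrix_(i, j) (D j - e j) 0 i.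
have -> : \matrix_(i, j) (h *: D j + z 0 j *: (dh *: (t ^- 2 *: (2 *: w)))) 0 i =
    h *: (1%:M + Err) + (2 * dh * t ^- 2) *: (w^T *m z).
  apply/matrixP => i j; rewrite !mxE big_ord1 !mxE eqxx /= (eq_sym i j); ring.
rewrite /plane_div mulmxDr -!scalemxAr mulmxDr mulmx1 mxtraceD !mxtraceZ mxtraceD.
rewrite (mxtrace_idem Pi) Pm.
have -> : \tr (P *m (w^T *m z)) = dot (z *m P) w.
  rewrite mulmxA mxtrace_mulC mulmxA /mxtrace big_ord1 mxE.
  by apply: eq_bigr => i _; rewrite [w^T _ _]mxE.
have s0 := enorm_ge0 w; set s := enorm w in wt hz hD s0 *.
have N21 : 1 <= N2 by rewrite ler1n muln_gt0.
have hE : `|\tr (P *m Err)| <= N2 * (C * s).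
  apply: mxtrace_mul_le => // i j; rewrite mxE.
  exact: le_trans (coord_le_enorm _ _) (hD j).
have hE' : - (2 * N2 * C * t) <= \tr (P *m Err).
  apply: le_trans (lerNnormlW hE); rewrite lerN2.
  have -> : 2 * N2 * C * t = N2 * (C * (2 * t)) by ring.
  by rewrite ler_wpM2l // ?(le_trans _ N21) // ler_wpM2l.
have hdot : dot (z *m P) w <= s ^+ 2 * (1 + 2 * N2 * C * t).
  have -> : dot (z *m P) w = dot (w *m P) w + dot (w *m P) (z - w).
    by rewrite dotBr addrC subrK dot_mulmx_sym // dotC.
  rewrite mulrDr mulr1; apply: lerD; first by have /andP[] := dot_proj_bounds w Ps Pi.
  apply: le_trans (ler_norm _) _; apply: le_trans (dot_le_enorm _ _) _.
  apply: (@le_trans _ _ (2 * t * (C * s ^+ 2))).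
    apply: ler_pM; rewrite ?enorm_ge0 //.
    exact: le_trans (enorm_proj_le _ Ps Pi) wt.
  have -> : s ^+ 2 * (2 * N2 * C * t) = N2 * (2 * t * (C * s ^+ 2)) by ring.
  by rewrite ler_peMl // !mulr_ge0 ?sqr_ge0 // ltW.
rewrite lerD //; first by rewrite ler_wpM2l // lerD2l.
have -> : 2 * dh * (t ^- 2 * s ^+ 2) * (1 + 2 * N2 * C * t) =
  (2 * dh * t ^- 2) * (s ^+ 2 * (1 + 2 * N2 * C * t)) by ring.
rewrite ler_wnM2l // mulr_le0_ge0 ?invr_ge0 ?sqr_ge0 //.
by rewrite mulr_ge0_le0.
Qed.

(** The derivative is carried explicitly, because it enters both the test field and the derivative
    of the weighted mass. [U1] bounds the support from the right. *)
Definition cutoff (h dh : R -> R) (U1 : R) :=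
  [/\ forall a : R, is_derive a 1 h (dh a), continuous dh,
      forall a, 0 <= h a <= 1, forall a, dh a <= 0 &
      forall a, U1 <= a -> h a = 0 /\ dh a = 0].

(** Where |x - x0| >= r, the condition U1 t^2 < r^2 puts the argument of h strictly beyond [U1]; the
    field then vanishes near x, and nothing is asked of Z there. *)
Lemma cutoff_field_gradient (h dh : R -> R) (U1 t r : R) x0 (Z : E -> E) (DZ : 'I_n.+1 -> E -> E) :
  cutoff h dh U1 -> 0 < t -> 0 < r -> U1 * t ^+ 2 < r ^+ 2 ->
  (forall x j, enorm (x - x0) < r -> has_gradient (fun y => Z y 0 j) (DZ j) x) ->
  forall x (j : 'I_n.+1), has_gradient
    (fun y => (h (t ^- 2 * enorm (y - x0) ^+ 2) *: Z y : E) 0 j)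
    (fun y => h (t ^- 2 * enorm (y - x0) ^+ 2) *: DZ j y +
      Z y 0 j *: (dh (t ^- 2 * enorm (y - x0) ^+ 2) *: (t ^- 2 *: (2 *: (y - x0)))))
    x.
Proof.
move=> [hh cdh _ _ hU] t0 r0 Ur hZ x j.
have [xr|rx] := ltP (enorm (x - x0)) r.
  have hu : has_gradient (fun y => t ^- 2 * enorm (y - x0) ^+ 2)
      (fun y => t ^- 2 *: (2 *: (y - x0))) x.
    have := has_gradientM (has_gradient_cst (t ^- 2) x) (has_gradient_dist2 x0 x).
    congr (has_gradient _ _ _); apply/funext => y; first by rewrite enorm_sqr.
    by rewrite scaler0 addr0.
  have := has_gradientM (has_gradient_comp hu hh (cdh _)) (hZ x j xr).
  by congr (has_gradient _ _ _); apply/funext => y; rewrite mxE.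
have hx : U1 < t ^- 2 * enorm (x - x0) ^+ 2.
  rewrite mulrC ltr_pdivlMr ?exprn_gt0 //; apply: lt_le_trans Ur _.
  by rewrite ler_pXn2r ?nnegrE ?enorm_ge0 // ltW.
have nx : \forall y \near x, U1 < t ^- 2 * enorm (y - x0) ^+ 2.
  have c1 : (fun y => t ^- 2 * enorm (y - x0) ^+ 2) @ x --> t ^- 2 * enorm (x - x0) ^+ 2.
    rewrite enorm_sqr; under eq_fun do rewrite enorm_sqr.
    have c2 := has_gradient_continuous (has_gradient_dist2 x0 x).
    by apply: (@cvgM _ _ (nbhs x)) => //; exact: cvg_cst.
  exact: (@cvgr_gt R _ (nbhs x) _ _ _ c1 _ hx).
apply: near_eq_has_gradient (has_gradient_cst 0 x).
  by apply: filterS nx => y /ltW/hU[-> _]; rewrite scale0r mxE.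
by apply: filterS nx => y /ltW/hU[-> ->]; rewrite !scale0r scaler0 addr0.
Qed.

End TestFields.

(** * Disintegration and the boundary term *)

Section GraphKernel.
Context d1 d2 (X : measurableType d1) (Y : measurableType d2) (R : realType).
Context (sigma : {measure set X -> \bar R}) (sigma_fin : (sigma setT < +oo)%E).
Context (k : R.-pker X ~> Y).
Local Open Scope ereal_scope.

(** The measure sigma as a kernel from the one-point space, so that composition of kernels yields a
    measure on the product. *)
Definition cst_kernel (_ : unit) : {measure set X -> \bar R} := sigma.

Let cst_kernel_measurable (U : set X) : measurable U ->
  measurable_fun [set: unit] (cst_kernel ^~ U : _ -> \bar R).
Proof. by move=> mU; exact: measurable_cst. Qed.

HB.instance Definition _ := isKernel.Build _ _ _ _ R cst_kernel cst_kernel_measurable.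

Let cst_kernel_uub : measure_fam_uub cst_kernel.
Proof.
exists (fine (sigma setT) + 1)%R; move=> u; rewrite /cst_kernel EFinD fineK ?ge0_fin_numE //.
by rewrite lteDl ?lte_fin ?ltr01 // ge0_fin_numE.
Qed.

HB.instance Definition _ := Kernel_isFinite.Build _ _ _ _ R cst_kernel cst_kernel_uub.

(** The image of the fibre measure under y -> (x, y). Composed with [cst_kernel] it gives the
    product-space measure with base sigma and fibres [k x]. *)
Definition graph_kernel (z : unit * X) : {measure set (X * Y) -> \bar R} :=
  @measure_function_pushforward__canonical__measure_function_Measure
    _ _ _ _ _ (k z.2) _ (@pair1_measurable _ _ X Y z.2).

Let graph_kernel_measurable (U : set (X * Y)) : measurable U ->
  measurable_fun [set: unit * X] (graph_kernel ^~ U : _ -> \bar R).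
Proof.
move=> mU; rewrite (_ : graph_kernel ^~ U = (fun x => k x (xsection U x)) \o snd).
  apply: measurableT_comp => //.
  by apply: measurable_fun_xsection_finite_kernel; rewrite inE.
apply/funext => z /=; rewrite /pushforward; congr (k _ _).
by apply/seteqP; split => y; rewrite /xsection /= inE.
Qed.

HB.instance Definition _ :=
  isKernel.Build _ _ _ _ R graph_kernel graph_kernel_measurable.

Let graph_kernel_prob z : graph_kernel z setT = 1.
Proof. by rewrite /= /pushforward preimage_setT prob_kernel. Qed.

HB.instance Definition _ :=
  Kernel_isProbability.Build _ _ _ _ R graph_kernel graph_kernel_prob.

(** [nu] and the composed kernel are finite and agree on rectangles, a generating family stable
    under intersection; hence they are equal. The formula is then the integration rule for composed
    kernels. *)
Lemma ge0_integral_disintegration (nu : {measure set (X * Y) -> \bar R})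
    (f : X * Y -> \bar R) :
  (forall A B, measurable A -> measurable B ->
    nu (A `*` B) = \int[sigma]_(x in A) k x B) ->
  (forall z, 0 <= f z) -> measurable_fun setT f ->
  \int[nu]_z f z = \int[sigma]_x \int[k x]_y f (x, y).
Proof.
move=> hnu f0 mf.
have := @integral_kcomp _ _ _ _ _ _ R cst_kernel graph_kernel tt f f0 mf; move=> kE.
transitivity (\int[kcomp cst_kernel graph_kernel tt]_z f z).
  apply: eq_measure_integral => A mA _.
  apply: (@measure_unique _ R _ [set A `*` B | A in measurable & B in measurable]
    (fun=> setT)) => //.
  - exact: measurable_prod_measurableType.
  - move=> _ _ [A1 mA1 [B1 mB1 <-]] [A2 mA2 [B2 mB2 <-]].
    rewrite -setXI; exists (A1 `&` A2); first exact: measurableI.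
    by exists (B1 `&` B2) => //; exact: measurableI.
  - by move=> i; exists setT => //; exists setT => //; rewrite setXTT.
  - by apply/seteqP; split => // x _; exists 0%N.
  - move=> _ [A1 mA1 [B1 mB1 <-]]; rewrite hnu // /kcomp /= integral_mkcond.
    apply: eq_integral => x _; rewrite patchE /pushforward.
    case: ifPn => [/set_mem Ax|/negP Ax].
      by congr (k x _); apply/seteqP; split => y //= [].
    rewrite /graph_kernel /= /pushforward.
    suff -> : pair x @^-1` (A1 `*` B1) = set0 by rewrite measure0.
    by apply/seteqP; split => y //= [/mem_set].
  - move=> _; rewrite -setXTT hnu //; under eq_integral do rewrite prob_kernel.
    by rewrite integral_cst // mul1e.
rewrite kE; apply: eq_integral => x _ /=.
by rewrite ge0_integral_pushforward // preimage_setT.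
Qed.

End GraphKernel.

Section BorelFunctions.
Context {R : realType} {T : ptopologicalType}.

Lemma borel_open (A : set T) : open A -> measurable (A : set (borel T)).
Proof. exact: sub_sigma_algebra. Qed.

Lemma borel_closed (A : set T) : closed A -> measurable (A : set (borel T)).
Proof.
by move=> cA; rewrite -[A]setCK; apply: measurableC; apply: borel_open; exact: closed_openC.
Qed.

Lemma within_continuous_borel (D : set T) (f : T -> R) :
  measurable (D : set (borel T)) -> {within D, continuous f} ->
  measurable_fun (D : set (borel T)) (f : borel T -> R).
Proof.
move=> mD /continuousP cf; apply: (measurability _ (RGenOpens.measurableE R)).
move=> _ [_ [a [b ->] <-]].
have /open_subspaceP[V oV VD] : open (from_subspace D f @^-1` `]a, b[).
  exact/cf/interval_open.
by rewrite setIC -VD; apply: measurableI => //; exact: borel_open.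
Qed.

Lemma continuous_borel (f : T -> R) : continuous f ->
  measurable_fun setT (f : borel T -> R).
Proof.
by move=> cf; apply: within_continuous_borel => //; exact: continuous_subspaceT.
Qed.

End BorelFunctions.

(** * Compactness of the Grassmannian and of the capillary bundle *)

Section Compactness.
Context {R : realType} {n : nat} (m : nat).
Local Notation E := 'rV[R]_n.+1.
Local Notation M := 'M[R]_n.+1.

(** The normal and the contact angle carry information on S only. Continuity within S follows from a
    continuous local extension at each point, such as a normalised gradient. *)
Definition local_extension (T T' : topologicalType) (A : set T) (f : T -> T') :=
  forall x, A x -> exists g : T -> T',
    {for x, continuous g} /\ \forall y \near x, A y -> f y = g y.

Lemma within_continuous_local (T T' : topologicalType) (A : set T) (f : T -> T') :
  local_extension A f -> {within A, continuous f}.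
Proof.
(* Points outside A are isolated in the subspace topology. *)
move=> h x; have [Ax|nAx] := pselect (A x); last first.
  move=> B /= fB; rewrite /nbhs /= /nbhs_subspace.
  case: ifPn => [/set_mem //|_]; move=> _ ->; exact: nbhs_singleton fB.
have [g [cg fg]] := h x Ax; have fgx := nbhs_singleton fg Ax.
move=> B /= fB; rewrite /nbhs /= /nbhs_subspace mem_set //.
have /cg gB : nbhs (g x) B by rewrite -fgx.
by apply: filterS2 fg gB => y e By Ay; change (B (f y)); rewrite e.
Qed.

Lemma closed_zero_set (T : topologicalType) (g : T -> R) :
  continuous g -> closed [set x | g x = 0].
Proof.
by move=> cg; exact: (closed_comp (fun y _ => cg y) (@closed_eq R 0)).
Qed.

Lemma mx_entry_continuous (i j : 'I_n.+1) : continuous (fun P : M => P i j).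
Proof. exact: coord_continuous. Qed.

(** The rank is not continuous in P; for idempotents it is the trace, which turns the Grassmannian
    into the zero set of polynomials in the entries. *)
Lemma grassmannianP (P : M) :
  grassmannian R n m P <-> [/\ P^T = P, P *m P = P & \tr P = m%:R].
Proof.
split=> [[Ps Pi Pm]|[Ps Pi Pm]]; split => //; first by rewrite mxtrace_idem // Pm.
by move: Pm; rewrite mxtrace_idem // => /eqP; rewrite eqr_nat => /eqP.
Qed.

Lemma grassmannian_closed : closed (grassmannian R n m).
Proof.
have -> : grassmannian R n m =
    (\bigcap_(ij in @setT ('I_n.+1 * 'I_n.+1)) [set P : M | P ij.2 ij.1 - P ij.1 ij.2 = 0]) `&`
    (\bigcap_(ij in @setT ('I_n.+1 * 'I_n.+1))
       [set P : M | \sum_k P ij.1 k * P k ij.2 - P ij.1 ij.2 = 0]) `&`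
    [set P : M | \sum_i P i i - m%:R = 0].
  apply/seteqP; split => P.
    move=> /grassmannianP[Ps Pi Pm]; split; last by rewrite /= -Pm subrr.
    split=> [[i j] _|[i j] _] /=; first by rewrite -{1}Ps mxE subrr.
    by rewrite -{3}Pi mxE subrr.
  move=> [[h1 h2] h3]; apply/grassmannianP; split.
  - by apply/matrixP => i j; rewrite mxE; apply/subr0_eq; exact: (h1 (i, j)).
  - by apply/matrixP => i j; rewrite mxE; apply/subr0_eq; exact: (h2 (i, j)).
  - exact/subr0_eq.
apply: closedI; last first.
  apply: closed_zero_set => P; apply: (@cvgB _ _ _ (nbhs P)); last exact: cvg_cst.
  by apply: (@cvg_sum _ _ _ (nbhs P)) => i; exact: mx_entry_continuous.
apply: closedI; apply: closed_bigI => -[i j] _; apply: closed_zero_set => P.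
  by apply: (@cvgB _ _ _ (nbhs P)); exact: mx_entry_continuous.
apply: (@cvgB _ _ _ (nbhs P)); last exact: mx_entry_continuous.
apply: (@cvg_sum _ _ _ (nbhs P)) => l.
by apply: (@cvgM _ _ (nbhs P)); exact: mx_entry_continuous.
Qed.

Lemma vec_mx_continuous : continuous (@vec_mx R n.+1 n.+1).
Proof.
move=> v; apply: (@cvg_mx_coord _ _ (nbhs v)) => i j; rewrite mxE.
under eq_fun do rewrite mxE.
exact: coord_continuous.
Qed.

(** Heine-Borel for matrices written as row vectors: the entries of an orthogonal projection are at
    most 1 in absolute value. *)
Lemma grassmannian_compact : compact (grassmannian R n m).
Proof.
pose A : set 'rV[R]_(n.+1 * n.+1) := [set v | grassmannian R n m (vec_mx v)].
have -> : grassmannian R n m = vec_mx @` A.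
  apply/seteqP; split => [P hP|_ [v hv <-]] //.
  by exists (mxvec P); rewrite /A /= mxvecK.
apply: continuous_compact.
  by apply: continuous_subspaceT; exact: vec_mx_continuous.
apply: bounded_closed_compact; last first.
  exact: (closed_comp (fun y _ => @vec_mx_continuous y) grassmannian_closed).
exists 1; split; first exact: num_real.
move=> c c1 v [Ps Pi _]; apply: le_trans (ltW c1).
rewrite /Num.Def.normr /= mx_normrE; apply: bigmax_le => // -[i j] _ /=.
rewrite (ord1 i); case/mxvec_indexP: j => j l.
by have := proj_entry_le1 j l Ps Pi; rewrite mxE.
Qed.

(** One defining function gives the normal at all nearby boundary points, and its normalised
    gradient is continuous in a full neighbourhood. *)
Lemma inner_normal_extension (Omega : set E) : bounded_C2_domain Omega ->
  local_extension (boundary Omega) (inner_normal Omega).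
Proof.
move=> hO x bx.
have [_ _ _ _ h] := hO; have [U [f hf]] := h x bx.
have [oU Ux [Cf _] g0 _] := hf.
have [_ _ cG] := C1_open_has_gradient Cf Ux.
have ng := enorm_gt0 g0; have ng0 : enorm (gradient f x) != 0 by rewrite gt_eqF.
exists (fun y => (enorm (gradient f y))^-1 *: gradient f y); split.
  exact: (cvgZ (cvgV ng0 (cvg_enorm cG)) cG).
have nG : \forall w \near x, 0 < enorm (gradient f w).
  exact: (@cvgr_gt R _ (nbhs x) _ _ _ (cvg_enorm cG) _ ng).
apply: filterS2 nG (open_nbhs_nbhs (conj oU Ux)) => y gy Uy by_.
apply: (inner_normal_gradient hO hf Uy by_).
by apply: contraTneq gy => ->; rewrite /enorm dot0l sqrtr0 ltxx.
Qed.

Lemma C1_set_extension (A : set E) (f : E -> R) : C1_set A f -> local_extension A f.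
Proof.
move=> h x Ax.
have [U [g [oU Ux Cg fg]]] := h x Ax; exists g; split.
  by have [/differentiable_continuous] := Cg x Ux.
apply: filterS (open_nbhs_nbhs (conj oU Ux)) => y Uy Ay.
by apply: fg; rewrite inE.
Qed.

Lemma boundary_sub_closure (Omega : set E) : boundary Omega `<=` closure Omega.
Proof. by move=> x []. Qed.

Lemma closure_compact (Omega : set E) : bounded_set Omega -> compact (closure Omega).
Proof.
move=> [c [_ hc]].
have sub : Omega `<=` cball 0 (n.+1%:R * (c + 1)).
  move=> x Ox; rewrite /cball /= subr0; apply: le_trans (enorm_le_norm _) _.
  by rewrite ler_pM2l ?ltr0n //; apply: hc Ox; rewrite ltrDl.
apply: (subclosed_compact (@closed_closure _ _) (@cball_compact R n 0 _)).
  rewrite [X in _ `<=` X](closure_id _).1; last exact: cball_closed.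
  exact: closure_subset sub.
Qed.

Lemma boundary_compact (Omega : set E) : bounded_C2_domain Omega ->
  compact (boundary Omega).
Proof.
move=> [_ _ _ bO _]; apply: (subclosed_compact _ (closure_compact bO)); last exact: boundary_sub_closure.
exact: boundary_closed.
Qed.

Lemma grassmann_bundle_compact (A : set E) : compact A ->
  compact (grassmann_bundle m A).
Proof. by move=> cA; apply: compact_setX => //; exact: grassmannian_compact. Qed.

(* The orthogonality condition in [capillary_planes] holds for every plane. *)
Lemma capillary_planesE (Omega : set E) (beta : E -> R) x :
  capillary_planes m Omega beta x = [set P | grassmannian R n m P /\
    enorm (plane_normal Omega x P) = sin (beta x)].
Proof.
apply/seteqP; split => [P [h1 h2 _] //|P [h1 h2]]; split => // v vP tv.
by have [Ps _ _] := h1; rewrite dotC dot_mulmx_sym // vP dotC.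
Qed.

Lemma cvg_mulmx (T : Type) (F : set_system T) {FF : Filter F} (f : T -> E) (g : T -> M)
    (v : E) (P : M) :
  f @ F --> v -> g @ F --> P -> (fun x => f x *m g x) @ F --> v *m P.
Proof.
move=> fv gP; apply: cvg_row => i; rewrite mxE; under eq_fun do rewrite mxE.
apply: cvg_sum => j; apply: cvgM; first exact: cvg_coord.
exact: (@cvg_comp _ _ _ g (fun P : M => P j i) _ _ _ gP (@mx_entry_continuous _ _ P)).
Qed.

Lemma capillary_planes_closed (Omega : set E) (beta : E -> R) x :
  closed (capillary_planes m Omega beta x).
Proof.
rewrite capillary_planesE.
have -> : [set P | grassmannian R n m P /\
      enorm (plane_normal Omega x P) = sin (beta x)] =
    grassmannian R n m `&` [set P | enorm (plane_normal Omega x P) - sin (beta x) = 0].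
  apply/seteqP; split => P [h1 h2]; split => //=; first by rewrite h2 subrr.
  exact: subr0_eq.
apply: closedI; first exact: grassmannian_closed.
apply: closed_zero_set => P; apply: (@cvgB _ _ _ (nbhs P)); last exact: cvg_cst.
apply: (@cvg_enorm _ _ _ (nbhs P)); apply: (@cvg_mulmx _ (nbhs P)); first exact: cvg_cst.
exact: cvg_id.
Qed.

(** Inside the compact product of S and the Grassmannian, the bundle is the zero set of |P(nu)| -
    sin beta, which is continuous there. Compactness makes Gamma finite and the bundle Borel. *)
Lemma capillary_bundle_compact (Omega : set E) (beta : E -> R) :
  bounded_C2_domain Omega -> contact_angle Omega beta ->
  compact (capillary_bundle m Omega beta).
Proof.
move=> hO [hb _].
have cK : compact (boundary Omega `*` grassmannian R n m).
  by apply: compact_setX; [exact: boundary_compact|exact: grassmannian_compact].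
pose g (z : bundle R n) := enorm (plane_normal Omega z.1 z.2) - sin (beta z.1).
have cg : {within boundary Omega `*` grassmannian R n m, continuous g}.
  apply: within_continuous_local => -[x P] [/= bx _].
  have [nu [cnu enu]] := inner_normal_extension hO bx.
  have [be [cbe ebe]] := C1_set_extension hb bx.
  exists (fun z => enorm (nu z.1 *m z.2) - sin (be z.1)); split.
    have c1 : {for ((x, P) : bundle R n), continuous (nu \o fst)}.
      by apply: continuous_comp; [exact: cvg_fst|exact: cnu].
    have c2 : {for ((x, P) : bundle R n), continuous (be \o fst)}.
      by apply: continuous_comp; [exact: cvg_fst|exact: cbe].
    have c3 : {for ((x, P) : bundle R n), continuous (@sin R \o (be \o fst))}.
      by apply: continuous_comp; [exact: c2|exact: continuous_sin].
    have c4 : {for ((x, P) : bundle R n), continuous snd} by exact: cvg_snd.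
    exact: (cvgB (cvg_enorm (cvg_mulmx c1 c4)) c3).
  have h : \forall y \near x, boundary Omega y ->
      inner_normal Omega y = nu y /\ beta y = be y.
    by apply: filterS2 enu ebe => y h1 h2 by_; rewrite h1 ?h2.
  have h' : \forall z \near ((x, P) : bundle R n), boundary Omega z.1 ->
      inner_normal Omega z.1 = nu z.1 /\ beta z.1 = be z.1.
    exact: (@cvg_fst _ _ _ _ _ _ h).
  apply: filterS h' => -[y Q] /= hy [/= by_ _].
  by rewrite /g /plane_normal /=; have [-> ->] := hy by_.
have -> : capillary_bundle m Omega beta =
    (boundary Omega `*` grassmannian R n m) `&` (g @^-1` [set 0]).
  apply/seteqP; split => -[x P]; rewrite /capillary_bundle /= capillary_planesE.
    by move=> [bx [gP e]]; rewrite /g /= e subrr.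
  by move=> [[/= bx gP] /subr0_eq e].
have Kc : closed (boundary Omega `*` grassmannian R n m).
  by apply: compact_closed cK; exact: norm_hausdorff.
apply: (subclosed_compact _ cK) => [|z []//].
have /continuous_closedP/(_ [set 0]) := cg.
move=> h; have /closed_subspaceP[B cB hB] := h (@closed_eq R 0).
rewrite setIC -hB.
exact: closedI.
Qed.

End Compactness.

(** * Sign of the boundary term *)

Section BoundaryTerm.
Context {R : realType} {n : nat} (m : nat).
Local Notation E := 'rV[R]_n.+1.
Local Notation M := 'M[R]_n.+1.

Lemma bundle_snd_measurable :
  measurable_fun setT (snd : borel (bundle R n) -> borel M).
Proof.
apply: (@measurability _ _ (borel (bundle R n)) (borel M) _ _ open erefl).
move=> _ [U oU <-]; rewrite setTI; apply: sub_sigma_algebra.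
by apply: open_comp => // z _; exact: cvg_snd.
Qed.

(* The product sigma-algebra is coarser than the Borel one, and it suffices to
   integrate functions of x times matrix entries. *)
Lemma bundle_id_measurable :
  measurable_fun setT (id : borel (bundle R n) -> (borel E * borel M)%type).
Proof.
rewrite (_ : id = (fun z : borel (bundle R n) => (z.1, z.2))); last first.
  by apply/funext => -[].
by apply: measurable_fun_pair; [exact: measurable_base|exact: bundle_snd_measurable].
Qed.

Lemma bundle_closed_measurable (D : set (bundle R n)) : closed D ->
  measurable (D : set (borel (bundle R n))).
Proof.
move=> cD; rewrite -[D]setCK; apply: measurableC; apply: sub_sigma_algebra.
exact: closed_openC.
Qed.

Lemma conormal_norm_le1 (Omega : set E) x (P : M) : enorm (conormal Omega x P) <= 1.
Proof.
rewrite /conormal; have [->|h] := eqVneq (plane_normal Omega x P) 0.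
  by rewrite scaler0 /enorm dot0l sqrtr0.
by rewrite enormZ ger0_norm ?invr_ge0 ?enorm_ge0 // mulVf // gt_eqF // enorm_gt0.
Qed.

Lemma Rintegral_sum d (T : measurableType d) (mu : {measure set T -> \bar R})
    (D : set T) (I : Type) (s : seq I) (f : I -> T -> R) : measurable D ->
  (forall i, mu.-integrable D (EFin \o f i)) ->
  mu.-integrable D (EFin \o (fun x => \sum_(i <- s) f i x)) /\
  \int[mu]_(x in D) (\sum_(i <- s) f i x) = \sum_(i <- s) \int[mu]_(x in D) f i x.
Proof.
move=> mD fi; elim: s => [|i s [IH1 IH2]].
  rewrite big_nil; split; last first.
    by under eq_Rintegral do rewrite big_nil; rewrite Rintegral_cst // mul0r.
  rewrite (_ : _ \o _ = cst 0%E); first exact: integrable0.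
  by apply/funext => x /=; rewrite big_nil.
have e : (fun x => \sum_(j <- i :: s) f j x) = (fun x => f i x + \sum_(j <- s) f j x).
  by apply/funext => x; rewrite big_cons.
rewrite e big_cons -IH2; split; last exact: RintegralD.
have -> : EFin \o (fun x => f i x + \sum_(j <- s) f j x) =
    ((EFin \o f i) \+ (EFin \o (fun x => (\sum_(j <- s) f j x)%R)))%E.
  by apply/funext.
exact: integrableD.
Qed.

(** On the fibre over x the length |P(nu)| is the constant sin beta(x), so the coordinates of the
    conormal are linear in P there; they are bounded by 1. *)
Lemma conormal_integrable (Omega : set E) (beta : E -> R) x i
    (kappa : {measure set (borel M) -> \bar R}) : (kappa setT < +oo)%E ->
  kappa.-integrable (capillary_planes m Omega beta x)
    (EFin \o (fun P => conormal Omega x P 0 i)).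
Proof.
move=> kfin; set D := capillary_planes m Omega beta x.
have mD : measurable (D : set (borel M)).
  by apply: borel_closed; exact: capillary_planes_closed.
apply: measurable_bounded_integrable => //.
- by apply: le_lt_trans kfin; apply: le_measure; rewrite ?inE.
- apply: (@eq_measurable_fun _ _ _ _ _
    (fun P : borel M => (sin (beta x))^-1 * (inner_normal Omega x *m P) 0 i)).
    move=> P /set_mem; rewrite /D capillary_planesE => -[_ e].
    by rewrite /conormal e [RHS]mxE.
  apply: measurable_funTS; apply: continuous_borel => P.
  apply: (@cvgM _ _ (nbhs P)); first exact: cvg_cst.
  apply: (@cvg_coord _ _ _ (nbhs P)); apply: (@cvg_mulmx _ _ _ (nbhs P)).
    exact: cvg_cst.
  exact: cvg_id.
- exists 1; split; first exact: num_real.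
  move=> c c1 P _; apply: le_trans (ltW c1).
  exact: le_trans (coord_le_enorm _ _) (conormal_norm_le1 _ _ _).
Qed.

Lemma dot_mean_conormal (Omega : set E) (beta : E -> R) x v
    (k : R.-pker (borel E) ~> (borel M)) :
  (k x).-integrable (capillary_planes m Omega beta x)
    (EFin \o (fun P => dot (conormal Omega x P) v)) /\
  dot (mean_conormal m Omega beta k x) v =
    \int[k x]_(P in capillary_planes m Omega beta x) dot (conormal Omega x P) v.
Proof.
set D := capillary_planes m Omega beta x.
have mD : measurable (D : set (borel M)).
  by apply: borel_closed; exact: capillary_planes_closed.
have kfin : (k x setT < +oo)%E by rewrite prob_kernel ltry.
have ic i := conormal_integrable Omega beta x i kfin.
have iv i : (k x).-integrable D (EFin \o (fun P => conormal Omega x P 0 i * v 0 i)).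
  have -> : EFin \o (fun P => conormal Omega x P 0 i * v 0 i) =
      (fun P => (v 0 i)%:E * (EFin \o (fun P => conormal Omega x P (0 : 'I_1)%R i)) P)%E.
    by apply/funext => P /=; rewrite EFinM muleC.
  exact: integrableZl.
have [h1 h2] := Rintegral_sum (index_enum 'I_n.+1) mD iv; split => //.
rewrite h2; apply: eq_bigr => i _; rewrite mxE.
by rewrite -RintegralZr.
Qed.

(** Only the mean of the conormal over a fibre pairs nonnegatively with phi. Shifted by its bound B,
    the integrand becomes nonnegative and can be disintegrated. Each fibre integral is at least B,
    because the fibre measures are probabilities, so the total is at least B times the mass of
    Gamma, and the shift can be removed. *)
Lemma boundary_term_ge0 (Omega : set E) (beta : E -> R)
    (Gamma : {measure set (borel (bundle R n)) -> \bar R})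
    (k : R.-pker (borel E) ~> (borel M)) (phi : E -> E) (B : R) :
  bounded_C2_domain Omega -> contact_angle Omega beta ->
  radon_on (capillary_bundle m Omega beta) Gamma ->
  disintegration m Omega beta Gamma k ->
  continuous phi -> (forall x, enorm (phi x) <= B) ->
  {ae base_measure Gamma, forall x, 0 <= dot (mean_conormal m Omega beta k x) (phi x)} ->
  0 <= \int[Gamma]_(z in capillary_bundle m Omega beta)
         dot (conormal Omega z.1 z.2) (phi z.1).
Proof.
move=> hO hb [G0 Gfin] [hdis hk] cphi phiB hpos.
pose D : set (borel (bundle R n)) := capillary_bundle m Omega beta.
rewrite -/D in G0 Gfin *.
pose S : set (borel E) := boundary Omega.
pose G : set (borel M) := grassmannian R n m.
have [hb1 hb2] := hb.
have cD : compact D := capillary_bundle_compact hO hb.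
have clD : closed D by apply: compact_closed cD; exact: norm_hausdorff.
have mD : measurable (D : set (borel (bundle R n))) by exact: bundle_closed_measurable.
have mS : measurable (S : set (borel E)) by apply: borel_closed; exact: boundary_closed.
have mG : measurable (G : set (borel M)).
  by apply: borel_closed; exact: grassmannian_closed.
have B0 : 0 <= B := le_trans (enorm_ge0 _) (phiB 0).
have GD : (Gamma D < +oo)%E by exact: Gfin.
have mDC : measurable (~` D : set (borel (bundle R n))) by exact: measurableC.
have GT : Gamma setT = Gamma D.
  have e : (Gamma (~` D `|` D) = 0 + Gamma D)%E.
    by rewrite -G0; exact: (measureU Gamma mDC mD (setICl D)).
  by rewrite setvU add0e in e.
(* The integrand on the bundle, with |P(nu)| replaced by sin beta(x). In this form it is measurable
   on [S] times [G] for the product sigma-algebra, where the disintegration takes place. *)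
pose F (z : borel E * borel M) : R :=
  (sin (beta z.1))^-1 * dot (inner_normal Omega z.1 *m z.2) (phi z.1).
have mSG : measurable (S `*` G : set (borel E * borel M)) by exact: measurableX.
have mlift (h : borel E -> R) : measurable_fun S h ->
    measurable_fun (S `*` G : set (borel E * borel M)) (h \o fst).
  move=> mh; apply: (measurable_comp mS) => //; first by move=> _ [z [Sz _] <-].
  exact: measurable_funTS.
have mF : measurable_fun (S `*` G) F.
  apply: measurable_funM.
    apply: (mlift (fun x => (sin (beta x))^-1)).
    apply: within_continuous_borel => //; apply: within_continuous_local => x bx.
    have [be [cbe ebe]] := C1_set_extension hb1 bx.
    exists (fun y => (sin (be y))^-1); split.
      have sx : sin (be x) != 0.
        have bex : beta x = be x := nbhs_singleton ebe bx.
        by rewrite -bex gt_eqF // sin_gt0_pi // hb2.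
      have c3 : {for x, continuous (@sin R \o be)}.
        by apply: continuous_comp; [exact: cbe|exact: continuous_sin].
      exact: (cvgV sx c3).
    by apply: filterS ebe => y h Sy; rewrite h.
  rewrite /dot; apply: measurable_sum => i; apply: measurable_funM; last first.
    apply: (mlift (fun x => phi x 0 i)); apply: measurable_funTS.
    by apply: continuous_borel => x; apply: (@cvg_coord _ _ _ (nbhs x)); exact: cphi.
  rewrite (_ : (fun z : borel E * borel M => (inner_normal Omega z.1 *m z.2) 0 i) =
     (fun z => \sum_j inner_normal Omega z.1 0 j * z.2 j i)); last first.
    by apply/funext => z; rewrite mxE.
  apply: measurable_sum => j; apply: measurable_funM.
    apply: (mlift (fun x => inner_normal Omega x 0 j)).
    apply: within_continuous_borel => //; apply: within_continuous_local => x bx.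
    have [nu [cnu enu]] := inner_normal_extension hO bx.
    exists (fun y => nu y 0 j); split; first by apply: (@cvg_coord _ _ _ (nbhs x)).
    by apply: filterS enu => y h Sy; rewrite h.
  apply: measurable_funTS.
  apply: (@measurableT_comp _ _ _ _ _ _ (fun P : borel M => P j i) _ snd) => //.
  by apply: continuous_borel; exact: mx_entry_continuous.
(* Maximum and restriction produce a nonnegative function on the whole product; on the bundle, where
   |F| <= B, its value is F + B. *)
pose G1 : borel E * borel M -> \bar R :=
  EFin \o ((fun z => Num.max (F z + B) 0) \_ (S `*` G)).
have mG1 : measurable_fun setT G1.
  have mmax : measurable_fun (S `*` G) (fun z => Num.max (F z + B) 0).
    by apply: measurable_maxr => //; apply: measurable_funD.
  by apply/measurable_EFinP; exact: ((measurable_restrictT _ mSG).1 mmax).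
have G1_ge0 z : (0 <= G1 z)%E.
  by rewrite lee_fin patchE; case: ifPn => // _; rewrite le_max lexx orbT.
have DE z : D z -> [/\ (S `*` G) z, dot (conormal Omega z.1 z.2) (phi z.1) = F z &
    `|F z| <= B].
  move=> Dz; have := Dz.2; rewrite capillary_planesE => -[gP e].
  have eF : dot (conormal Omega z.1 z.2) (phi z.1) = F z.
    by rewrite /conormal e dotZl.
  split => //; first by split => //; exact: Dz.1.
  rewrite -eF; apply: le_trans (dot_le_enorm _ _) _.
  by rewrite -[B]mul1r ler_pM ?enorm_ge0 // conormal_norm_le1.
have G1D z : D z -> G1 z = (F z + B)%:E.
  move=> /DE[SGz _ FB]; rewrite /G1 /= patchE mem_set // max_l //.
  by move: FB; rewrite ler_norml => /andP[+ _]; lra.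
have mFD : measurable_fun (D : set (borel (bundle R n)))
    (F : borel (bundle R n) -> R).
  change (measurable_fun D (F \o (id : borel (bundle R n) -> (borel E * borel M)%type))).
  apply: (measurable_comp mSG) => //.
    by move=> _ [z Dz <-]; have [] := DE z Dz.
  by apply: measurable_funTS; exact: bundle_id_measurable.
have iF : Gamma.-integrable (D : set (borel (bundle R n)))
    (EFin \o (F : borel (bundle R n) -> R)).
  apply: measurable_bounded_integrable => //.
  exists B; split; first exact: num_real.
  by move=> c Bc z Dz; have [_ _ h] := DE z Dz; apply: le_trans h (ltW Bc).
have -> : \int[Gamma]_(z in D) dot (conormal Omega z.1 z.2) (phi z.1) =
    \int[Gamma]_(z in D) F z.
  by apply: eq_Rintegral => z /set_mem /DE[].
pose nu : {measure set (borel E * borel M) -> \bar R} :=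
  @measure_function_pushforward__canonical__measure_function_Measure
    _ _ _ _ _ Gamma _ bundle_id_measurable.
have fub : (\int[Gamma]_z G1 z = \int[base_measure Gamma]_x \int[k x]_P G1 (x, P))%E.
  rewrite -(@ge0_integral_disintegration _ _ _ _ R (base_measure Gamma) _ k nu) //.
  - have G1_ge0' : {in setT, forall z, (0 <= G1 z)%E} by move=> z _.
    have := ge0_integral_pushforward bundle_id_measurable Gamma measurableT mG1 G1_ge0'.
    by rewrite preimage_setT => ->.
  - by rewrite /= /pushforward preimage_setT GT.
have iGD : (\int[Gamma]_z G1 z = \int[Gamma]_(z in D) (F z + B)%:E)%E.
  rewrite (@ge0_negligible_integral _ _ _ Gamma setT (~` D)) //.
  - rewrite setTD setCK; apply: eq_integral => z /set_mem; exact: G1D.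
  - exact: (measurableT_comp mG1 bundle_id_measurable).
have sigT : base_measure Gamma setT = Gamma D.
  by rewrite /= /pushforward preimage_setT GT.
have fin1 : (\int[Gamma]_(z in D) (F z + B)%:E =
    (\int[Gamma]_(z in D) F z)%:E + B%:E * Gamma D)%E.
  under eq_integral do rewrite EFinD.
  rewrite integralD //; last first.
    apply/integrableP; split => //; rewrite integral_cst //= lte_mul_pinfty //.
  by rewrite integral_cst // /Rintegral fineK //; exact: integrable_fin_num.
(* Almost everywhere the inner integral equals B + <n_V(x), phi(x)>, which is at least B by
   [hpos]. *)
have lower : (B%:E * Gamma D <= \int[base_measure Gamma]_x \int[k x]_P G1 (x, P))%E.
  rewrite -sigT -integral_cst //; apply: ae_ge0_le_integral => //.
  - by move=> x _; exact: integral_ge0.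
  - by apply: (measurable_fun_integral_sfinite_kernel _ k).
  have sS : base_measure Gamma (~` S) = 0%E.
    have mfst : measurable ((fst : borel (bundle R n) -> borel E) @^-1` (~` S)).
      by rewrite -[X in measurable X]setTI; apply: measurable_base => //; exact: measurableC.
    apply: (@subset_measure0 _ _ _ Gamma _ (~` D) mfst mDC _ G0).
    by move=> z /= nS [].
  have aeS : {ae base_measure Gamma, forall x, S x}.
    by exists (~` S); split => //; exact: measurableC.
  have FF := ae_filter_ringOfSetsType (base_measure Gamma).
  have h1 := @filterI _ _ FF _ _ hpos aeS.
  have h2 := @filterI _ _ FF _ _ hk h1.
  apply: (@filterS _ _ FF _ _ _ h2) => x [kx [mx Sx]] _.
  have [i1 e1] := dot_mean_conormal Omega beta x (phi x) k.
  set C := capillary_planes m Omega beta x in kx i1 e1.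
  have mC : measurable (C : set (borel M)).
    by apply: borel_closed; exact: capillary_planes_closed.
  have kC : k x C = 1%E.
    have e : (k x (~` C `|` C) = 0 + k x C)%E.
      by rewrite -kx; exact: (measureU (k x) (measurableC mC) mC (setICl C)).
    by rewrite setvU add0e prob_kernel in e; rewrite -e.
  rewrite (@ge0_negligible_integral _ _ _ (k x) setT (~` C)) //; last 2 first.
  - exact: measurableC.
  - exact: (measurableT_comp mG1 (pair1_measurable x)).
  have eG : (\int[k x]_(P in C) G1 (x, P) =
      \int[k x]_(P in C) ((dot (conormal Omega x (P : M)) (phi x))%:E + B%:E))%E.
    apply: eq_integral => P /set_mem CP.
    have DxP : D (x, P) by split.
    by rewrite (G1D _ DxP); have [_ <- _] := DE _ DxP; rewrite EFinD.
  rewrite setTD setCK eG integralD //; last first.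
    by apply/integrableP; split => //; rewrite integral_cst //= kC mule1 ltry.
  rewrite integral_cst // kC mule1 leeDr //.
  rewrite -[X in (_ <= X)%E]fineK; last exact: integrable_fin_num.
  by rewrite lee_fin -/(Rintegral _ _ _) -e1.
have Bfin : (B%:E * Gamma D)%E \is a fin_num by rewrite fin_numM // ge0_fin_numE.
move: lower; rewrite -fub iGD fin1.
by rewrite -[X in (X <= _)%E -> _]add0e leeD2rE // lee_fin.
Qed.

End BoundaryTerm.

(** * The growth functional *)

Section Growth.
Context {R : realType}.

(* [eps] keeps the base of the power positive, where the power is differentiable. *)
Definition growth (m : nat) (p La eps : R) (I : R -> R) (t : R) : R :=
  expR (La * t) * ((I t / t ^+ m + eps) `^ p^-1 + La * t `^ ((p - m%:R) / p)).

(** For w = I / t^m + eps the hypothesis becomes w' >= - C (1 + m) w - 2 h w^(1 - 1/p) t^(-m/p).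
    Multiplication by w^(1/p - 1) / p turns the two errors into multiples of w^(1/p) and of
    t^(-m/p). The factor exp(La t) pays for the former, and the derivative of La t^((p-m)/p) for the
    latter; these are the two conditions on [La]. *)
Lemma growth_derive_ge0 (m : nat) (p La C h eps t dI : R) (I : R -> R) :
  0 < t -> m%:R < p -> 1 <= p -> 0 <= C -> 0 <= h -> 0 < eps -> 0 <= I t ->
  is_derive t 1 I dI ->
  m%:R * I t - C * t * I t - (1 + C * t) * (t * dI) <=
    2 * t * (1 + C * t) * (h * I t `^ (1 - p^-1)) ->
  C * (1 + m%:R) <= La * p -> 2 * h <= La * (p - m%:R) ->
  exists2 dF, is_derive t 1 (growth m p La eps I) dF & 0 <= dF.
Proof.
move=> t0 mp p1 C0 h0 eps0 I_ge0 dIt ineq hLa1 hLa2.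
have p0 : 0 < p by rewrite (lt_le_trans ltr01).
have La0 : 0 <= La.
  rewrite -(pmulr_lge0 _ p0); apply: le_trans hLa1.
  by rewrite mulr_ge0 // addr_ge0.
pose w s := I s / s ^+ m + eps.
have tm0 : 0 < t ^+ m by rewrite exprn_gt0.
have w0 : 0 < w t by rewrite ltr_wpDl // divr_ge0 // ltW.
pose dw := (t * dI - m%:R * I t) / t ^+ m.+1.
have hdw : is_derive t 1 w dw.
  have [dI1 dI2] := dIt.
  have hX : is_derive t 1 (fun s : R => s ^+ m) (m%:R * t ^+ m.-1).
    apply: DeriveDef; first exact: exprn_derivable.
    by rewrite exp_derive [_ *: 1]mulr1.
  have [dX1 dX2] := hX.
  have tm : t ^+ m != 0 by rewrite gt_eqF.
  have dV1 : derivable (fun s : R => (s ^+ m)^-1) t 1 by exact: (@derivableV _ _ (fun s : R => s ^+ m) t 1 tm dX1).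
  have dV2 : 'D_1 (fun s : R => (s ^+ m)^-1) t = - (t ^+ m) ^- 2 * (m%:R * t ^+ m.-1).
    by rewrite (@deriveV _ _ (fun s : R => s ^+ m) t 1 tm dX1) dX2.
  have dM1 : derivable (fun s : R => I s * (s ^+ m)^-1) t 1 by exact: (derivableM dI1 dV1).
  have dM2 := deriveM dI1 dV1.
  apply: DeriveDef; first exact: (derivableD dM1 (derivable_cst eps t 1)).
  rewrite (deriveD dM1 (derivable_cst eps t 1)) derive_cst addr0 dM2 dI2 dV2.
  rewrite /dw /GRing.scale /=; clear -t0; case: m => [|m']; last first.
    have tn : t != 0 by rewrite gt_eqF.
    by rewrite /= !exprS; field; rewrite ?expf_neq0 ?tn.
  by rewrite /= !expr0 expr1; field; rewrite gt_eqF.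
have dw_ge : - (C * (1 + m%:R)) * w t - 2 * h * (w t `^ (1 - p^-1) * t `^ (- (m%:R / p))) <= dw.
  set P := I t `^ (1 - p^-1) in ineq.
  have P0 : 0 <= P by exact: powR_ge0.
  have CT : 0 <= C * t by rewrite mulr_ge0 // ltW.
  have m0 : 0 <= m%:R :> R by [].
  (* Division by 1 + C t: once multiplied out, the claim is weaker than [ineq] by the nonnegative
     term (C t)^2 (1 + m) I. *)
  have step : - (C * (1 + m%:R)) * (t * I t) - 2 * h * (t * P) <= t * dI - m%:R * I t.
    have : (1 + C * t) * (m%:R * I t - C * (1 + m%:R) * (t * I t) - 2 * h * (t * P)) <=
        (1 + C * t) * (t * dI).
      have : 0 <= (C * t) ^+ 2 * (1 + m%:R) * I t.
        by apply: mulr_ge0 => //; apply: mulr_ge0; [exact: sqr_ge0|exact: addr_ge0].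
      move: ineq; clear; nra.
    rewrite ler_pM2l ?ltr_wpDr //; lra.
  have tm1 : 0 < t ^+ m.+1 by rewrite exprn_gt0.
  rewrite /dw ler_pdivlMr //; apply: le_trans step.
  set q := 1 - p^-1.
  have q0 : 0 <= q.
    by rewrite subr_ge0 invf_le1.
  have h1 : t * I t <= w t * t ^+ m.+1.
    have -> : w t * t ^+ m.+1 = t * I t + eps * t ^+ m.+1.
      by rewrite /w exprS; field; rewrite gt_eqF.
    by rewrite lerDl mulr_ge0 // ltW.
  have h2 : t * P <= w t `^ q * t `^ (- (m%:R / p)) * t ^+ m.+1.
    have e1 : P = (I t / t ^+ m) `^ q * (t ^+ m) `^ q.
      by rewrite /P -powRM ?divfK ?gt_eqF // ?divr_ge0 // ltW.
    (* This is where t^(-m/p) appears, the power that the derivative of t^((p-m)/p) has to match. *)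
    have e2 : (t ^+ m) `^ q = t `^ (- (m%:R / p)) * t ^+ m.
      rewrite -[in RHS]powR_mulrn ?ltW // -powRD; last by rewrite (gt_eqF t0) implybT.
      rewrite -powR_mulrn ?ltW // -powRrM; congr (_ `^ _); rewrite /q; field.
      by rewrite gt_eqF.
    rewrite e1 e2 exprS.
    set T := t `^ _; have T0 : 0 <= T by exact: powR_ge0.
    have -> : t * ((I t / t ^+ m) `^ q * (T * t ^+ m)) =
      (I t / t ^+ m) `^ q * (T * (t * t ^+ m)) by ring.
    rewrite -[leRHS]mulrA; apply: ler_wpM2r.
      by rewrite !mulr_ge0 // ltW.
    have a1 : 0 <= I t / t ^+ m by rewrite divr_ge0 // ltW.
    have a2 : I t / t ^+ m <= w t by rewrite /w lerDl ltW.
    by apply: ge0_ler_powR => //; rewrite nnegrE // ltW.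
  rewrite mulrBl -!mulrA; apply: lerB; first by rewrite ler_wnM2l // oppr_le0 mulr_ge0 // addr_ge0.
  by do 2 apply: ler_wpM2l => //; rewrite mulrA.
pose dF := expR (La * t) * (La * (w t `^ p^-1 + La * t `^ ((p - m%:R) / p)) +
  (p^-1 * w t `^ (p^-1 - 1) * dw + La * ((p - m%:R) / p * t `^ (- (m%:R / p))))).
exists dF.
  have dL : is_derive t 1 (fun s : R => La * s) La.
    have := @is_deriveZ _ _ _ id La t 1 1 (is_derive_id t 1).
    by rewrite [La *: 1]mulr1.
  have dE : is_derive t 1 (fun s : R => expR (La * s)) (expR (La * t) * La).
    exact: (is_derive1_comp (is_derive_expR _) dL).
  have dW : is_derive t 1 (fun s => w s `^ p^-1) (p^-1 * w t `^ (p^-1 - 1) * dw).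
    exact: (is_derive1_comp (is_derive1_powR p^-1 w0) hdw).
  have al : (p - m%:R) / p - 1 = - (m%:R / p) by field; rewrite gt_eqF.
  have dT : is_derive t 1 (fun s : R => La * s `^ ((p - m%:R) / p))
      (La * ((p - m%:R) / p * t `^ (- (m%:R / p)))).
    rewrite -al.
    exact: (@is_deriveZ _ _ _ (fun s : R => s `^ ((p - m%:R) / p)) La t 1 _ (is_derive1_powR _ t0)).
  have dS := is_deriveD dW dT.
  have := is_deriveM dE dS.
  rewrite /dF /GRing.scale /= => h'.
  by apply: is_derive_eq h' _; rewrite !fctE /=; ring.
rewrite /dF mulr_ge0 ?expR_ge0 //.
have wp : w t `^ (p^-1 - 1) * w t = w t `^ p^-1.
  by rewrite mulrC mulr_powRB1 ?invr_gt0 // ltW.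
have wp2 : w t `^ (p^-1 - 1) * w t `^ (1 - p^-1) = 1.
  rewrite -powRD; last by rewrite (gt_eqF w0) implybT.
  by rewrite addrA subrK subrr powRr0.
set A := w t `^ p^-1 in wp *; set B := w t `^ (p^-1 - 1) in wp wp2 *.
set T := t `^ (- (m%:R / p)) in dw_ge *.
have A0 : 0 <= A by exact: powR_ge0.
have B0 : 0 <= B by exact: powR_ge0.
have T0 : 0 <= T by exact: powR_ge0.
have h1 : p^-1 * B * dw >= p^-1 * (- (C * (1 + m%:R)) * A - 2 * h * T).
  rewrite -[leRHS]mulrA ler_pM2l ?invr_gt0 //; apply: le_trans (ler_wpM2l B0 dw_ge).
  rewrite mulrBr (_ : B * (- (C * (1 + m%:R)) * w t) = - (C * (1 + m%:R)) * (B * w t)); last by ring.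
  rewrite wp (_ : B * (2 * h * (w t `^ (1 - p^-1) * T)) =
    2 * h * (B * w t `^ (1 - p^-1)) * T); last by ring.
  by rewrite wp2 mulr1.
have h2 : 0 <= La * (La * t `^ ((p - m%:R) / p)).
  by rewrite !mulr_ge0 ?powR_ge0.
have h3 : p^-1 * (C * (1 + m%:R)) * A <= La * A.
  by apply: ler_wpM2r => //; rewrite mulrC ler_pdivrMr.
have h4 : p^-1 * (2 * h) * T <= La * ((p - m%:R) / p) * T.
  by apply: ler_wpM2r => //; rewrite mulrC mulrA ler_pM2r ?invr_gt0.
have e : p^-1 * (- (C * (1 + m%:R)) * A - 2 * h * T) =
  - (p^-1 * (C * (1 + m%:R)) * A) - p^-1 * (2 * h) * T by ring.
rewrite e in h1.
rewrite mulrDr; move: h1 h2 h3 h4.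
set X1 := p^-1 * B * dw; set X2 := La * (La * _); set X3 := p^-1 * (C * _) * A.
set X4 := p^-1 * (2 * h) * T; rewrite [La * ((p - m%:R) / p * T)]mulrA.
set X5 := La * (_ / p) * T; set X6 := La * A.
by clear; lra.
Qed.

Lemma nondecreasing_of_derive_ge0 (F : R -> R) (a b : R) : a <= b ->
  (forall t, a <= t <= b -> exists2 d, is_derive t 1 F d & 0 <= d) -> F a <= F b.
Proof.
rewrite le_eqVlt => /predU1P[-> //|ab] h.
have hd t : a <= t <= b -> is_derive t 1 F ('D_1 F t).
  by move=> /h[d [d1 _] _]; exact: derivableP.
have h1 t : t \in `]a, b[ -> is_derive t 1 F ('D_1 F t).
  by rewrite in_itv /= => /andP[at_ tb]; apply: hd; rewrite !ltW.
have h2 : {within `[a, b], continuous F}.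
  apply: derivable_within_continuous => t; rewrite in_itv /= => tab.
  by have [] := hd t tab.
have [c] := MVT ab h1 h2; rewrite in_itv /= => /andP[ac cb] e.
rewrite -subr_ge0 e mulr_ge0 //; last by rewrite subr_ge0 ltW.
have [|d [_ ->] //] := h c; first by rewrite !ltW.
Qed.

Lemma expR_powR (x y : R) : expR x `^ y = expR (y * x).
Proof. by rewrite /powR gt_eqF ?expR_gt0 // expRK. Qed.

(** By 1 + x <= e^x, the factor (rho/r)^m lost in the denominator is at most exp(m (rho/r - 1)).
    After the p-th root the exponent is m (rho - r) / (p r), which is at most La (rho - r) when r >=
    r1. *)
Lemma growth_large (m : nat) (p La r1 r rho A B : R) :
  0 < p -> m%:R < p -> 0 < r1 -> 0 <= La -> m%:R <= La * p * r1 -> r1 <= r -> r <= rho ->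
  0 <= A -> A <= B ->
  expR (La * r) * ((A / r ^+ m) `^ p^-1 + La * r `^ ((p - m%:R) / p)) <=
  expR (La * rho) * ((B / rho ^+ m) `^ p^-1 + La * rho `^ ((p - m%:R) / p)).
Proof.
move=> p0 mp r10 La0 hLa r1r rrho A0 AB.
have r0 : 0 < r by exact: lt_le_trans r1r.
have rho0 : 0 < rho by exact: lt_le_trans rrho.
have pi0 : 0 <= p^-1 by rewrite invr_ge0 ltW.
rewrite !mulrDr; apply: lerD; last first.
  apply: ler_pM; rewrite ?expR_ge0 ?mulr_ge0 ?powR_ge0 //.
    by rewrite ler_expR ler_wpM2l.
  apply: ler_wpM2l => //; apply: ge0_ler_powR; rewrite ?nnegrE ?(ltW r0) ?(ltW rho0) //.
  by rewrite divr_ge0 ?(ltW p0) // subr_ge0 ltW.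
have rm0 : 0 < r ^+ m by rewrite exprn_gt0.
have rhom0 : 0 < rho ^+ m by rewrite exprn_gt0.
have B0 : 0 <= B := le_trans A0 AB.
have h1 : (rho / r) ^+ m <= expR (m%:R * (rho / r - 1)).
  rewrite expRM_natl; apply: lerXn2r; rewrite ?nnegrE ?expR_ge0 ?divr_ge0 ?(ltW r0) ?(ltW rho0) //.
  by have := expR_ge1Dx (rho / r - 1); rewrite addrC subrK.
have h2 : A / r ^+ m <= B / rho ^+ m * expR (m%:R * (rho / r - 1)).
  apply: le_trans (ler_wpM2l _ h1); last by rewrite divr_ge0 // ltW.
  rewrite expr_div_n (_ : B / rho ^+ m * (rho ^+ m / r ^+ m) = B / r ^+ m); last first.
    by field; rewrite !gt_eqF.
  by rewrite ler_pM2r ?invr_gt0.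
have h3 : (A / r ^+ m) `^ p^-1 <= (B / rho ^+ m) `^ p^-1 * expR (p^-1 * (m%:R * (rho / r - 1))).
  rewrite -expR_powR -powRM ?expR_ge0 ?divr_ge0 ?(ltW rhom0) //.
  have n1 : 0 <= A / r ^+ m by rewrite divr_ge0 // ltW.
  have n2 : 0 <= B / rho ^+ m * expR (m%:R * (rho / r - 1)).
    by apply: mulr_ge0; [rewrite divr_ge0 // ltW|exact: expR_ge0].
  by apply: ge0_ler_powR => //; rewrite nnegrE.
apply: le_trans (ler_wpM2l (expR_ge0 _) h3) _.
rewrite mulrCA mulrC; apply: ler_wpM2r; first exact: powR_ge0.
rewrite -expRD ler_expR.
have : p^-1 * (m%:R * (rho / r - 1)) <= La * (rho - r).
  rewrite ler_pdivrMl // (_ : m%:R * (rho / r - 1) = m%:R / r * (rho - r)); last first.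
    by field; rewrite gt_eqF.
  rewrite mulrA; apply: ler_wpM2r; first by rewrite subr_ge0.
  rewrite ler_pdivrMr //; apply: le_trans hLa _.
  by rewrite (mulrC p) ler_wpM2l // mulr_ge0 // ltW.
by rewrite mulrBr; lra.
Qed.

(* By Young's inequality, x^(p-1) y <= (1 - 1/p) x^p + y^p / p. *)
Lemma powR_sub_le (p x y : R) : 1 < p -> 0 <= y -> y <= x ->
  x `^ p - y `^ p <= p * x `^ (p - 1) * (x - y).
Proof.
move=> p1 y0 yx; have x0 := le_trans y0 yx.
have p0 : 0 < p by rewrite (lt_trans ltr01).
have pn : p != 0 by rewrite gt_eqF.
have q0 : 0 < p - 1 by rewrite subr_gt0.
pose q := p / (p - 1).
have qp : 0 < q by rewrite divr_gt0.
have pq : q^-1 + p^-1 = 1 by rewrite /q; field; rewrite !gt_eqF.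
have := conjugate_powR (powR_ge0 x (p - 1)) y0 qp p0 pq.
rewrite -powRrM (_ : (p - 1) * q = p); last by rewrite /q; field; rewrite gt_eqF.
have xp : x * x `^ (p - 1) = x `^ p by rewrite mulr_powRB1.
have -> : q^-1 = 1 - p^-1 by rewrite -pq addrK.
move=> h; have := ler_wpM2l (ltW p0) h.
rewrite mulrDr (_ : p * (y `^ p / p) = y `^ p); last by field.
rewrite (_ : p * (x `^ p * (1 - p^-1)) = p * x `^ p - x `^ p); last by field.
rewrite -xp; lra.
Qed.

End Growth.

(** * Estimates of the terms of the first variation *)

Section NullComplement.
Context d (T : measurableType d) (R : realType) (mu : {measure set T -> \bar R}).

Lemma integrable_null_compl (D : set T) (f : T -> \bar R) : measurable D ->
  mu (~` D) = 0%E -> measurable_fun setT f -> mu.-integrable D f ->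
  mu.-integrable setT f.
Proof.
move=> mD muD mf /integrableP[_ fD]; apply/integrableP; split => //.
rewrite (@ge0_negligible_integral _ _ _ mu setT (~` D)) //.
- by rewrite setTD setCK.
- exact: measurableC.
- exact: measurableT_comp.
Qed.

Lemma Rintegral_null_compl (D : set T) (f : T -> R) : measurable D ->
  mu (~` D) = 0%E -> mu.-integrable setT (EFin \o f) ->
  \int[mu]_(x in D) f x = \int[mu]_x f x.
Proof.
move=> mD muD fi; rewrite /Rintegral; congr fine.
rewrite [RHS](@negligible_integral _ _ _ mu setT (~` D)) //.
  by rewrite setTD setCK.
exact: measurableC.
Qed.

End NullComplement.

Section VarifoldTerms.
Context {R : realType} {n : nat} (m : nat).
Local Notation E := 'rV[R]_n.+1.
Local Notation M := 'M[R]_n.+1.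
Context (Omega : set E) (V : {measure set (borel (bundle R n)) -> \bar R}).
Context (bO : bounded_set Omega) (hV : radon_on (grassmann_bundle m (closure Omega)) V).
Local Notation mu := (base_measure V).
Let GB : set (borel (bundle R n)) := grassmann_bundle m (closure Omega).

Lemma grassmann_bundle_measurable : measurable GB.
Proof.
have c1 := @grassmann_bundle_compact R n m _ (closure_compact bO).
have cl : closed (grassmann_bundle m (closure Omega)).
  by apply: compact_closed c1; exact: norm_hausdorff.
exact: bundle_closed_measurable cl.
Qed.

Lemma varifold_null_compl : V (~` GB) = 0%E.
Proof. by case: hV. Qed.

Lemma varifold_finite : (V GB < +oo)%E.
Proof.
by case: hV => _; apply => //; apply: grassmann_bundle_compact; exact: closure_compact.
Qed.

Lemma varifold_mass_finite : (mu setT < +oo)%E.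
Proof.
rewrite /= /pushforward preimage_setT.
have e : (V (~` GB `|` GB) = 0 + V GB)%E.
  rewrite -varifold_null_compl.
  apply: (measureU V _ _ (setICl GB)); last exact: grassmann_bundle_measurable.
  by apply: measurableC; exact: grassmann_bundle_measurable.
by rewrite setvU add0e in e; rewrite e; exact: varifold_finite.
Qed.

Lemma closure_measurable : measurable (closure Omega : set (borel E)).
Proof. by apply: borel_closed; exact: closed_closure. Qed.

Lemma base_null_compl : mu (~` closure Omega) = 0%E.
Proof.
have mf : measurable ((fst : borel (bundle R n) -> borel E) @^-1` (~` closure Omega)).
  rewrite -[X in measurable X]setTI; apply: measurable_base => //.
  by apply: measurableC; exact: closure_measurable.
apply: (@subset_measure0 _ _ _ V _ (~` GB) mf _ _ varifold_null_compl).
  by apply: measurableC; exact: grassmann_bundle_measurable.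
by move=> z /= nS [].
Qed.

Lemma bounded_integrable (f : E -> R) (c : R) :
  measurable_fun setT (f : borel E -> R) -> (forall x, `|f x| <= c) ->
  mu.-integrable setT (EFin \o f).
Proof.
move=> mf fc; apply: measurable_bounded_integrable => //.
  exact: varifold_mass_finite.
exists c; split; first exact: num_real.
by move=> c' cc' x _; exact: le_trans (ltW cc').
Qed.

(** A bound for the divergence that does not depend on the plane can be integrated on the base.
    Continuity and boundedness of J make the divergence integrable, so that the real-valued
    integrals can be compared. *)
Lemma first_variation_lower (J : E -> M) (psi : E -> R) (c : R) :
  (forall i j, continuous (fun x => J x i j)) ->
  (forall i j x, `|J x i j| <= c) ->
  measurable_fun setT (psi : borel E -> R) -> mu.-integrable setT (EFin \o psi) ->
  (forall x P, grassmannian R n m P -> psi x <= plane_div P (J x)) ->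
  \int[mu]_x psi x <= first_variation m Omega V J.
Proof.
move=> cJ Jc mpsi ipsi h; rewrite /first_variation -/GB.
have mGB := grassmann_bundle_measurable.
have mEpsi : measurable_fun setT (EFin \o (psi : borel E -> R)).
  exact/measurable_EFinP.
have mbase : measurable_fun setT (fst : borel (bundle R n) -> borel E).
  exact: measurable_base.
have mpf : measurable_fun setT (EFin \o (fun z : borel (bundle R n) => psi z.1)).
  exact: (measurableT_comp mEpsi mbase).
have iVT : V.-integrable setT (EFin \o (fun z : borel (bundle R n) => psi z.1)).
  apply/integrableP; split => //.
  have /integrableP[_] := ipsi.
  have mabs : measurable_fun setT (fun x : borel E => `|(psi x)%:E|%E).
    exact: (measurableT_comp _ mEpsi).
  have abs0 : {in setT, forall x : borel E, (0 <= `|(psi x)%:E|)%E} by move=> x _.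
  by rewrite (ge0_integral_pushforward mbase V measurableT mabs abs0) preimage_setT.
have eV : \int[mu]_x psi x = \int[V]_z psi z.1.
  rewrite /Rintegral; congr fine.
  by rewrite (integral_pushforward mbase mEpsi) // preimage_setT.
rewrite eV -(Rintegral_null_compl mGB varifold_null_compl iVT).
have iV := integrableS measurableT mGB (@subsetT _ GB) iVT.
apply: le_Rintegral => //.
- apply: measurable_bounded_integrable => //; first exact: varifold_finite.
  + apply: measurable_funTS; rewrite /plane_div /mxtrace.
    apply: measurable_sum => i.
    rewrite (_ : (fun z : borel (bundle R n) => (z.2 *m J z.1) i i) =
      (fun z => \sum_j z.2 i j * J z.1 j i)); last by apply/funext => z; rewrite mxE.
    apply: measurable_sum => j; apply: measurable_funM.
      apply: (measurableT_comp (f := fun P : borel M => P i j) _ (@bundle_snd_measurable R n)).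
      by apply: continuous_borel; exact: mx_entry_continuous.
    apply: (measurableT_comp (f := fun x : borel E => J x j i) _ (@measurable_base R n)).
    exact: continuous_borel.
  + exists ((n.+1 * n.+1)%:R * c); split; first exact: num_real.
    move=> c' cc' [x P] [_ [Ps Pi _]]; apply: le_trans (ltW cc').
    exact: mxtrace_mul_le.
- by move=> [x P] [_ gP]; exact: h.
Qed.

Context (H : E -> E).
Context (hH : forall (K : set E) i, compact K ->
  mu.-integrable K (fun x => (H x 0 i)%:E)).

(** Integrability on a compact set includes measurability there, and balls of integer radius exhaust
    the space. *)
Lemma curvature_measurable i : measurable_fun setT (fun x : borel E => H x 0 i).
Proof.
have -> : [set: borel E] = \bigcup_k (cball (0 : E) k%:R : set (borel E)).
  apply/seteqP; split => // x _; exists (Num.truncn (enorm x)).+1 => //=.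
  by rewrite /cball /= subr0 ltW // truncnS_gt.
apply/measurable_fun_bigcup => k.
  by apply: borel_closed; exact: cball_closed.
by apply/measurable_EFinP; have /integrableP[] := hH i (@cball_compact R n 0 k%:R).
Qed.

Lemma curvature_integrable i : mu.-integrable setT (EFin \o (fun x => H x 0 i)).
Proof.
apply: (integrable_null_compl closure_measurable base_null_compl).
  by apply/measurable_EFinP; exact: curvature_measurable.
by apply: hH; exact: closure_compact.
Qed.

Lemma curvature_norm_measurable : measurable_fun setT (fun x : borel E => enorm (H x)).
Proof.
apply: (measurableT_comp (f := @Num.sqrt R)).
  by apply: continuous_measurable_fun; exact: sqrt_continuous.
by apply: measurable_sum => i; apply: measurable_funM; exact: curvature_measurable.
Qed.

Lemma enorm_le_sum (v : E) : enorm v <= \sum_i `|v 0 i|.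
Proof.
rewrite {1}[v]row_sum_delta; apply: le_trans (enorm_sum _ _) _.
apply: ler_sum => i _; rewrite enormZ ler_piMr //.
rewrite /enorm /dot (bigD1 i) //= big1 => [|k ki].
  by rewrite !mxE !eqxx mulr1 addr0 sqrtr1.
by rewrite !mxE (negPf ki) andbF mul0r.
Qed.

Lemma curvature_norm_integrable : mu.-integrable setT (EFin \o (fun x => enorm (H x))).
Proof.
have h := Rintegral_sum (index_enum 'I_n.+1) measurableT
  (fun i => integrable_norm (curvature_integrable i)).
apply: le_integrable h.1 => //.
  by apply/measurable_EFinP; exact: curvature_norm_measurable.
move=> x _ /=; rewrite lee_fin !ger0_norm ?enorm_ge0 ?sumr_ge0 //.
exact: enorm_le_sum.
Qed.

Lemma curvature_weighted_integrable (eta : E -> R) :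
  measurable_fun setT (eta : borel E -> R) -> (forall x, 0 <= eta x <= 1) ->
  mu.-integrable setT (EFin \o (fun x => enorm (H x) * eta x)).
Proof.
move=> meta eta01.
rewrite (_ : _ \o _ = (EFin \o (fun x => enorm (H x))) \* (EFin \o eta))%E; last first.
  by apply/funext => x.
apply: integrableMl => //; first exact: curvature_norm_integrable.
exists 1; split; first exact: num_real.
move=> c c1 x _; have /andP[e0 e1] := eta01 x.
by rewrite /= ger0_norm // (le_trans e1) // ltW.
Qed.

Lemma curvature_term_lower (phi : E -> E) (eta : E -> R) (b : R) :
  continuous phi -> measurable_fun setT (eta : borel E -> R) -> 0 <= b ->
  (forall x, 0 <= eta x <= 1) -> (forall x, enorm (phi x) <= b * eta x) ->
  - (\int[mu]_(x in closure Omega) dot (H x) (phi x)) <=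
  b * \int[mu]_x (enorm (H x) * eta x).
Proof.
move=> cphi meta b0 eta01 phib.
have ieta := curvature_weighted_integrable meta eta01.
have idot : mu.-integrable setT (EFin \o (fun x => dot (H x) (phi x))).
  have ib : mu.-integrable setT (EFin \o (fun x => b * (enorm (H x) * eta x))).
    rewrite (_ : _ \o _ = fun x => b%:E * (EFin \o (fun x => (enorm (H x) * eta x)%R)) x)%E //.
    exact: integrableZl.
  apply: le_integrable ib => //.
    apply/measurable_EFinP; apply: measurable_sum => i; apply: measurable_funM.
      exact: curvature_measurable.
    by apply: continuous_borel => x; apply: (@cvg_coord _ _ _ (nbhs x)); exact: cphi.
  move=> x _ /=; rewrite lee_fin; apply: le_trans (dot_le_enorm _ _) _.
  apply: le_trans (ler_norm _); rewrite mulrCA; apply: ler_wpM2l; first exact: enorm_ge0.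
  exact: phib.
rewrite (Rintegral_null_compl closure_measurable base_null_compl idot).
rewrite -RintegralZl // -mulN1r -RintegralZl //.
apply: le_Rintegral => //.
- rewrite (_ : _ \o _ = fun x => (-1)%:E * (EFin \o (fun x => dot (H x) (phi x))) x)%E //.
  exact: integrableZl.
- rewrite (_ : _ \o _ = fun x => b%:E * (EFin \o (fun x => (enorm (H x) * eta x)%R)) x)%E //.
  exact: integrableZl.
move=> x _; rewrite mulN1r; apply: le_trans (ler_norm _) _; rewrite normrN.
apply: le_trans (dot_le_enorm _ _) _; rewrite mulrCA.
by apply: ler_wpM2l; [exact: enorm_ge0|exact: phib].
Qed.

(** Hoelder with q = p / (p - 1), followed by eta^q <= eta, valid since 0 <= eta <= 1 <= q. The L^q
    norm of the cutoff thus becomes a power of the weighted mass, and the same I occurs on both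
    sides of the differential inequality. *)
Lemma curvature_hoelder (eta : E -> R) (p normH : R) : 1 < p ->
  vLnorm V p H = normH%:E -> measurable_fun setT (eta : borel E -> R) ->
  (forall x, 0 <= eta x <= 1) ->
  \int[mu]_x (enorm (H x) * eta x) <= normH * (\int[mu]_x eta x) `^ (1 - p^-1).
Proof.
move=> p1 hN meta eta01.
have p0 : 0 < p by rewrite (lt_trans ltr01).
have p10 : 0 < p - 1 by rewrite subr_gt0.
pose q := p / (p - 1); have q0 : 0 < q by rewrite divr_gt0.
have pq : p^-1 + q^-1 = 1 by rewrite /q; field; rewrite !gt_eqF.
have qE : q^-1 = 1 - p^-1 by rewrite -pq addrC addKr.
have q1 : 1 <= q by rewrite /q ler_pdivlMr // mul1r gerBl.
have eta0 x : 0 <= eta x by have /andP[] := eta01 x.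
have ieta : mu.-integrable setT (EFin \o eta).
  apply: (@bounded_integrable _ 1) => // x.
  by have /andP[h0 h1] := eta01 x; rewrite ger0_norm.
have eI : (\int[mu]_x (eta x)%:E = (\int[mu]_x eta x)%:E)%E.
  by rewrite /Rintegral fineK //; exact: integrable_fin_num.
have I0 : 0 <= \int[mu]_x eta x by apply: Rintegral_ge0.
have := hoelder mu curvature_norm_measurable meta p0 q0 pq.
rewrite Lnorm1 => hh.
have Nq : ('N[mu]_q%:E[EFin \o eta] <= ((\int[mu]_x eta x) `^ (1 - p^-1))%:E)%E.
  rewrite unlock -qE -poweR_EFin -eI.
  have n1 : (0 <= \int[mu]_x (`|(EFin \o eta) x| `^ q))%E.
    by apply: integral_ge0; move=> x xT; exact: poweR_ge0.
  have n2 : (0 <= \int[mu]_x (eta x)%:E)%E.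
    by apply: integral_ge0; move=> x xT; rewrite lee_fin.
  apply: gt0_ler_poweR; rewrite ?invr_ge0 ?(ltW q0) //.
  - by rewrite in_itv /= leey andbT n1.
  - by rewrite in_itv /= leey andbT n2.
  apply: ge0_le_integral => //.
  - by move=> x xT; exact: poweR_ge0.
  - have h : measurable_fun setT (fun x : borel E => (`|eta x| `^ q)%:E).
      apply/measurable_EFinP; apply: (measurableT_comp (measurable_powR q)).
      exact: measurableT_comp.
    exact: h.
  - by apply/measurable_EFinP; exact: meta.
  - move=> x xT /=; rewrite ger0_norm // lee_fin.
    have [->|ex] := eqVneq (eta x) 0; first by rewrite powR0 // gt_eqF.
    apply: ge1r_powR => //; have /andP[h0 h1] := eta01 x.
    by rewrite lt_neqAle eq_sym ex h0 h1.
rewrite -lee_fin EFinM -hN.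
apply: le_trans (lee_wpmul2l _ Nq); last exact: Lnorm_ge0.
apply: le_trans hh.
rewrite /Rintegral fineK.
  apply: ge0_le_integral => //.
  - by move=> x xT; rewrite lee_fin mulr_ge0 ?enorm_ge0.
  - by apply/measurable_EFinP; apply: measurable_funM => //; exact: curvature_norm_measurable.
  - by apply: measurableT_comp => //; apply/measurable_EFinP; apply: measurable_funM => //; exact: curvature_norm_measurable.
  - by move=> x xT /=; rewrite lee_fin ler_norm.
apply: integrable_fin_num => //; exact: curvature_weighted_integrable meta eta01.
Qed.

End VarifoldTerms.

(** * The differential inequality *)

Section Cutoffs.
Context {R : realType}.

(** For the squared positive part a remainder of order y^2 can be checked by arithmetic, also across
    0, where its formula changes. *)
Lemma is_derive_quadratic (f : R -> R) (x d : R) :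
  (forall y, `|f (x + y) - f x - y * d| <= y ^+ 2) -> is_derive x 1 f d.
Proof.
move=> hf.
have h : (fun y : R => y^-1 *: (f (y *: 1 + x) - f x)) @ (0 : R)^' --> d.
  apply/cvgrPdist_le => /= e e0.
  near=> y.
  have y0 : y != 0 by near: y; exact: nbhs_dnbhs_neq.
  have ye : `|y| <= e by near: y; exact: dnbhs0_le.
  have -> : d - y^-1 *: (f (y *: 1 + x) - f x) = - (y^-1 * (f (x + y) - f x - y * d)).
    by rewrite /GRing.scale /= mulr1 [y + x]addrC; field.
  rewrite normrN normrM normfV ler_pdivrMl ?normr_gt0 //.
  apply: le_trans (hf y) _; rewrite -[y ^+ 2]real_normK ?num_real // expr2.
  by rewrite ler_pM2l // normr_gt0.
apply: DeriveDef; first by apply/cvg_ex; exists d.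
exact: (cvg_lim _ h).
Unshelve. all: by end_near. Qed.

Definition pos_sqr (x : R) : R := Num.max x 0 ^+ 2.

Lemma pos_sqr_derive (x : R) : is_derive x 1 pos_sqr (2 * Num.max x 0).
Proof.
apply: is_derive_quadratic => y; rewrite /pos_sqr ler_norml.
by case: (leP x 0) => hx; case: (leP (x + y) 0) => hy; apply/andP; split; nra.
Qed.

Lemma pos_sqr_ge0 x : 0 <= pos_sqr x. Proof. exact: sqr_ge0. Qed.

(* A C^1 function equal to 1 for u <= 1 and to 0 for u >= 1 + d. *)
Definition soft_cut (d u : R) : R := pos_sqr (1 - pos_sqr ((u - 1) / d)).

Definition dsoft_cut (d u : R) : R :=
  2 * Num.max (1 - pos_sqr ((u - 1) / d)) 0 * - (2 * Num.max ((u - 1) / d) 0 / d).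

Lemma max0_continuous (f : R -> R) : continuous f -> continuous (fun x => Num.max (f x) 0).
Proof.
move=> cf x; rewrite (_ : (fun y => _) = (fun y : R => 2^-1 * (f y + `|f y|))).
  apply: cvgM; first exact: cvg_cst.
  by apply: cvgD; [exact: cf|apply: cvg_norm; exact: cf].
apply/funext => y; case: (leP (f y) 0) => h.
  by rewrite ler0_norm // subrr mulr0.
by rewrite gtr0_norm //; lra.
Qed.

Lemma cutoff_soft_cut (d : R) : 0 < d -> cutoff (soft_cut d) (dsoft_cut d) (1 + d).
Proof.
move=> d0; split.
- move=> a.
  have h1 : is_derive a 1 (fun u : R => (u - 1) / d) d^-1.
    rewrite (_ : (fun u => _) = (d^-1 \*: (id - cst 1 : R -> R))); last first.
      by apply/funext => u; rewrite /GRing.scale /= mulrC.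
    by apply: is_derive_eq; rewrite subr0 /GRing.scale /= mulr1.
  have h2 := @is_derive1_comp R pos_sqr (fun u => (u - 1) / d) a _ _
    (pos_sqr_derive ((a - 1) / d)) h1.
  have h3 : is_derive a 1 (fun u : R => 1 - pos_sqr ((u - 1) / d))
      (- (2 * Num.max ((a - 1) / d) 0 / d)).
    rewrite (_ : (fun u => _) = (cst 1 - (pos_sqr \o (fun u => (u - 1) / d)) : R -> R)) //.
    by apply: is_derive_eq; rewrite sub0r.
  exact: (@is_derive1_comp R pos_sqr (fun u => 1 - pos_sqr ((u - 1) / d)) a _ _
    (pos_sqr_derive _) h3).
- have cl : continuous (fun u : R => (u - 1) / d).
    move=> x; apply: cvgM; last exact: cvg_cst.
    by apply: cvgB; [exact: cvg_id|exact: cvg_cst].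
  have cm := max0_continuous cl.
  have cp : continuous (fun u : R => 1 - pos_sqr ((u - 1) / d)).
    move=> x; apply: cvgB; first exact: cvg_cst.
    by rewrite /pos_sqr; under eq_fun do rewrite expr2; apply: cvgM; exact: cm.
  move=> x; rewrite /dsoft_cut; apply: cvgM.
    by apply: cvgM; [exact: cvg_cst|exact: (max0_continuous cp)].
  apply: cvgN; apply: cvgM; last exact: cvg_cst.
  by apply: cvgM; [exact: cvg_cst|exact: cm].
- move=> a; rewrite sqr_ge0 /=; rewrite /soft_cut /pos_sqr.
  have p0 := pos_sqr_ge0 ((a - 1) / d).
  rewrite -[leRHS](expr1n _ 2) ler_pXn2r ?nnegrE ?le_max ?lexx ?orbT //.
  by rewrite ge_max ler01 andbT gerBl.
- move=> a; rewrite /dsoft_cut mulrN oppr_le0 !mulr_ge0 ?le_max ?lexx ?orbT ?invr_ge0 //.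
  exact: ltW.
- move=> a ha; have h : 1 <= (a - 1) / d by rewrite ler_pdivlMr //; lra.
  have e : Num.max (1 - pos_sqr ((a - 1) / d)) 0 = 0.
    apply/max_idPr; rewrite subr_le0 /pos_sqr max_l ?(le_trans ler01) //.
    by rewrite -[leLHS](expr1n _ 2) ler_pXn2r ?nnegrE // (le_trans ler01).
  by rewrite /soft_cut /dsoft_cut {1}/pos_sqr e expr0n /= mulr0 mul0r.
Qed.

Lemma soft_cut_eq1 (d u : R) : 0 < d -> u <= 1 -> soft_cut d u = 1.
Proof.
move=> d0 u1; rewrite /soft_cut {2}/pos_sqr max_r; last by rewrite ler_pdivrMr // mul0r subr_le0.
by rewrite expr0n subr0 /pos_sqr max_l // expr1n.
Qed.

End Cutoffs.

Lemma compact_support_bounded {R : realType} {n : nat} (f : 'rV[R]_n.+1 -> R) x0 (r : R) :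
  continuous f -> (forall x, r < enorm (x - x0) -> f x = 0) ->
  exists2 c : R, 0 <= c & forall x, `|f x| <= c.
Proof.
move=> cf f0; have cB := @cball_compact R n x0 r.
have cfB : compact (f @` cball x0 r).
  by apply: continuous_compact => //; exact: continuous_subspaceT.
have /ex_strict_bound_gt0 [c c0 hc] := compact_bounded cfB.
exists c; first exact: ltW.
move=> x; have [xr|rx] := leP (enorm (x - x0)) r; last by rewrite f0 // normr0 ltW.
by apply/ltW/hc; exists x.
Qed.

(** The rate C of the differential inequality: (n+1)^2 comes from the trace estimate, the factor 2
    from |x - x0| <= 2 t on the support of the cutoff. *)
Definition field_rate {R : realType} (n : nat) (r K : R) : R :=
  2 * (n.+1 * n.+1)%:R * field_const (n := n) r K.

Definition scaled_dist2 {R : realType} {n : nat} (x0 : 'rV[R]_n.+1) (t : R) x : R :=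
  t ^- 2 * enorm (x - x0) ^+ 2.

Lemma field_const_ge0 {R : realType} (n : nat) (r K : R) : 0 < r -> 0 <= K ->
  0 <= field_const (n := n) r K.
Proof.
move=> r0 K0; have c0 : 0 <= r^-1 by rewrite invr_ge0 ltW.
by rewrite /field_const !(addr_ge0, mulr_ge0, mulrn_wge0, ler0n) // ler01.
Qed.

Section WeightedInequality.
Context {R : realType} {n : nat} (m : nat).
Local Notation E := 'rV[R]_n.+1.
Local Notation M := 'M[R]_n.+1.
Implicit Types (Omega : set E) (beta : E -> R) (x : E).
Implicit Types (V Gamma : {measure set (borel (bundle R n)) -> \bar R}).

Lemma boundary_measure_null Omega beta Gamma :
  radon_on (capillary_bundle m Omega beta) Gamma ->
  bounded_C2_domain Omega -> contact_angle Omega beta ->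
  {ae base_measure Gamma, forall x, boundary Omega x}.
Proof.
move=> [G0 _] hO hb.
have mS : measurable (boundary Omega : set (borel E)).
  by apply: borel_closed; exact: boundary_closed.
exists (~` boundary Omega); split => //; first exact: measurableC.
have cD : compact (capillary_bundle m Omega beta) := capillary_bundle_compact hO hb.
have clD : closed (capillary_bundle m Omega beta).
  by apply: compact_closed cD; exact: norm_hausdorff.
have mD : measurable (~` capillary_bundle m Omega beta : set (borel (bundle R n))).
  by apply: measurableC; exact: bundle_closed_measurable.
have mf : measurable ((fst : borel (bundle R n) -> borel E) @^-1` (~` boundary Omega)).
  by rewrite -[X in measurable X]setTI; apply: measurable_base => //; exact: measurableC.
by apply: (@subset_measure0 _ _ _ Gamma _ _ mf mD _ G0) => z /= nS [].
Qed.

Lemma cos_nW_tangential Omega beta (k : R.-pker (borel E) ~> (borel M)) x (z : E) :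
  bounded_C2_domain Omega -> boundary Omega x ->
  tangent Omega x (cos_nW m Omega beta k x) /\
  (tangent Omega x z -> dot (mean_conormal m Omega beta k x) z = dot (cos_nW m Omega beta k x) z).
Proof.
move=> hO bx; rewrite /cos_nW /tangent_proj /tangent; split.
  by rewrite dotBl dotZl -[X in _ * X]enorm_sqr inner_normal_unit // expr1n mulr1 subrr.
by move=> hz; rewrite dotBl dotZl [dot (inner_normal _ _) z]dotC hz mulr0 subr0.
Qed.

(** The three conditions on [U1] place the support of the cutoff within |x - x0| <= 2 t, inside the
    chart, and inside the ball where (C1) and (C2) hold. The first makes all relative errors of the
    test field multiples of t. *)
Lemma capillary_weighted_inequality Omega beta V Gamma (H : E -> E)
    (k : R.-pker (borel E) ~> (borel M)) x0 tau
    (p normH eps0 rho0 c0 r t U1 C I : R) (h dh : R -> R) f F b DF Db :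
  1 < p -> bounded_C2_domain Omega -> contact_angle Omega beta ->
  capillary_varifold m Omega beta V Gamma H -> vLnorm V p H = normH%:E ->
  disintegration m Omega beta Gamma k ->
  capillary_boundary_point m Omega beta Gamma k x0 eps0 rho0 c0 tau ->
  0 < r <= 1 -> chart (boundary Omega) x0 r f F b DF Db ->
  cutoff h dh U1 -> U1 <= 4 -> 0 < t -> U1 * t ^+ 2 < r ^+ 2 -> U1 * t ^+ 2 <= rho0 ^+ 2 ->
  C = field_rate n r (c0 * `|cos (beta x0)| / eps0) ->
  I = \int[base_measure V]_x h (scaled_dist2 x0 t x) ->
  m%:R * I - C * t * I - (1 + C * t) *
    - (2 * \int[base_measure V]_x (dh (scaled_dist2 x0 t x) * scaled_dist2 x0 t x)) <=
  2 * t * (1 + C * t) * (normH * I `^ (1 - p^-1)).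
Proof.
move=> p1 hO hb hV hN hdis hcb r01 hchart hcut U14 t0 Ur Urho.
pose u := scaled_dist2 x0 t; rewrite -/u => CE IE.
have [hrV hrG hH _ hvar] := hV.
have [[bx0 _ _] [/andP[e0 e1] /andP[rho00 _] c00] [tau1 _] hC1 hC2] := hcb.
set K := c0 * _ / _ in CE.
have K0 : 0 <= K by rewrite !mulr_ge0 // ?invr_ge0 ltW.
have [Z [DZ [hZ1 hZ2 hZ3 hZ4 hZ5]]] := exists_test_field r01 K0 tau1 bx0 hchart.
have [r0 r1] := andP r01.
have bO : bounded_set Omega by have [] := hO.
have hG := cutoff_field_gradient hcut t0 r0 Ur hZ1.
have [hd cdh h01 dh0 hU] := hcut.
pose G (j : 'I_n.+1) (y : E) : E := h (u y) *: DZ j y +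
  Z y 0 j *: (dh (u y) *: (t ^- 2 *: (2 *: (y - x0)))).
pose phi y : E := h (u y) *: Z y.
have ch : continuous h.
  by move=> a; apply: differentiable_continuous; apply/derivable1_diffP; have [] := hd a.
have cu : continuous u.
  move=> x; apply: (@cvgM _ _ (nbhs x)); first exact: cvg_cst.
  under eq_fun do rewrite expr2.
  by apply: (@cvgM _ _ (nbhs x)); exact: enorm_dist_continuous.
have u0 x : 0 <= u x by rewrite mulr_ge0 ?invr_ge0 ?exprn_ge0 ?enorm_ge0 // ltW.
have uE x : enorm (x - x0) ^+ 2 = u x * t ^+ 2.
  by rewrite /u mulrAC mulVf ?mul1r // expf_neq0 // gt_eqF.
have small x : u x < U1 -> [/\ enorm (x - x0) < r, enorm (x - x0) <= rho0 &
    enorm (x - x0) <= 2 * t].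
  move=> ux; have s0 := enorm_ge0 (x - x0).
  have st : enorm (x - x0) ^+ 2 <= U1 * t ^+ 2.
    by rewrite uE ler_pM2r ?exprn_gt0 // ltW.
  split.
  - by rewrite -(@ltr_pXn2r _ 2) ?nnegrE ?(ltW r0) // (le_lt_trans st).
  - by rewrite -(@ler_pXn2r _ 2) ?nnegrE ?(ltW rho00) // (le_trans st).
  - rewrite -(@ler_pXn2r _ 2) ?nnegrE // ?mulr_ge0 ?(ltW t0) // (le_trans st) // exprMn.
    by rewrite ler_wpM2r ?exprn_ge0 ?(ltW t0) //; apply: le_trans U14 _; lra.
have far x : r < enorm (x - x0) -> U1 <= u x.
  by move=> rx; rewrite leNgt; apply/negP => /small[]; lra.
have C0 : 0 <= field_const (n := n) r K.
  exact: field_const_ge0.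
rewrite /field_rate in CE.
have C_ge : 2 * field_const (n := n) r K <= C.
  by rewrite CE ler_wpM2r // ler_peMr // ler1n muln_gt0.
have tC0 : 0 <= C * t by rewrite mulr_ge0 ?(ltW t0) // (le_trans _ C_ge) // mulr_ge0.
pose J x : M := \matrix_(i, j) G j x 0 i.
have hphi x (j : 'I_n.+1) : has_gradient (fun y => phi y 0 j) (G j) x := hG x j.
have Jout x : U1 <= u x -> J x = 0.
  move=> /hU[h0 d0]; apply/matrixP => i j; rewrite !mxE /G h0 d0.
  by rewrite !(mul0r, mulr0) addr0.
have cJ i j : continuous (fun x => J x i j).
  move=> x; have [_ _ cG] := hphi x j.
  rewrite (_ : (fun x => J x i j) = (fun x => G j x 0 i)); last by apply/funext => y; rewrite mxE.
  exact: (@cvg_coord _ _ _ (nbhs x)) cG.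
have [c Jc] : exists c, forall i j x, `|J x i j| <= c.
  have hc i j : exists2 c : R, 0 <= c & forall x, `|J x i j| <= c.
    by apply: (compact_support_bounded (cJ i j)) => x /far/Jout ->; rewrite mxE.
  have hc' i j := cid2 (hc i j).
  exists (\sum_i \sum_j s2val (hc' i j)) => i j x; apply: le_trans (s2valP' (hc' i j) x) _.
  rewrite (bigD1 i) //= (bigD1 j) //= -addrA lerDl addr_ge0 ?sumr_ge0 // => [l _|l _].
    exact: s2valP (hc' _ _).
  by apply: sumr_ge0 => l' _; exact: s2valP (hc' _ _).
have htest : tangential_test Omega phi J.
  apply: (@gradients_tangential_test _ _ _ _ _ x0 r) => // [x bx|x].
    have [/hU[h0 _]|/small[xr _ _]] := leP U1 (u x).
      by rewrite /tangent /phi h0 scale0r dot0l.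
    by rewrite /tangent /phi dotZl (hZ4 Omega) // mulr0.
  apply: contraNT; rewrite -ltNge => /far/hU[h0 _].
  by rewrite /phi h0 scale0r.
have phib x : enorm (phi x) <= 2 * t * (1 + C * t) * h (u x).
  have [/hU[h0 _]|/small[xr _ xt]] := leP U1 (u x).
    by rewrite /phi h0 scale0r mulr0 /enorm dot0l sqrtr0.
  have /andP[h0 _] := h01 (u x).
  rewrite /phi enormZ ger0_norm // mulrC ler_wpM2r //.
  have hz : enorm (Z x) <= enorm (x - x0) + field_const (n := n) r K * enorm (x - x0) ^+ 2.
    rewrite -[Z x in leLHS](subrK (x - x0)) addrC; apply: le_trans (enormD _ _) _.
    by rewrite lerD2l; exact: hZ2.
  have s0 := enorm_ge0 (x - x0).
  apply: (le_trans hz); set s := enorm (x - x0) in s0 xt *.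
  have sCt : field_const (n := n) r K * s ^+ 2 <= s * (C * t).
    rewrite expr2 mulrCA ler_wpM2l //; apply: le_trans (_ : field_const (n := n) r K * (2 * t) <= _).
      by rewrite ler_wpM2l.
    by rewrite mulrCA mulrA ler_wpM2r // ltW.
  apply: le_trans (_ : s * (1 + C * t) <= _); first by rewrite mulrDr mulr1 lerD2l.
  by rewrite ler_wpM2r // addr_ge0.
have cphi : continuous phi.
  move=> x; apply: (@cvg_row _ _ _ (nbhs x)) => j.
  exact: has_gradient_continuous (hphi x j).
have B0 : 0 <= 2 * t * (1 + C * t) by rewrite !mulr_ge0 ?addr_ge0 // ltW.
have bdry : 0 <= \int[Gamma]_(z in capillary_bundle m Omega beta)
         dot (conormal Omega z.1 z.2) (phi z.1).
  apply: (@boundary_term_ge0 _ _ _ Omega beta Gamma k phi (2 * t * (1 + C * t))) => //.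
    move=> x; apply: le_trans (phib x) _; have /andP[_ h1] := h01 (u x).
    by rewrite ler_piMr.
  have FF := ae_filter_ringOfSetsType (base_measure Gamma).
  have hS := boundary_measure_null hrG hO hb.
  apply: (@filterS _ _ FF _ _ _ (@filterI _ _ FF _ _ hS (@filterI _ _ FF _ _ hC1 hC2))).
  move=> x [bx [h1 h2]].
  have [/hU[h0 _]|/small[xr xrho xt]] := leP U1 (u x).
    by rewrite /phi h0 scale0r dot0r.
  have /andP[h0 _] := h01 (u x).
  have [tan hdot] := cos_nW_tangential beta k (Z x) hO bx.
  (* As Z is tangential, n_V may be replaced by its tangential part cos beta n_W, the vector that
     (C1) and (C2) speak of. *)
  rewrite /phi dotZr mulr_ge0 // hdot; last by apply: (hZ4 Omega).
  rewrite (hZ5 Omega x _ hO erefl xr bx tan).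
  have := h2 xrho; have := h1 xrho; rewrite ler_norml (dotC (x - x0)) => h3 /andP[h4 _].
  have s0 := enorm_ge0 (x - x0).
  have : K * enorm (x - x0) ^+ 2 * eps0 <=
      K * enorm (x - x0) ^+ 2 * dot (cos_nW m Omega beta k x) tau.
    by rewrite ler_wpM2l // mulr_ge0 // exprn_ge0.
  have -> : K * enorm (x - x0) ^+ 2 * eps0 =
      c0 * `|cos (beta x0)| * enorm (x - x0) ^+ 2.
    by rewrite /K; field; rewrite gt_eqF.
  lra.
(* The lower bound for the divergence that depends on the base point only; beyond the support of the
   cutoff both sides are 0. *)
pose psi x := h (u x) * (m%:R - C * t) + 2 * dh (u x) * u x * (1 + C * t).
have mcont (g : E -> R) : continuous g -> measurable_fun setT (g : borel E -> R).
  by move=> cg; exact: continuous_borel.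
have chu : continuous (fun x => h (u x)).
  by move=> x; apply: continuous_comp; [exact: cu|exact: ch].
have cdhu : continuous (fun x => dh (u x) * u x).
  move=> x; apply: (@cvgM _ _ (nbhs x)); last exact: cu.
  by apply: continuous_comp; [exact: cu|exact: cdh].
have ih : (base_measure V).-integrable setT (EFin \o (fun x => h (u x))).
  apply: (@bounded_integrable _ _ m Omega V bO hrV _ 1); first exact: mcont.
  by move=> x; have /andP[h0 h1] := h01 (u x); rewrite ger0_norm.
have idh : (base_measure V).-integrable setT (EFin \o (fun x => dh (u x) * u x)).
  have [c' _ hc'] : exists2 c : R, 0 <= c & forall x, `|dh (u x) * u x| <= c.
    by apply: (@compact_support_bounded _ _ _ x0 r) => // x /far/hU[_ ->]; rewrite mul0r.
  by apply: (@bounded_integrable _ _ m Omega V bO hrV _ c') => //; exact: mcont.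
have ia : (base_measure V).-integrable setT (EFin \o (fun x => (m%:R - C * t) * h (u x))).
  rewrite (_ : _ \o _ = fun x => ((m%:R - C * t)%:E * (EFin \o (fun x => h (u x))) x)%E) //.
  exact: integrableZl.
have ib : (base_measure V).-integrable setT
    (EFin \o (fun x => (2 * (1 + C * t)) * (dh (u x) * u x))).
  rewrite (_ : _ \o _ =
    fun x => ((2 * (1 + C * t))%:E * (EFin \o (fun x => dh (u x) * u x)%R) x)%E) //.
  exact: integrableZl.
have psiE : psi = (fun x => (m%:R - C * t) * h (u x) + (2 * (1 + C * t)) * (dh (u x) * u x)).
  by apply/funext => x; rewrite /psi; ring.
have ipsi : (base_measure V).-integrable setT (EFin \o psi).
  rewrite psiE (_ : _ \o _ = (EFin \o (fun x => (m%:R - C * t) * h (u x))%R) \+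
     (EFin \o (fun x => (2 * (1 + C * t)) * (dh (u x) * u x))%R))%E //.
  exact: integrableD.
have intpsi : \int[base_measure V]_x psi x = (m%:R - C * t) * I +
    2 * (1 + C * t) * \int[base_measure V]_x (dh (u x) * u x).
  by rewrite psiE RintegralD // !RintegralZl // -IE.
have mpsi : measurable_fun setT (psi : borel E -> R).
  by apply/measurable_EFinP; have /integrableP[] := ipsi.
have fv : \int[base_measure V]_x psi x <= first_variation m Omega V J.
  apply: (first_variation_lower bO hrV cJ Jc mpsi ipsi) => x P gP.
  have [Uu|/small[xr _ xt]] := leP U1 (u x).
    rewrite Jout // /psi; have [-> ->] := hU _ Uu.
    by rewrite /plane_div mulmx0 mxtrace0 !(mul0r, mulr0) addr0.
  have /andP[h0 _] := h01 (u x).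
  have := plane_div_lower gP h0 (dh0 (u x)) t0 C0 xt (hZ2 x xr) (fun j => hZ3 x j xr).
  by rewrite -CE.
have meta : measurable_fun setT ((fun x => h (u x)) : borel E -> R) by exact: mcont.
have eta01 x : 0 <= h (u x) <= 1 by exact: h01.
have ct := curvature_term_lower bO hrV hH cphi meta B0 eta01 phib.
have ho := curvature_hoelder bO hrV hH p1 hN meta eta01.
have := hvar phi J htest => hv; rewrite hv intpsi in fv.
have := ler_wpM2l B0 ho; rewrite -IE => hoe.
have combine (a1 a2 a3 a4 a5 a6 : R) : (m%:R - C * t) * I + 2 * (1 + C * t) * a1 <= - a2 - a3 ->
    - a2 <= a6 * a4 -> 0 <= a3 -> a6 * a4 <= a5 ->
    m%:R * I - C * t * I - (1 + C * t) * - (2 * a1) <= a5.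
  lra.
exact: combine fv ct bdry hoe.
Qed.

End WeightedInequality.

Lemma cutoff_continuous {R : realType} (h dh : R -> R) (U1 : R) :
  cutoff h dh U1 -> continuous h.
Proof.
move=> [hd _ _ _ _] a; apply: differentiable_continuous.
by apply/derivable1_diffP; have [] := hd a.
Qed.

Lemma scaled_dist2_continuous {R : realType} {n : nat} (x0 : 'rV[R]_n.+1) (t : R) :
  continuous (scaled_dist2 x0 t).
Proof.
move=> x; rewrite /scaled_dist2; apply: (@cvgM _ _ (nbhs x)); first exact: cvg_cst.
under eq_fun do rewrite expr2.
by apply: (@cvgM _ _ (nbhs x)); exact: enorm_dist_continuous.
Qed.

Lemma scaled_dist2_ge0 {R : realType} {n : nat} (x0 : 'rV[R]_n.+1) (t : R) x :
  0 < t -> 0 <= scaled_dist2 x0 t x.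
Proof. by move=> t0; rewrite mulr_ge0 ?invr_ge0 ?exprn_ge0 ?enorm_ge0 // ltW. Qed.

Lemma scaled_dist2_derive {R : realType} {n : nat} (x0 : 'rV[R]_n.+1) (t : R) x :
  0 < t -> is_derive t 1 (fun s => scaled_dist2 x0 s x) (- (2 / t * scaled_dist2 x0 t x)).
Proof.
move=> t0; rewrite /scaled_dist2; set A := enorm _ ^+ 2.
have tn : t != 0 by rewrite gt_eqF.
have h1 : is_derive t 1 (fun s : R => s ^+ 2) (2 * t).
  rewrite (_ : (fun s => _) = (id : R -> R) ^+ 2); last by apply/funext => s; rewrite exprfctE.
  by apply: is_derive_eq; rewrite /GRing.scale /= !mulr1 expr1 mulr_natl.
have t2 : t ^+ 2 != 0 by rewrite expf_neq0.
have h2 := @is_deriveV R (fun s => s ^+ 2) t (2 * t) 1 t2 h1.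
rewrite (_ : (fun s => _) = A \*: (fun s : R => s ^- 2)); last first.
  by apply/funext => s; rewrite /GRing.scale /= mulrC.
by apply: is_derive_eq; rewrite /GRing.scale /=; field.
Qed.

(** * Monotonicity *)

Section WeightedMass.
Context {R : realType} {n : nat} (m : nat).
Local Notation E := 'rV[R]_n.+1.
Context (Omega : set E) (V : {measure set (borel (bundle R n)) -> \bar R}).
Context (bO : bounded_set Omega) (hV : radon_on (grassmann_bundle m (closure Omega)) V).
Local Notation mu := (base_measure V).
Context (x0 : E) (h dh : R -> R) (U1 : R) (hc : cutoff h dh U1).

Lemma weighted_integrable (t : R) : mu.-integrable setT (EFin \o (fun x => h (scaled_dist2 x0 t x))).
Proof.
apply: (@bounded_integrable _ _ m Omega V bO hV _ 1).
  apply: continuous_borel => x.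
  by apply: continuous_comp; [exact: scaled_dist2_continuous|exact: (cutoff_continuous hc)].
have [_ _ h01 _ _] := hc.
by move=> x; have /andP[h0 h1] := h01 (scaled_dist2 x0 t x); rewrite ger0_norm.
Qed.

(** Differentiation under the integral. The derivative of h(u) in s is -(2/s) u h'(u); here u h'(u)
    is bounded for u >= 0, since h' vanishes beyond [U1], and 2/s <= 4/t for s > t/2. As the mass is
    finite, a constant dominates. The integral obtained is the one in the weighted inequality. *)
Lemma weighted_mass_derive (t : R) : 0 < t ->
  is_derive t 1 (fun s => \int[mu]_x h (scaled_dist2 x0 s x))
    (- (2 / t * \int[mu]_x (dh (scaled_dist2 x0 t x) * scaled_dist2 x0 t x))).
Proof.
move=> t0; have [hd cdh h01 dh0 hU] := hc.
have [D D0 hD] : exists2 D : R, 0 <= D & forall a, 0 <= a -> `|dh a * a| <= D.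
  have [/ltW U0|U0] := ltP U1 0.
    exists 0 => // a a0; have [_ ->] := hU a (le_trans U0 a0).
    by rewrite mul0r normr0.
  have cf : {within `[0, U1], continuous (fun a => `|dh a * a|)}.
    apply: continuous_subspaceT => a; apply: cvg_norm.
    by apply: cvgM; [exact: cdh|exact: cvg_id].
  have [c cU hm] := EVT_max U0 cf; exists `|dh c * c| => // a a0.
  have [aU|Ua] := leP a U1; first by apply: hm; rewrite in_itv /= a0.
  by have [_ ->] := hU a (ltW Ua); rewrite mul0r normr0.
pose f s (x : borel E) := h (scaled_dist2 x0 s x).
have df (s : R) x : 0 < s -> is_derive s 1 (f ^~ x)
    (dh (scaled_dist2 x0 s x) * - (2 / s * scaled_dist2 x0 s x)).
  move=> s0; exact: (@is_derive1_comp R h (fun s => scaled_dist2 x0 s x) s _ _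
    (hd _) (scaled_dist2_derive x0 x s0)).
have d1f (s : R) x : 0 < s -> partial1of2 f s x =
    dh (scaled_dist2 x0 s x) * - (2 / s * scaled_dist2 x0 s x).
  by move=> s0; rewrite partial1of2E; have [_ ->] := df s x s0.
have tI : [set` `](t / 2), (2 * t)[] t by rewrite /= in_itv /=; apply/andP; split; lra.
have pos (s : R) : [set` `](t / 2), (2 * t)[] s -> 0 < s.
  by rewrite /= in_itv /= => /andP[ts _]; apply: lt_trans ts; rewrite divr_gt0.
have ub (s : R) x : [set` `](t / 2), (2 * t)[] s -> setT x -> `|partial1of2 f s x| <= 4 / t * D.
  move=> sI _; have s0 := pos s sI.
  rewrite d1f // mulrN normrN mulrCA normrM ger0_norm ?divr_ge0 ?(ltW s0) //.
  apply: ler_pM => //; [by rewrite divr_ge0 ?(ltW s0)| |].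
    move: sI; rewrite /= in_itv /= => /andP[ts _].
    by rewrite ler_pdivrMr // mulrAC ler_pdivlMr //; lra.
  by apply: hD; exact: scaled_dist2_ge0.
have int (s : R) : [set` `](t / 2), (2 * t)[] s -> mu.-integrable setT (EFin \o f s).
  by move=> _; exact: weighted_integrable.
have der (s : R) x : [set` `](t / 2), (2 * t)[] s -> setT x -> derivable (f ^~ x) s 1.
  by move=> sI _; have [] := df s x (pos s sI).
have G0 (x : borel E) : 0 <= cst (4 / t * D) x :> R.
  by rewrite /cst /= mulr_ge0 // divr_ge0 // ltW.
have iG : mu.-integrable setT (EFin \o (cst (4 / t * D) : borel E -> R)).
  apply: (@bounded_integrable _ _ m Omega V bO hV (cst (4 / t * D)) (4 / t * D)) => //.
  by move=> x; rewrite ger0_norm.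
have e1 := differentiation_under_integral measurableT tI int der G0 iG ub.
have e2 := derivable_under_integral measurableT tI int der G0 iG ub.
apply: DeriveDef => //; rewrite -derive1E e1.
rewrite -mulNr -RintegralZl //; last first.
  apply: (@bounded_integrable _ _ m Omega V bO hV _ D).
    apply: continuous_borel => x; apply: (@cvgM _ _ (nbhs x)); last exact: scaled_dist2_continuous.
    by apply: continuous_comp; [exact: scaled_dist2_continuous|exact: cdh].
  by move=> x; apply: hD; exact: scaled_dist2_ge0.
by apply: eq_Rintegral => x _; rewrite d1f // mulrN mulNr mulrCA.
Qed.

End WeightedMass.

Section CutMass.
Context {R : realType} {n : nat} (m : nat).
Local Notation E := 'rV[R]_n.+1.
Context (Omega : set E) (V : {measure set (borel (bundle R n)) -> \bar R}).
Context (bO : bounded_set Omega) (hV : radon_on (grassmann_bundle m (closure Omega)) V).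
Local Notation mu := (base_measure V).
Context (x0 : E).

Lemma cball_measurable (t : R) : measurable (cball x0 t : set (borel E)).
Proof. by apply: borel_closed; exact: cball_closed. Qed.

Lemma ball_mass_ge0 (t : R) : 0 <= ball_mass V x0 t.
Proof. exact: fine_ge0. Qed.

Lemma ball_mass_fin (t : R) : mu (cball x0 t) = (ball_mass V x0 t)%:E.
Proof.
rewrite /ball_mass fineK // ge0_fin_numE //.
apply: le_lt_trans (varifold_mass_finite bO hV).
by apply: le_measure; rewrite ?inE //; exact: cball_measurable.
Qed.

Lemma ball_mass_mono (s t : R) : s <= t -> ball_mass V x0 s <= ball_mass V x0 t.
Proof.
move=> st; rewrite -lee_fin -!ball_mass_fin; apply: le_measure.
- by rewrite inE; exact: cball_measurable.
- by rewrite inE; exact: cball_measurable.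
- by move=> x /= xs; exact: le_trans st.
Qed.

(** Every cutoff is 1 on the closed ball, and a point outside is eventually beyond the support.
    Dominated convergence therefore gives the mass of the closed ball, boundary sphere included. *)
Lemma cut_mass_cvg (t : R) : 0 < t ->
  \int[mu]_x soft_cut (k.+1%:R^-1) (scaled_dist2 x0 t x) @[k --> \oo] --> ball_mass V x0 t.
Proof.
move=> t0.
have uball x : (scaled_dist2 x0 t x <= 1) = (enorm (x - x0) <= t).
  rewrite /scaled_dist2 mulrC ler_pdivrMr ?exprn_gt0 // mul1r.
  by rewrite ler_pXn2r ?nnegrE ?enorm_ge0 // ltW.
pose f k (x : borel E) : \bar R := (soft_cut (k.+1%:R^-1) (scaled_dist2 x0 t x))%:E.
pose g (x : borel E) : \bar R := (\1_(cball x0 t : set (borel E)) x)%:E.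
have kp k : 0 < k.+1%:R^-1 :> R by rewrite invr_gt0 ltr0n.
have hc k := cutoff_soft_cut (kp k).
have mf k : measurable_fun setT (f k).
  by have /integrableP[] := weighted_integrable bO hV x0 (hc k) t.
have mg : measurable_fun setT g.
  by apply/measurable_EFinP; apply: measurable_indic; exact: cball_measurable.
have fg : {ae mu, forall x, setT x -> f k x @[k --> \oo] --> g x}.
  apply: aeW => x _; rewrite /f /g indicE.
  have [u1|u1] := leP (scaled_dist2 x0 t x) 1.
    rewrite (_ : (fun k => _) = cst 1%E); last first.
      by apply/funext => k; rewrite soft_cut_eq1.
    have xb : (cball x0 t : set (borel E)) x by rewrite /cball /= -uball.
    by rewrite (mem_set xb); exact: cvg_cst.
  have xb : ~ (cball x0 t : set (borel E)) x by move=> h; move: u1; rewrite ltNge uball h.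
  rewrite (memNset xb).
  apply: cvg_near_cst; have d0 : 0 < scaled_dist2 x0 t x - 1 by rewrite subr_gt0.
  near=> k; congr EFin.
  have [_ _ _ _ hU] := hc k.
  suff h : k.+1%:R^-1 < scaled_dist2 x0 t x - 1.
    by have [-> _] := hU (scaled_dist2 x0 t x) ltac:(by rewrite -lerBrDl ltW).
  near: k; exact: (near_infty_natSinv_lt (PosNum d0)).
pose G (x : borel E) : \bar R := 1%E.
have ig : mu.-integrable setT G.
  apply: (@bounded_integrable _ _ m Omega V bO hV (cst 1) 1) => // x.
  by rewrite normr1.
have fb : {ae mu, forall x k, setT x -> (`|f k x| <= G x)%E}.
  apply: aeW => x k _; rewrite /f /= lee_fin.
  have [_ _ h01 _ _] := hc k; have /andP[h0 h1] := h01 (scaled_dist2 x0 t x).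
  by rewrite ger0_norm.
have [_ _ h] := dominated_convergence measurableT mf mg fg ig fb.
have eg : (\int[mu]_x g x = (ball_mass V x0 t)%:E)%E.
  by rewrite /g integral_indic //; [rewrite setIT ball_mass_fin|exact: cball_measurable].
rewrite eg in h; exact: fine_cvg h.
Unshelve. all: by end_near. Qed.

End CutMass.

(** The limit density is not assumed positive. For l = 0 the expression exp(x ln u) is of no help,
    and u <= e^(1/x) is used to get u^x <= e. *)
Lemma cvg_powR {R : realType} {T : Type} {F : set_system T} {FF : Filter F}
    (u : T -> R) (l x : R) : 0 < x -> (forall k, 0 <= u k) -> 0 <= l ->
  u @ F --> l -> u k `^ x @[k --> F] --> l `^ x.
Proof.
move=> x0 u0; rewrite le_eqVlt => /predU1P[<-|l0] ul.
  rewrite powR0 ?gt_eqF //; apply/cvgrPdist_le => e e0.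
  have ep : 0 < e `^ x^-1 by exact: powR_gt0.
  near=> k.
  have uk : u k <= e `^ x^-1.
    have := u0 k => uk0; rewrite -[u k]ger0_norm // -[_ (u k)]normrN -[- _]sub0r.
    by near: k; move/cvgrPdist_le: ul; apply.
  rewrite sub0r normrN ger0_norm ?powR_ge0 //.
  have -> : e = (e `^ x^-1) `^ x by rewrite -powRrM mulVf ?gt_eqF // powRr1 // ltW.
  by apply: ge0_ler_powR; rewrite ?nnegrE ?powR_ge0 // ltW.
have h1 : expR (x * ln (u k)) @[k --> F] --> expR (x * ln l).
  apply: (@cvg_comp _ _ _ (fun k => x * ln (u k)) expR F (nbhs (x * ln l))); last exact: continuous_expR.
  apply: cvgM; first exact: cvg_cst.
  exact: (@cvg_comp _ _ _ u (@ln R) F (nbhs l) _ ul (continuous_ln l0)).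
rewrite {2}/powR gt_eqF //.
apply: cvg_trans h1; apply: near_eq_cvg; near=> k.
have uk : 0 < u k by near: k; exact: (@cvgr_gt R _ F _ _ _ ul _ l0).
by rewrite /powR gt_eqF.
Unshelve. all: by end_near. Qed.

(** * Monotonicity below the chart radius *)

Section SmallRadii.
Context {R : realType} {n : nat} (m : nat).
Local Notation E := 'rV[R]_n.+1.
Local Notation M := 'M[R]_n.+1.

(** The approximate functionals have nonnegative derivative on [s, t], and the inequality between
    their end values survives the limit. The bound 2 t^2 < r^2 leaves room for cutoffs supported up
    to 1 + d <= 2. *)
Lemma growth_small Omega beta
    (V Gamma : {measure set (borel (bundle R n)) -> \bar R}) (H : E -> E)
    (k : R.-pker (borel E) ~> (borel M)) (x0 tau : E)
    (p La normH eps0 rho0 c0 r s t C : R) f F b DF Db :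
  (1 <= m)%N -> m%:R < p -> bounded_C2_domain Omega -> contact_angle Omega beta ->
  capillary_varifold m Omega beta V Gamma H -> vLnorm V p H = normH%:E ->
  disintegration m Omega beta Gamma k ->
  capillary_boundary_point m Omega beta Gamma k x0 eps0 rho0 c0 tau ->
  0 < r <= 1 -> chart (boundary Omega) x0 r f F b DF Db ->
  C = field_rate n r (c0 * `|cos (beta x0)| / eps0) ->
  C * (1 + m%:R) <= La * p -> 2 * normH <= La * (p - m%:R) ->
  0 < s -> s <= t -> t < rho0 -> 2 * t ^+ 2 < r ^+ 2 ->
  growth m p La 0 (ball_mass V x0) s <= growth m p La 0 (ball_mass V x0) t.
Proof.
move=> m1 mp hO hb hV hN hdis hcb r01 hchart CE hLa1 hLa2 s0 st trho tr.
have [r0 _] := andP r01.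
have p1 : 1 < p by apply: le_lt_trans mp; rewrite ler1n.
have bO : bounded_set Omega by have [] := hO.
have [hrV _ _ _ _] := hV.
have N0 : 0 <= normH by rewrite -lee_fin -hN; exact: Lnorm_ge0.
have [_ [/andP[e0 _] _ c00] _ _ _] := hcb.
have C0 : 0 <= C.
  by rewrite CE /field_rate mulr_ge0 ?mulr_ge0 // field_const_ge0 // !mulr_ge0 ?invr_ge0 // ltW.
have t0 : 0 < t by exact: lt_le_trans st.
(* One sequence serves both as width of the cutoff and as the constant keeping the base of the power
   positive, so that a single limit removes both. *)
pose d (i : nat) : R := i.+1%:R^-1.
have d0 i : 0 < d i by rewrite invr_gt0 ltr0n.
pose I i (a : R) := \int[base_measure V]_x soft_cut (d i) (scaled_dist2 x0 a x).
have I0 i a : 0 <= I i a.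
  by apply: Rintegral_ge0 => x _; rewrite sqr_ge0.
have cvgG a : 0 < a -> growth m p La (d i) (I i) a @[i --> \oo] --> growth m p La 0 (ball_mass V x0) a.
  move=> a0; rewrite /growth; apply: cvgM; first exact: cvg_cst.
  apply: cvgD; last exact: cvg_cst.
  have am : 0 < a ^+ m by rewrite exprn_gt0.
  apply: cvg_powR; first by rewrite invr_gt0 (lt_trans ltr01).
  - by move=> i; rewrite addr_ge0 ?divr_ge0 ?I0 // ltW.
  - by rewrite addr0 divr_ge0 ?ball_mass_ge0 // ltW.
  - apply: cvgD; last exact: cvg_harmonic.
    by apply: cvgM; [exact: (cut_mass_cvg bO hrV)|exact: cvg_cst].
apply: (ler_cvg_to (cvgG s s0) (cvgG t t0)).
(* Strictness of t < rho0 leaves room for the wider support: eventually (1 + d) t^2 <= rho0^2. *)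
have h : 0 < rho0 ^+ 2 / t ^+ 2 - 1.
  rewrite subr_gt0 ltr_pdivlMr ?exprn_gt0 // mul1r.
  by rewrite ltr_pXn2r ?nnegrE ?(ltW t0) // ltW // (lt_trans t0).
near=> i.
have di : (1 + d i) * t ^+ 2 <= rho0 ^+ 2.
  suff h1 : d i < rho0 ^+ 2 / t ^+ 2 - 1.
    by rewrite -ler_pdivlMr ?exprn_gt0 // addrC -lerBrDr ltW.
  near: i; exact: (near_infty_natSinv_lt (PosNum h)).
have d1 : d i <= 1 by rewrite invf_le1 // ler1n.
apply: nondecreasing_of_derive_ge0 => // a /andP[sa at_].
have a0 : 0 < a by exact: lt_le_trans sa.
have hcut := cutoff_soft_cut (d0 i).
have der := weighted_mass_derive bO hrV x0 hcut a0.
have a2 : a ^+ 2 <= t ^+ 2 by rewrite ler_pXn2r ?nnegrE // ltW.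
have U4 : 1 + d i <= 4 by lra.
have a20 : 0 <= a ^+ 2 by exact: sqr_ge0.
have Ur : (1 + d i) * a ^+ 2 < r ^+ 2.
  by apply: le_lt_trans tr; apply: ler_pM => //; have := d0 i; lra.
have Urho : (1 + d i) * a ^+ 2 <= rho0 ^+ 2.
  by apply: le_trans di; apply: ler_wpM2l => //; have := d0 i; lra.
have main := capillary_weighted_inequality p1 hO hb hV hN hdis hcb r01 hchart hcut U4 a0 Ur Urho CE erefl.
apply: (growth_derive_ge0 a0 mp (ltW p1) C0 N0 (d0 i) (I0 i a) der _ hLa1 hLa2).
have e (Y : R) : a * - (2 / a * Y) = - (2 * Y) by field; rewrite gt_eqF.
by rewrite e; exact: main.
Unshelve. all: by end_near. Qed.

End SmallRadii.

(** * From monotonicity to the additive estimate *)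

Section GrowthError.
Context {R : realType} (p La al : R) (theta : R -> R).
Hypotheses (p1 : 1 < p) (La0 : 0 < La) (al0 : 0 < al) (theta0 : forall t, 0 < t -> 0 <= theta t).
Let G t := expR (La * t) * (theta t `^ p^-1 + La * t `^ al).

(** Monotonicity gives theta(s) <= G(s)^p <= G(t)^p. By [powR_sub_le], G(t)^p exceeds theta(t) by at
    most p G(t)^(p-1) (G(t) - theta(t)^(1/p)), and the last factor tends to 0 because exp(La t) - 1
    and t^al do. *)
Lemma growth_error (R0 : R) :
  (forall s t, 0 < s -> s <= t -> t < R0 -> G s <= G t) ->
  (exists2 B : R, 0 < B & forall t, 0 < t -> t < R0 -> G t <= B) ->
  exists g : R -> R,
    [/\ forall t : R, 0 < t -> 0 < g t,
        {in `]0, +oo[ &, {homo g : s t / s <= t}},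
        forall s t : R, 0 < s -> s < t -> t < R0 -> theta s <= theta t + g t
      & g t @[t --> 0^'+] --> (0 : R)].
Proof.
move=> mono [B B0 hB].
have p0 : 0 < p by exact: lt_trans p1.
have pB : 0 < p * B `^ (p - 1) by rewrite mulr_gt0 // powR_gt0.
have e1 t : 0 < t -> 1 < expR (La * t) by move=> t0; rewrite expR_gt1 mulr_gt0.
(* B replaces both G(t) and theta(t)^(1/p); what remains is explicit, increasing and defined for all
   t > 0. *)
exists (fun t => p * B `^ (p - 1) *
  ((expR (La * t) - 1) * B + expR (La * t) * (La * t `^ al))); split.
- move=> t t0; rewrite mulr_gt0 // addr_gt0 ?mulr_gt0 ?expR_gt0 ?powR_gt0 //.
  by rewrite subr_gt0 e1.
- move=> s t; rewrite !in_itv /= !andbT => s0 t0 st; rewrite ler_pM2l //.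
  have le_e : expR (La * s) <= expR (La * t) by rewrite ler_expR ler_pM2l.
  apply: lerD; first by rewrite ler_pM2r // lerB.
  apply: ler_pM; rewrite ?expR_ge0 ?mulr_ge0 ?powR_ge0 ?(ltW La0) //.
  by rewrite ler_pM2l //; apply: ge0_ler_powR; rewrite ?nnegrE ?(ltW s0) ?(ltW t0) ?(ltW al0).
- move=> s t s0 st tR; have t0 : 0 < t by exact: lt_trans st.
  have le_theta a : 0 < a -> theta a `^ p^-1 <= G a.
    move=> a0; rewrite /G -[leLHS]mul1r; apply: ler_pM; rewrite ?powR_ge0 //.
      by rewrite ltW // e1.
    by rewrite lerDl mulr_ge0 ?powR_ge0 // ltW.
  have G0 a : 0 < a -> 0 <= G a.
    by move=> a0; apply: le_trans (le_theta a a0); exact: powR_ge0.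
  have thE a : 0 < a -> theta a = (theta a `^ p^-1) `^ p.
    by move=> a0; rewrite -powRrM mulVf ?gt_eqF // powRr1 // theta0.
  have h1 : theta s <= G t `^ p.
    rewrite (thE s s0); apply: ge0_ler_powR; rewrite ?nnegrE ?powR_ge0 ?G0 ?(ltW p0) //.
    by apply: le_trans (le_theta s s0) _; apply: mono => //; exact: ltW.
  have h2 := powR_sub_le p1 (powR_ge0 (theta t) p^-1) (le_theta t t0).
  rewrite -(thE t t0) in h2.
  suff h3 : p * G t `^ (p - 1) * (G t - theta t `^ p^-1) <=
      p * B `^ (p - 1) * ((expR (La * t) - 1) * B + expR (La * t) * (La * t `^ al)).
    by move: (le_trans h2 h3); rewrite lerBlDl; exact: le_trans h1.
  apply: ler_pM.
  + by rewrite mulr_ge0 ?powR_ge0 // ltW.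
  + by rewrite subr_ge0 le_theta.
  + rewrite ler_pM2l //; apply: ge0_ler_powR; rewrite ?nnegrE ?G0 ?(ltW B0) ?hB //.
    by rewrite subr_ge0 ltW.
  + have -> : G t - theta t `^ p^-1 =
        (expR (La * t) - 1) * theta t `^ p^-1 + expR (La * t) * (La * t `^ al).
      by rewrite /G; ring.
    rewrite lerD2r ler_pM2l ?subr_gt0 ?e1 //.
    exact: le_trans (le_theta t t0) (hB t t0 tR).
- have ce : expR (La * t) @[t --> (0 : R)^'+] --> (1 : R).
    have h : (fun t => expR (La * t)) @ (0 : R) --> expR (La * 0).
      apply: (@cvg_comp _ _ _ (fun t => La * t) expR (nbhs (0 : R)) (nbhs (La * 0))).
        by apply: cvgM; [exact: cvg_cst|exact: cvg_id].
      exact: continuous_expR.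
    by rewrite mulr0 expR0 in h; exact: cvg_at_right_filter.
  have cp := powR_cvg0 al0.
  have e0 : p * B `^ (p - 1) * ((1 - 1) * B + 1 * (La * 0)) = 0 by ring.
  rewrite -[X in _ --> X]e0.
  apply: cvgM; first exact: cvg_cst.
  apply: cvgD; first by apply: cvgM; [apply: cvgB => //; exact: cvg_cst|exact: cvg_cst].
  by apply: cvgM => //; apply: cvgM => //; exact: cvg_cst.
Qed.

End GrowthError.

(* Lambda is chosen from n, m, p, S (with its constant rho_S), the L^p norm
   normH of H, eps0, c0 and cosb = cos(beta(x0)) only. *)
Theorem corollary4p4 (R : realType) (n m : nat) (p : R)
    (S : set 'rV[R]_n.+1) (rhoS normH eps0 c0 cosb : R) :
  (2 <= n)%N -> (1 <= m <= n)%N -> m%:R < p ->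
  exists Lambda : R, 0 < Lambda /\
  forall (Omega : set 'rV[R]_n.+1) (beta : 'rV[R]_n.+1 -> R)
         (V Gamma : {measure set (borel (bundle R n)) -> \bar R})
         (H : 'rV[R]_n.+1 -> 'rV[R]_n.+1)
         (k : R.-pker (borel 'rV[R]_n.+1) ~> (borel 'M[R]_n.+1))
         (x0 tau : 'rV[R]_n.+1) (rho0 : R),
    bounded_C2_domain Omega -> boundary Omega = S ->
    tubular_radius Omega rhoS ->
    contact_angle Omega beta ->
    capillary_varifold m Omega beta V Gamma H ->
    vLnorm V p H = normH%:E ->
    disintegration m Omega beta Gamma k ->
    capillary_boundary_point m Omega beta Gamma k x0 eps0 rho0 c0 tau ->
    cos (beta x0) = cosb ->
    {in `]0, Num.min rho0 (rhoS / 2)[ &,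
       {homo (fun rho => expR (Lambda * rho) *
                ((ball_mass V x0 rho / rho ^+ m) `^ p^-1
                 + Lambda * rho `^ ((p - m%:R) / p)))
        : r rho / r <= rho}} /\
    exists g : R -> R,
      [/\ forall rho : R, 0 < rho -> 0 < g rho,
          {in `]0, +oo[ &, {homo g : r rho / r <= rho}},
          forall r rho : R, 0 < r -> r < rho -> rho < Num.min rho0 (rhoS / 2) ->
            ball_mass V x0 r / r ^+ m <= ball_mass V x0 rho / rho ^+ m + g rho
        & g rho @[rho --> 0^'+] --> (0 : R)].
Proof.
move=> _ /andP[m1 _] mp.
case: (pselect (exists Omega, bounded_C2_domain Omega /\ boundary Omega = S)); last first.
  (* If S bounds no C^2 domain, every Lambda will do. *)
  by move=> noO; exists 1; split => // Omega *; exfalso; apply: noO; exists Omega.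
(* Omega is given only after [Lambda], so the charts are taken from some domain D1 with boundary S;
   they serve every domain with this boundary. *)
move=> [D1 [hO1 bS1]].
have [r r01 hch] := exists_chart hO1 (boundary_compact hO1).
rewrite bS1 in hch; have [r0 _] := andP r01.
have p1 : 1 < p by apply: le_lt_trans mp; rewrite ler1n.
have p0 : 0 < p by exact: lt_trans p1.
have pm : 0 < p - m%:R by rewrite subr_gt0.
pose C := field_rate n r (c0 * `|cosb| / eps0).
(* For t <= r1 one has 2 t^2 <= r^2 / 2 < r^2, as required at small radii; from r1 on the argument
   for large radii applies. *)
pose r1 := r / 2; have r10 : 0 < r1 by rewrite divr_gt0.
(* One summand for each requirement: C (1 + m) <= La p and 2 normH <= La (p - m) for the derivative,
   m <= La p r1 for large radii. Absolute values are needed as the signs of the parameters are known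
   only once a varifold and a boundary point are given. *)
pose La1 := `|C| * (1 + m%:R) / p; pose La2 := 2 * `|normH| / (p - m%:R).
pose La3 := m%:R / (p * r1).
have La10 : 0 <= La1 by rewrite divr_ge0 ?mulr_ge0 ?addr_ge0 // ltW.
have La20 : 0 <= La2 by rewrite divr_ge0 ?mulr_ge0 // ltW.
have La30 : 0 <= La3 by rewrite divr_ge0 ?mulr_ge0 // ltW.
pose La := 1 + La1 + La2 + La3.
have La0 : 0 < La by rewrite /La; lra.
have hLa1 : C * (1 + m%:R) <= La * p.
  apply: le_trans (_ : `|C| * (1 + m%:R) <= _).
    by rewrite ler_wpM2r ?addr_ge0 // ler_norm.
  by rewrite -ler_pdivrMr // -/La1 /La; lra.
have hLa2 : 2 * normH <= La * (p - m%:R).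
  apply: le_trans (_ : 2 * `|normH| <= _); first by rewrite ler_wpM2l // ler_norm.
  by rewrite -ler_pdivrMr // -/La2 /La; lra.
have hLa3 : m%:R <= La * p * r1.
  by rewrite -mulrA -ler_pdivrMr ?mulr_gt0 // -/La3 /La; lra.
exists La; split => // Omega beta V Gamma H k x0 tau rho0 hO bS htub hb hV hN hdis hcb hcos.
have [[bx0 _ _] [_ /andP[rho00 _] _] _ _ _] := hcb.
have [rhoS0 _] := htub.
have bO : bounded_set Omega by have [] := hO.
have [hrV _ _ _ _] := hV.
have mass_mono := ball_mass_mono bO hrV x0.
have mass0 := ball_mass_ge0 V x0.
have [f [F [b [DF [Db hchart]]]]] : exists f F b DF Db, chart (boundary Omega) x0 r f F b DF Db.
  by rewrite bS; apply: hch; rewrite -bS.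
have CE : C = field_rate n r (c0 * `|cos (beta x0)| / eps0) by rewrite hcos.
set R0 := Num.min rho0 (rhoS / 2).
have R00 : 0 < R0 by rewrite lt_min rho00 divr_gt0.
have mono s t : 0 < s -> s <= t -> t < R0 ->
    expR (La * s) * ((ball_mass V x0 s / s ^+ m) `^ p^-1 + La * s `^ ((p - m%:R) / p)) <=
    expR (La * t) * ((ball_mass V x0 t / t ^+ m) `^ p^-1 + La * t `^ ((p - m%:R) / p)).
  move=> s0 st; rewrite lt_min => /andP[trho _].
  have small a c : 0 < a -> a <= c -> c < rho0 -> c <= r1 ->
      expR (La * a) * ((ball_mass V x0 a / a ^+ m) `^ p^-1 + La * a `^ ((p - m%:R) / p)) <=
      expR (La * c) * ((ball_mass V x0 c / c ^+ m) `^ p^-1 + La * c `^ ((p - m%:R) / p)).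
    move=> a0 ac crho cr.
    have cr2 : 2 * c ^+ 2 < r ^+ 2.
      have : c ^+ 2 <= r1 ^+ 2 by rewrite ler_pXn2r ?nnegrE ?(ltW r10) // (le_trans (ltW a0)).
      rewrite /r1 expr_div_n; have : 0 < r ^+ 2 by rewrite exprn_gt0.
      lra.
    have := growth_small m1 mp hO hb hV hN hdis hcb r01 hchart CE hLa1 hLa2 a0 ac crho cr2.
    by rewrite /growth !addr0.
  have large a c : r1 <= a -> a <= c ->
      expR (La * a) * ((ball_mass V x0 a / a ^+ m) `^ p^-1 + La * a `^ ((p - m%:R) / p)) <=
      expR (La * c) * ((ball_mass V x0 c / c ^+ m) `^ p^-1 + La * c `^ ((p - m%:R) / p)).
    by move=> ra ac; apply: (growth_large p0 mp r10 (ltW La0) hLa3 ra ac (mass0 a)); exact: mass_mono.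
  have [tr|rt] := leP t r1; first exact: small.
  have [rs|sr] := leP r1 s; first exact: large.
  apply: le_trans (small s r1 s0 (ltW sr) _ _) (large r1 t _ (ltW rt)) => //.
  exact: lt_trans trho.
split.
  move=> s t; rewrite !in_itv /= => /andP[s0 _] /andP[_ tR] st.
  exact: mono.
have al0 : 0 < (p - m%:R) / p by rewrite divr_gt0.
pose theta t := ball_mass V x0 t / t ^+ m.
have theta0 t : 0 < t -> 0 <= theta t by move=> t0; rewrite divr_ge0 // exprn_ge0 // ltW.
apply: (@growth_error R p La ((p - m%:R) / p) theta p1 La0 al0 theta0 R0 mono).
(* Monotonicity holds strictly below R0, so G is bounded by its value at h on (0, h]. On (h, R0) its
   ingredients are bounded separately: the mass by that of the ball of radius R0, and 1/t^m by
   1/h^m. The summand 1 below makes the bound positive. *)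
pose h := R0 / 2; have h0 : 0 < h by rewrite divr_gt0.
have hR : h < R0 by rewrite /h; lra.
pose G a t := expR (La * t) * (a `^ p^-1 + La * t `^ ((p - m%:R) / p)).
have G0 a t : 0 <= G a t.
  by rewrite mulr_ge0 ?expR_ge0 // addr_ge0 ?mulr_ge0 ?powR_ge0 // ltW.
exists (1 + G (theta h) h + G (ball_mass V x0 R0 / h ^+ m) R0).
  by rewrite -addrA ltr_pwDl // addr_ge0.
move=> t t0 tR; have [th|ht] := leP t h.
  apply: le_trans (mono t h t0 th hR) _; rewrite -/(theta h) -/(G _ _).
  by have := G0 (ball_mass V x0 R0 / h ^+ m) R0; lra.
apply: le_trans (_ : G (ball_mass V x0 R0 / h ^+ m) R0 <= _); last first.
  by have := G0 (theta h) h; lra.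
apply: ler_pM; rewrite ?expR_ge0 ?addr_ge0 ?mulr_ge0 ?powR_ge0 ?(ltW La0) //.
  by rewrite ler_expR ler_pM2l // ltW.
apply: lerD.
  apply: ge0_ler_powR; rewrite ?nnegrE ?invr_ge0 ?theta0 ?(ltW p0) //.
    by rewrite divr_ge0 // exprn_ge0 // ltW.
  apply: ler_pM => //; first by rewrite invr_ge0 exprn_ge0 // ltW.
    by apply: mass_mono; exact: ltW.
  rewrite lef_pV2 ?posrE ?exprn_gt0 //.
  by apply: lerXn2r; rewrite ?nnegrE ltW.
rewrite ler_pM2l //; apply: ge0_ler_powR; rewrite ?nnegrE ?(ltW al0) ?(ltW t0) ?(ltW R00) //.
exact: ltW.
Qed.
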